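(* Let $D_\circ$ be a hollow dissection. The collection of cones \[ \bigl\{\,\mathbb{R}_{\ge0}\{\mathbf{d}(D_\circ\mid\delta_\bullet):\delta_\bullet\in D_\bullet\} : D_\bullet \text{ a } D_\circ\text{-accordion dissection}\bigr\} \] forms a complete simplicial fan in $\mathbb{R}^{D_\circ}$ if and only if $D_\circ$ contains no even interior cell.
   Context: Fix $n\ge 2$ and $2n$ points on the unit circle, labeled $1,\dots,2n$ in clockwise order (labels modulo $2n$). Odd-labeled points are hollow, even-labeled ones solid. The hollow (resp. solid) polygon is the convex hull of the hollow (resp. solid) points. A hollow (resp. solid) diagonal joins two hollow (resp. two solid) points; polygon edges (boundary edges) count as diagonals, the others are internal. Two segments cross if they meet at a point interior to both. A hollow (resp. solid) dissection is a set of pairwise non-crossing internal hollow (resp. solid) diagonals; its cells are the closures of the connected components of the polygon minus its diagonals; $\overline{D}$ is $D$ together with all boundary edges of its polygon. For a hollow dissection $D_\circ$, a solid diagonal $\delta_\bullet$ is a $D_\circ$-accordion diagonal if the union of the segments of $\overline{D_\circ}$ crossed by $\delta_\bullet$ is connected. A $D_\circ$-accordion dissection is a solid dissection consisting of $D_\circ$-accordion diagonals. For a hollow diagonal $\delta_\circ = i\,j$ and a solid diagonal $\delta_\bullet$, set $c(\delta_\circ,\delta_\bullet)=-1$ if $\delta_\bullet$ is the segment $(i-1)(j-1)$, $c(\delta_\circ,\delta_\bullet)=1$ if $\delta_\bullet$ crosses $(i-1)(j-1)$, and $0$ otherwise. The $\mathbf{d}$-vector is $\mathbf{d}(D_\circ\mid\delta_\bullet)=\sum_{\delta_\circ\in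 D_\circ}c(\delta_\circ,\delta_\bullet)\,\mathbf{e}_{\delta_\circ}\in\mathbb{R}^{D_\circ}$, where $(\mathbf{e}_{\delta_\circ})$ is the canonical basis. An even interior cell of $D_\circ$ is a cell with an even number of edges, all of which are internal diagonals (elements of $D_\circ$). Simplicial fan: every cone is generated by linearly independent vectors; complete: union of cones is the whole space. *)

(* Defs.v *)
From mathcomp Require Import all_boot all_order all_algebra.
From mathcomp Require Import all_classical all_reals all_analysis.

Set Implicit Arguments.
Unset Strict Implicit.
Unset Printing Implicit Defensive.

Import Order.TTheory GRing.Theory Num.Theory.
Import numFieldNormedType.Exports.

Local Open Scope classical_set_scope.
Local Open Scope ring_scope.

(* The points are indexed by the labels modulo 2n, taken in 'I_(2 * n); the   *)
(* label 2n is thus the index 0, and ord_pred i is the label i - 1. As 2n is  *)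
(* even, the parity of a label is that of its index.                          *)

Definition on_unit_circle (R : realType) (I : Type) (p : I -> R * R) : Prop :=
  forall i, (p i).1 ^+ 2 + (p i).2 ^+ 2 = 1.

(* Twice the signed area of the triangle x y z; for three points of a circle  *)
(* it is negative exactly when x, y, z are met in this order when the circle  *)
(* is run clockwise.                                                          *)
Definition signed_area2 (R : realType) (x y z : R * R) : R :=
  (y.1 - x.1) * (z.2 - x.2) - (z.1 - x.1) * (y.2 - x.2).

Definition clockwise (R : realType) (m : nat) (p : 'I_m -> R * R) : Prop :=
  forall i j k : 'I_m, (i < j)%N -> (j < k)%N ->
    signed_area2 (p i) (p j) (p k) < 0.

Definition hollow (n : nat) : {set 'I_(2 * n)} := [set i : 'I_(2 * n) | odd i]%SET.
Definition solid (n : nat) : {set 'I_(2 * n)} := [set i : 'I_(2 * n) | ~~ odd i]%SET.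

(* Convex hull of the points labeled by A, and its relative interior. The     *)
(* segment joining the points i and j is hull p [set i; j].                   *)
Definition hull (R : realType) (I : finType) (p : I -> R * R) (A : {set I}) :
    set (R * R) :=
  [set x | exists w : I -> R,
     [/\ forall i, 0 <= w i,
         \sum_(i in A) w i = 1,
         x.1 = \sum_(i in A) w i * (p i).1
       & x.2 = \sum_(i in A) w i * (p i).2]].

Definition hull_interior (R : realType) (I : finType) (p : I -> R * R)
    (A : {set I}) : set (R * R) :=
  [set x | exists w : I -> R,
     [/\ forall i, 0 < w i,
         \sum_(i in A) w i = 1,
         x.1 = \sum_(i in A) w i * (p i).1
       & x.2 = \sum_(i in A) w i * (p i).2]].

Definition cross (R : realType) (I : finType) (p : I -> R * R)
    (d e : {set I}) : Prop :=
  hull_interior p d `&` hull_interior p e !=set0.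

(* From here on V is hollow n or solid n, and a diagonal is represented by    *)
(* the set of its two endpoints.                                              *)
Definition diagonals (n : nat) (V : {set 'I_(2 * n)}) :
    {set {set 'I_(2 * n)}} :=
  [set d : {set 'I_(2 * n)} | (d \subset V) && (#|d| == 2)]%SET.

(* Two consecutive points of the same colour differ by two labels.            *)
Definition boundary_edges (n : nat) (V : {set 'I_(2 * n)}) :
    {set {set 'I_(2 * n)}} :=
  [set d in diagonals V |
     [exists i, d == [set i; ord_pred (ord_pred i)]%SET]]%SET.

Definition dissection (R : realType) (n : nat) (p : 'I_(2 * n) -> R * R)
    (V : {set 'I_(2 * n)}) (D : {set {set 'I_(2 * n)}}) : Prop :=
  D \subset diagonals V :\: boundary_edges V /\
  (forall d e, d \in D -> e \in D -> d != e -> ~ cross p d e).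

Definition completion (n : nat) (V : {set 'I_(2 * n)})
    (D : {set {set 'I_(2 * n)}}) : {set {set 'I_(2 * n)}} :=
  D :|: boundary_edges V.

Definition is_cell (R : realType) (n : nat) (p : 'I_(2 * n) -> R * R)
    (V : {set 'I_(2 * n)}) (D : {set {set 'I_(2 * n)}})
    (C : set (R * R)) : Prop :=
  let U := hull p V `\` \bigcup_(d in [set` D]) hull p d in
  exists2 x, U x & C = closure (connected_component U x).

(* A cell is a convex polygon with no diagonal of D through its interior, so  *)
(* the members of the completion of D lying in it are exactly its edges.      *)
Definition cell_edges (R : realType) (n : nat) (p : 'I_(2 * n) -> R * R)
    (V : {set 'I_(2 * n)}) (D : {set {set 'I_(2 * n)}})
    (C : set (R * R)) : {set {set 'I_(2 * n)}} :=
  [set d in completion V D | `[< hull p d `<=` C >]]%SET.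

Definition even_interior_cell (R : realType) (n : nat)
    (p : 'I_(2 * n) -> R * R) (D : {set {set 'I_(2 * n)}})
    (C : set (R * R)) : Prop :=
  [/\ is_cell p (hollow n) D C,
      ~~ odd #|cell_edges p (hollow n) D C|
    & cell_edges p (hollow n) D C \subset D].

Definition accordion_diagonal (R : realType) (n : nat)
    (p : 'I_(2 * n) -> R * R) (D : {set {set 'I_(2 * n)}})
    (e : {set 'I_(2 * n)}) : Prop :=
  e \in diagonals (solid n) /\
  connected (\bigcup_(d in [set d | d \in completion (hollow n) D /\
                                    cross p d e]) hull p d).

Definition accordion_dissection (R : realType) (n : nat)
    (p : 'I_(2 * n) -> R * R) (D E : {set {set 'I_(2 * n)}}) : Prop :=
  dissection p (solid n) E /\
  (forall e, e \in E -> accordion_diagonal p D e).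

Definition shift_diagonal (n : nat) (d : {set 'I_(2 * n)}) :
    {set 'I_(2 * n)} :=
  [set ord_pred i | i in d]%SET.

Definition dcoef (R : realType) (n : nat) (p : 'I_(2 * n) -> R * R)
    (d e : {set 'I_(2 * n)}) : R :=
  if e == shift_diagonal d then -1
  else if `[< cross p (shift_diagonal d) e >] then 1 else 0.

(* R^D is 'rV[R]_#|D|, the coordinate of d in D being the one of index        *)
(* enum_rank_in _ d, i.e. the k such that enum_val k = d.                     *)
Definition dvector (R : realType) (n : nat) (p : 'I_(2 * n) -> R * R)
    (D : {set {set 'I_(2 * n)}}) (e : {set 'I_(2 * n)}) : 'rV[R]_#|D| :=
  \sum_(k < #|D|) dcoef p (enum_val k) e *: delta_mx 0 k.

Definition cone_gen (R : realType) (V : vectType R) (s : seq V) : set V :=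
  [set v | exists w : nat -> R,
     (forall i, 0 <= w i) /\ v = \sum_(i < size s) w i *: s`_i].

Definition is_face (R : realType) (V : vectType R) (tau sigma : set V) : Prop :=
  exists2 f : {scalar V}, (forall v, sigma v -> 0 <= f v) &
    tau = sigma `&` [set v | f v = 0].

Definition is_fan (R : realType) (V : vectType R) (F : set (set V)) : Prop :=
  [/\ forall sigma, F sigma -> exists s : seq V, sigma = cone_gen s,
      forall sigma tau, F sigma -> is_face tau sigma -> F tau
    & forall sigma tau, F sigma -> F tau ->
        is_face (sigma `&` tau) sigma /\ is_face (sigma `&` tau) tau].

Definition is_simplicial (R : realType) (V : vectType R) (F : set (set V)) :
    Prop :=
  forall sigma, F sigma -> exists2 s : seq V, free s & sigma = cone_gen s.

Definition is_complete (R : realType) (V : vectType R) (F : set (set V)) :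
    Prop :=
  \bigcup_(sigma in F) sigma = setT.

Definition complete_simplicial_fan (R : realType) (V : vectType R)
    (F : set (set V)) : Prop :=
  [/\ is_fan F, is_simplicial F & is_complete F].

Definition accordion_cones (R : realType) (n : nat) (p : 'I_(2 * n) -> R * R)
    (D : {set {set 'I_(2 * n)}}) : set (set 'rV[R]_#|D|) :=
  [set cone_gen [seq dvector p D e | e <- enum E] |
     E in [set E | accordion_dissection p D E]].
Arguments accordion_cones {R n} p D _.

(* Main.v *)
(* After identifying the solid and the hollow points with the same cyclic set of n points, a
   weighting of the accordion diagonals of an accordion dissection becomes a lamination w. The
   cones form a complete simplicial fan as soon as every vector is, in exactly one way, the
   coordinate vector of a lamination. This is shown by induction on the number of diagonals.
   Cutting along a diagonal a b that has diagonals on both sides, the leaves crossing it are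
   recovered from their traces on the two sides as the only noncrossing coupling of two measures
   of equal mass. If no such diagonal is left, all the diagonals are edges of one cell, and the
   weights c of its corners solve c (nx u) = min (y (nx u) - c u) (y (nx (nx u))) where
   y u = max 0 x_u is the required mass across the edge leaving u. Going once around the cell
   composes to a clamped t |-> r + t or t |-> r - t, so a solution exists; it is unique when the
   cell has an odd number of edges or an edge on the boundary.
   Conversely, around an even interior cell there are accordion diagonals crossing exactly two
   consecutive edges, with d-vectors e_u + e_(nx u). They satisfy one relation with alternating
   signs although each of them spans an extreme ray, so their cone is not simplicial. *)

(* The shift by -1 in the d-vector is what makes one index set enough: label 2i is the solid point
   i, label 2i + 1 the hollow point i, and hollow i shifts to solid i. Entries of d-vectors then
   compare chords of one n-gon ([cr]), while the accordion condition compares chords half a step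
   apart ([rx]). A positive coordinate on a b is the mass of the leaves crossing a b, a negative one
   is minus the weight of a b itself; the two exclude each other, so the coordinate fixes both,
   which allows gluing along a b. Laminations exist for every dissection; an even interior cell
   destroys uniqueness only. Uniqueness also gives independence of the generators, by splitting a
   linear relation into its positive and negative parts. Cutting must not change the polygon: a side
   keeps all n points and only forgets chords, and a leaf entering the forgotten region gets the
   single end allowed there. Topology enters in two places: connectedness of a union of segments
   becomes a statement on two-colourings, and a closed cell becomes a system of weak sign
   conditions. *)
From HB Require Import structures.
Require Import Defs.
From mathcomp Require Import all_boot all_order all_algebra.
From mathcomp Require Import zify ring lra.

Set Implicit Arguments.
Unset Strict Implicit.
Unset Printing Implicit Defensive.

Import Order.TTheory GRing.Theory Num.Theory.

(** * The cyclic order *)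

(* In the cyclic order of nat, k lies strictly between a and b when one goes up from a
   to b; never the case when a = b. *)
Definition btw (a k b : nat) : bool := [|| a < k < b, k < b < a | b < a < k].

(* A formula on the cyclic order of some naturals is decided on all their weak orders, which
   [ccheck] enumerates by inserting the variables one by one. *)
Inductive cform :=
| CBtw of nat & nat & nat | CEq of nat & nat | CTrue | CNot of cform
| CAnd of cform & cform | COr of cform & cform | CImp of cform & cform.

Fixpoint ceval (e : seq nat) (f : cform) : bool :=
  match f with
  | CBtw i j k => btw (nth 0 e i) (nth 0 e j) (nth 0 e k)
  | CEq i j => nth 0 e i == nth 0 e j
  | CTrue => true
  | CNot g => ~~ ceval e g
  | CAnd g h => ceval e g && ceval e h
  | COr g h => ceval e g || ceval e h
  | CImp g h => ceval e g ==> ceval e h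
  end.

(* Three-valued evaluation on the ranks of the first variables only. *)
Fixpoint ceval3 (e : seq nat) (f : cform) : option bool :=
  match f with
  | CBtw i j k =>
      match onth e i, onth e j, onth e k with
      | Some x, Some y, Some z => Some (btw x y z)
      | _, _, _ => None
      end
  | CEq i j =>
      match onth e i, onth e j with
      | Some x, Some y => Some (x == y) | _, _ => None end
  | CTrue => Some true
  | CNot g => omap negb (ceval3 e g)
  | CAnd g h =>
      match ceval3 e g with
      | Some false => Some false
      | Some true => ceval3 e h
      | None => if ceval3 e h is Some false then Some false else None
      end
  | COr g h =>
      match ceval3 e g with
      | Some true => Some true
      | Some false => ceval3 e h
      | None => if ceval3 e h is Some true then Some true else None
      end
  | CImp g h =>
      match ceval3 e g with
      | Some false => Some true
      | Some true => ceval3 e h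
      | None => if ceval3 e h is Some true then Some true else None
      end
  end.

(** [k] variables remain to be placed and [m] ranks are in use. The first [all] gives the new
    variable an existing rank, the second a new rank [g], which moves up the ranks from [g] on. A
    branch is closed as soon as [ceval3] decides the formula. *)
Fixpoint ccheck (k m : nat) (r : seq nat) (f : cform) : bool :=
  if ceval3 r f is Some b then b else
  if k is k'.+1 then
    all (fun g => ccheck k' m (rcons r g) f) (iota 0 m) &&
    all (fun g => ccheck k' m.+1
           (rcons (map (fun x => if g <= x then x.+1 else x) r) g) f)
        (m :: iota 0 m)
  else false.

Definition same_order (r e : seq nat) :=
  forall i j, i < size r -> j < size r ->
    (nth 0 r i < nth 0 r j) = (nth 0 e i < nth 0 e j).

Lemma onth_some (s : seq nat) i x : onth s i = Some x -> i < size s /\ nth 0 s i = x.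
Proof. by move=> h; split; [rewrite -onthTE h | exact: onth_nth]. Qed.

Lemma same_orderE r e i j : same_order r e -> i < size r -> j < size r ->
  (nth 0 r i == nth 0 r j) = (nth 0 e i == nth 0 e j).
Proof.
move=> h hi hj; rewrite !eqn_leq leqNgt (leqNgt (nth 0 r j)).
by rewrite !h // -!leqNgt.
Qed.

Lemma ceval3_sound r e f b : same_order r e -> ceval3 r f = Some b -> ceval e f = b.
Proof.
move=> h; elim: f b => [i j k|i j||g IH|g IHg g' IHg'|g IHg g' IHg'|g IHg g' IHg'] b /=.
- case Ei: (onth r i) => [x|//]; case Ej: (onth r j) => [y|//].
  case Ek: (onth r k) => [z|//] [<-].
  have [hi <-] := onth_some Ei; have [hj <-] := onth_some Ej; have [hk <-] := onth_some Ek.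
  by rewrite /btw !h.
- case Ei: (onth r i) => [x|//]; case Ej: (onth r j) => [y|//] [<-].
  have [hi <-] := onth_some Ei; have [hj <-] := onth_some Ej.
  by rewrite (same_orderE h).
- by case.
- by case: (ceval3 r g) IH => //= c /(_ c erefl) -> [<-].
- case: (ceval3 r g) IHg => [[]|] IHg.
  + by rewrite (IHg true) // => /IHg' ->.
  + by rewrite (IHg false) // => -[].
  + by case: (ceval3 r g') IHg' => [[]|] // /(_ false erefl) -> [<-]; rewrite andbF.
- case: (ceval3 r g) IHg => [[]|] IHg.
  + by rewrite (IHg true) // => -[].
  + by rewrite (IHg false) // => /IHg' ->.
  + by case: (ceval3 r g') IHg' => [[]|] // /(_ true erefl) -> [<-]; rewrite orbT.
- case: (ceval3 r g) IHg => [[]|] IHg.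
  + by rewrite (IHg true) // => /IHg' ->.
  + by rewrite (IHg false) // => -[].
  + by case: (ceval3 r g') IHg' => [[]|] // /(_ true erefl) -> [<-]; rewrite implybT.
Qed.

Lemma ccheck_sound k m r e f : size r + k = size e ->
  (forall i, i < size r -> nth 0 r i < m) ->
  same_order r e -> ccheck k m r f -> ceval e f.
Proof.
elim: k m r => [|k IH] m r hs hm h /=; case E: (ceval3 r f) => [b|] //.
- by rewrite (ceval3_sound h E).
- by rewrite (ceval3_sound h E).
set v := nth 0 e (size r).
have Q c : c < (size r).+1 -> ~~ (c < size r) -> c = size r.
  by rewrite -leqNgt => A B; apply/eqP; rewrite eqn_leq B andbT -ltnS.
case/andP=> /allP h1 h2.
case: (boolP (has (fun i => nth 0 e i == v) (iota 0 (size r)))).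
  case/hasP=> i; rewrite mem_iota add0n => hi /eqP Ei.
  apply: (IH m (rcons r (nth 0 r i))).
  - by rewrite size_rcons addSn -addnS.
  - move=> j; rewrite size_rcons nth_rcons => hj.
    case: (ltnP j (size r)) => h'; first exact: hm.
    by rewrite (Q j hj) ?eqxx ?hm // -leqNgt.
  - move=> a b; rewrite !size_rcons !nth_rcons => ha hb.
    case: (boolP (a < size r)) => ha'; last rewrite (Q _ ha ha') eqxx;
    case: (boolP (b < size r)) => hb'; try rewrite (Q _ hb hb') eqxx;
    rewrite ?h // ?Ei ?/v //.
  - by apply: h1; rewrite mem_iota add0n hm.
move/hasPn => hn.
have {}hn i : i < size r -> nth 0 e i != v.
  by move=> hi; apply: hn; rewrite mem_iota add0n.
(* The rank at which [v] is to be inserted: one more than the largest rank below it, or 0. *)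
pose g := \max_(i < size r | nth 0 e i < v) (nth 0 r i).+1.
have gle : g <= m by apply/bigmax_leqP => i _; apply: hm.
have gP i : i < size r -> (g <= nth 0 r i) = (v < nth 0 e i).
  move=> hi; rewrite [RHS]ltn_neqAle eq_sym hn //= leqNgt [RHS]leqNgt.
  congr (~~ _); apply/idP/idP => [|hv].
    apply: contraLR; rewrite -!leqNgt => hv.
    apply/bigmax_leqP => j hj; rewrite h //.
    exact: leq_trans hj hv.
  exact: (leq_bigmax_cond (Ordinal hi)).
apply: (IH m.+1 (rcons (map (fun x => if g <= x then x.+1 else x) r) g)).
- by rewrite size_rcons size_map addSn -addnS.
- move=> j; rewrite size_rcons size_map nth_rcons size_map => hj.
  case: (ltnP j (size r)) => h'; last by rewrite (Q j hj) ?eqxx ?ltnS // -leqNgt.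
  rewrite (nth_map 0) //; case: ifP => _; first by rewrite ltnS hm.
  by rewrite ltnW // ltnS hm.
- move=> a b; rewrite !size_rcons size_map !nth_rcons size_map => ha hb.
  case: (boolP (a < size r)) => ha'; last rewrite (Q _ ha ha') eqxx;
  case: (boolP (b < size r)) => hb'; try rewrite (Q _ hb hb') eqxx;
  rewrite ?(nth_map 0) //.
  + rewrite -(h a b) //; case: (leqP g (nth 0 r a)) => A; case: (leqP g (nth 0 r b)) => B.
    * by [].
    * by rewrite [RHS]ltnNge (leq_trans (ltnW B) A) /= ltnNge (leq_trans (ltnW B) (leqW A)).
    * by rewrite (leq_trans A B) (leq_trans A (leqW B)).
    * by [].
  + case: (leqP g (nth 0 r a)) => A; move: (gP a ha'); rewrite -/v.
      by rewrite A => /esym/ltnW; rewrite leqNgt => /negbTE ->; rewrite ltnNge leqW.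
    rewrite leqNgt A /= => /esym/negbT; rewrite -leqNgt leq_eqVlt (negbTE (hn a ha')) /=.
    by move=> ->.
  + case: (leqP g (nth 0 r b)) => A; move: (gP b hb'); rewrite -/v.
      by rewrite A ltnS A => <-.
    rewrite leqNgt A /= => <-.
    by rewrite ltnNge ltnW.
  + by rewrite !ltnn.
- case/andP: h2 => h2m /allP h2; move: gle; rewrite leq_eqVlt => /orP[/eqP -> //|gm].
  by apply: h2; rewrite mem_iota add0n.
Qed.

Lemma ccheckP e f : ccheck (size e) 0 [::] f -> ceval e f.
Proof. by apply: ccheck_sound. Qed.

(** * Reification of goals on the cyclic order *)

Ltac cyc_mem x l :=
  lazymatch l with
  | nil => false
  | x :: _ => true
  | _ :: ?t => cyc_mem x t
  end.
Ltac cyc_add x l :=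
  lazymatch cyc_mem x l with true => l | false => constr:(x :: l) end.
Ltac cyc_vars t l :=
  lazymatch t with
  | btw ?a ?b ?c => let l := cyc_add a l in let l := cyc_add b l in cyc_add c l
  | @eq_op _ ?a ?b => let l := cyc_add a l in cyc_add b l
  | true => l
  | negb ?a => cyc_vars a l
  | andb ?a ?b => let l := cyc_vars a l in cyc_vars b l
  | orb ?a ?b => let l := cyc_vars a l in cyc_vars b l
  | implb ?a ?b => let l := cyc_vars a l in cyc_vars b l
  end.
Ltac cyc_idx x l :=
  lazymatch l with
  | x :: _ => constr:(0)
  | _ :: ?t => let i := cyc_idx x t in constr:(S i)
  end.
Ltac cyc_reify t l :=
  lazymatch t with
  | btw ?a ?b ?c => let i := cyc_idx a l in let j := cyc_idx b l in
      let k := cyc_idx c l in constr:(CBtw i j k)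
  | @eq_op _ ?a ?b => let i := cyc_idx a l in let j := cyc_idx b l in constr:(CEq i j)
  | true => constr:(CTrue)
  | negb ?a => let f := cyc_reify a l in constr:(CNot f)
  | andb ?a ?b => let f := cyc_reify a l in let g := cyc_reify b l in constr:(CAnd f g)
  | orb ?a ?b => let f := cyc_reify a l in let g := cyc_reify b l in constr:(COr f g)
  | implb ?a ?b => let f := cyc_reify a l in let g := cyc_reify b l in constr:(CImp f g)
  end.
Definition cr (i j a b : nat) : bool := btw a i b && btw b j a || btw a j b && btw b i a.
(** The arc from [a] to [b], with [b] but without [a]; empty when [a = b]. As the solid point [k]
    stands just before the hollow point [k], these are the solid points strictly between the hollow
    points [a] and [b]. *)
Definition hb (a k b : nat) : bool := btw a k b || (k == b) && (a != b).
(* [rx i j x y] is the crossing of the solid chord i j with the hollow chord x y, the hollow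
   point i standing just after the solid point i. *)
Definition rx (i j x y : nat) : bool := hb x i y && hb y j x || hb x j y && hb y i x.

Lemma cyc_eqb (a b : bool) : (a ==> b) && (b ==> a) -> a = b.
Proof. by case: a b => [] []. Qed.
Ltac cyc_rev :=
  lazymatch goal with
  | |- is_true _ => idtac
  | |- @eq bool _ _ => apply: cyc_eqb
  | |- @eq nat _ _ => apply/eqP
  | |- @eq (ordinal _) _ _ => apply/eqP
  | |- False => apply: notF
  | |- _ -> _ => let H := fresh in intro H; cyc_rev; lazymatch type of H with @eq _ _ _ => apply (introT eqP) in H | _ => idtac end; revert H; refine (elimT implyP _)
  end.
Ltac cyc :=
  rewrite /cr /rx /hb -?val_eqE /=; cyc_rev; rewrite -?val_eqE /=;
  rewrite -?[false]/(~~ true);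
  lazymatch goal with
  | |- is_true ?t =>
      let l := cyc_vars t (@nil nat) in
      let f := cyc_reify t l in
      refine (@ccheckP l f _); vm_compute; reflexivity
  end.

(** * Chords and accordions *)

Section Chords.
Variable n : nat.
Implicit Types (a b c i j k l x y z : 'I_n) (D : rel 'I_n).

Definition adj i j := (ordS i == j) || (ordS j == i).

Definition noncrossing D :=
  [/\ symmetric D, forall x y, D x y -> (x != y) && ~~ adj x y
    & forall x y x' y', D x y -> D x' y' -> ~~ cr x y x' y'].

(* The chord i j of the solid polygon is an accordion: a colouring of the hollow points that is
   constant on each edge it crosses is constant on all of them. *)
Definition acc D i j := forall P : 'I_n -> bool,
  (forall x y, D x y || adj x y -> rx i j x y -> P x = P y) ->
  forall x y x' y', D x y || adj x y -> rx i j x y ->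
    D x' y' || adj x' y' -> rx i j x' y' -> P x = P x'.

(** The polygon is not cut down: all n points stay, and only the chords with an end strictly between
    [a] and [b] are dropped, [a b] being kept. A side is thus again a dissection of the same
    polygon, and the induction needs no relabelling. *)
Definition side a b D : rel 'I_n := fun x y => [&& D x y, ~~ btw a x b & ~~ btw a y b].

Lemma ordSE i : (ordS i : nat) = if i.+1 == n then 0 else i.+1.
Proof.
rewrite /=; case: eqP => [->|/eqP h]; first by rewrite modnn.
by rewrite modn_small // ltn_neqAle h ltn_ord.
Qed.

Lemma btw_ordS i k : ~~ btw i k (ordS i).
Proof.
rewrite ordSE; move: (nat_of_ord i) (nat_of_ord k) (ltn_ord i) (ltn_ord k) => {}i {}k hi hk.
by rewrite /btw; case: eqP => h; lia.
Qed.

Lemma ordS_inj : injective (@ordS n).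
Proof. exact: can_inj (@ordSK n). Qed.

Lemma ordS_neq i : 1 < n -> ordS i != i.
Proof.
move=> hn; apply/eqP => /(congr1 (@nat_of_ord n)); rewrite ordSE; case: eqP => h; lia.
Qed.

Lemma ordS_gap k i : k != i -> ordS k != i -> btw k (ordS k) i.
Proof.
have h := btw_ordS k i; move=> h1 h2; have h3 : ordS k != k.
  apply: ordS_neq; case: n k i {h h2} h1 => [|[|m]] // [k hk] [i hi] //.
  by rewrite -val_eqE /=; lia.
by move: h h1 h2 h3; cyc.
Qed.

Lemma crC i j a b : cr i j a b = cr a b i j.
Proof. by cyc. Qed.

Lemma rx_sym i j x y : rx i j x y = rx i j y x.
Proof. by cyc. Qed.
Lemma rx_symi i j x y : rx i j x y = rx j i x y.
Proof. by cyc. Qed.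
Lemma adjC i j : adj i j = adj j i.
Proof. by rewrite /adj orbC. Qed.

Lemma acc_sym D i j : acc D i j -> acc D j i.
Proof.
move=> h P hP x y x' y' h1 h2 h3 h4; apply: (h P _ x y x' y') => //; rewrite 1?rx_symi //.
by move=> u v huv; rewrite rx_symi; apply: hP.
Qed.

Lemma noncrossing_sym D x y : noncrossing D -> D x y = D y x.
Proof. by case. Qed.

Lemma edgeC D x y : noncrossing D -> (D x y || adj x y) = (D y x || adj y x).
Proof. by move=> hD; rewrite noncrossing_sym // adjC. Qed.

Lemma side_noncrossing D a b : noncrossing D -> noncrossing (side a b D).
Proof.
case=> h1 h2 h3; split.
- by move=> x y; rewrite /side h1; case: (D y x) => //=; rewrite andbC.
- by move=> x y /and3P[/h2].
- by move=> x y x' y' /and3P[h _ _] /and3P[h' _ _]; apply: h3.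
Qed.

Lemma side_ends D a b : D a b -> side a b D a b.
Proof. by move=> h; rewrite /side h /=; cyc. Qed.

Section Side.
Variables (D : rel 'I_n) (a b : 'I_n).
Hypotheses (hD : noncrossing D) (hab : D a b).

Lemma ends_neq : a != b. Proof. by case: hD => _ /(_ _ _ hab)/andP[]. Qed.
Lemma ends_nadj : ~~ adj a b. Proof. by case: hD => _ /(_ _ _ hab)/andP[]. Qed.
Lemma ends_btw : btw a (ordS a) b.
Proof.
apply: ordS_gap; first exact: ends_neq.
by apply: contra ends_nadj => /eqP <-; rewrite /adj eqxx.
Qed.

Lemma chord_side x y : D x y || adj x y -> btw a x b -> ~~ btw b y a.
Proof.
case/orP => [h|].
  by case: hD => _ _ /(_ _ _ _ _ h hab); cyc.
case/orP => /eqP <-.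
  move: (btw_ordS x b) (btw_ordS x a); cyc.
move: (btw_ordS y b) (btw_ordS y a); cyc.
Qed.

Lemma side_sub x y : side a b D x y || adj x y -> D x y || adj x y.
Proof. by case/orP => [/and3P[->]|->] //; rewrite orbT. Qed.

(* An edge crossed by k l and starting strictly between a and b must end in b, and then k or l
   is b. *)
Lemma acc_side k l : ~~ btw a k b -> ~~ btw a l b -> k != l ->
  acc D k l <-> acc (side a b D) k l.
Proof.
move=> hk hl hkl.
have hn : 1 < n by move: hkl; rewrite -val_eqE /=; have := ltn_ord k; have := ltn_ord l; lia.
pose b' := ord_pred b.
have Sb' : ordS b' = b by exact: ord_predK.
have inner x y : D x y || adj x y -> btw a x b -> rx k l x y -> y = b /\ (k = b \/ l = b).
  move=> hxy hx hr; have := chord_side hxy hx => hy.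
  have /andP[/eqP-> /orP[]/eqP->] : (y == b) && ((k == b) || (l == b)); auto.
  by move: hx hy hk hl hkl hr; cyc.
have hb' : k = b \/ l = b -> adj b' b /\ rx k l b' b.
  move=> hh; split; first by rewrite /adj Sb' eqxx.
  have h1 : b' != b by have := ordS_neq b' hn; rewrite Sb' eq_sym.
  have h2 := btw_ordS b' k; have h3 := btw_ordS b' l; rewrite Sb' in h2 h3.
  by case: hh => hh; move: hh h2 h3 h1 hkl => <-; cyc.
split=> h P hP.
(* The inner points get the colour of [b], the only point to which a crossed edge can join them. *)
- pose P' x := if btw a x b then P b else P x.
  have hP' x y : D x y || adj x y -> rx k l x y -> P' x = P' y.
    move=> hxy hr; rewrite /P'.
    case: (boolP (btw a x b)) => hx.
      have [-> hk'] := inner _ _ hxy hx hr.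
      by case: ifP.
    case: (boolP (btw a y b)) => hy.
      have hyx : D y x || adj y x by rewrite edgeC.
      by have [-> hk'] := inner _ _ hyx hy (etrans (rx_sym _ _ _ _) hr).
    apply: hP => //; rewrite /side hx hy !andbT //.
  have hPx x y : side a b D x y || adj x y -> rx k l x y -> P x = P' x.
    move=> hxy hr; rewrite /P'; case: ifP => // hx.
    rewrite (hP x y hxy hr).
    by have [->] := inner _ _ (side_sub hxy) hx hr.
  move=> x y x' y' h1 h2 h3 h4.
  rewrite (hPx _ _ h1 h2) (hPx _ _ h3 h4); apply: (h P' hP' x y x' y') => //; exact: side_sub.
- have hP2 x y : side a b D x y || adj x y -> rx k l x y -> P x = P y.
    by move=> hxy; apply: hP; exact: side_sub.
  (* A crossed edge with an inner end is replaced by the boundary edge [b' b], which is crossed as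
     well, belongs to the side and has the same colour. *)
  have hPx x y : D x y || adj x y -> rx k l x y ->
     exists x' y', [/\ side a b D x' y' || adj x' y', rx k l x' y' & P x = P x'].
    move=> hxy hr; case: (boolP (btw a x b)) => hx.
      have [e /hb'[hb1 hb2]] := inner _ _ hxy hx hr.
      exists b', b; split; rewrite ?hb1 ?orbT //.
      by rewrite (hP _ _ hxy hr) e; apply/esym/hP2 => //; rewrite hb1 orbT.
    case: (boolP (btw a y b)) => hy.
      have hyx : D y x || adj y x by rewrite edgeC.
      have [e /hb'[hb1 hb2]] := inner _ _ hyx hy (etrans (rx_sym _ _ _ _) hr).
      exists b', b; split; rewrite ?hb1 ?orbT //.
      by rewrite e; apply/esym/hP2 => //; rewrite hb1 orbT.
    by exists x, y; rewrite /side hx hy !andbT.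
  move=> x y x' y' h1 h2 h3 h4.
  have [u [v [e1 e2 ->]]] := hPx _ _ h1 h2; have [u' [v' [e3 e4 ->]]] := hPx _ _ h3 h4.
  exact: (h P hP2 u v u' v').
Qed.

(* A leaf entering the undissected side between a and b must stop at [ordS a]. *)
Lemma acc_side_end k l : acc (side a b D) k l -> k != l -> ~~ adj k l -> btw a l b ->
  btw b k a /\ l = ordS a.
Proof.
move=> h hkl hadj hl.
have hn : 1 < n by move: hkl; rewrite -val_eqE /=; have := ltn_ord k; have := ltn_ord l; lia.
suff : btw b k a && (l == ordS a) by case/andP => -> /eqP.
apply/idPn => hneg.
pose l' := ord_pred l; pose k' := ord_pred k.
have Sl : ordS l' = l by exact: ord_predK.
have Sk : ordS k' = k by exact: ord_predK.
have hl' := ordS_neq l' hn; rewrite Sl in hl'.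
have hk' := ordS_neq k' hn; rewrite Sk in hk'.
have kl' : k != l' by apply: contra hadj => /eqP ->; rewrite /adj Sl eqxx.
have k'l : k' != l by apply: contra hadj => /eqP e; rewrite /adj -e Sk eqxx orbT.
have k'l' : k' != l' by apply: contra hkl => /eqP e; rewrite -Sk e Sl.
clearbody l' k'.
have rad (u u' v : 'I_n) : ordS u' = u -> u != v -> rx u v u' u.
  move=> <- huv; have := btw_ordS u' v; have := ordS_neq u' hn; move: huv; cyc.
(* The boundary edge [l' l] is crossed. Unless the conclusion holds, no other crossed edge touches
   it, since the side has no chord with an end strictly between [a] and [b]; this colouring then
   separates it from the crossed edge [k' k]. *)
pose P x := (x == l) || (x == l').
have half x y : side a b D x y || adj x y -> rx k l x y -> P x -> P y.
  case/orP => [/and3P[_ hx hy]|].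
    move=> hr /orP[/eqP e|/eqP e]; first by rewrite e hl in hx.
    exfalso; subst x.
    have : (l == ordS a) = (l' == a) by rewrite -Sl (inj_eq ordS_inj).
    move: hneg => + e; rewrite e => hneg.
    have := btw_ordS l' a; have := btw_ordS l' b; have := btw_ordS l' k; rewrite Sl.
    move: hl hx hy hr hneg hl' kl' hkl; cyc.
  have hk1 := btw_ordS l k.
  have hSl : k != ordS l by apply: contra hadj => /eqP ->; rewrite /adj eqxx orbT.
  have hSl0 := ordS_neq l hn.
  case/orP => /eqP e hr /orP[/eqP hx|/eqP hx].
  - by exfalso; move: hr; rewrite -e hx; move: hk1 hSl hSl0 hkl; cyc.
  - by rewrite /P -e hx Sl eqxx.
  - have yl : y = l' by apply: ordS_inj; rewrite Sl e.
    by rewrite /P yl eqxx orbT.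
  - case: (boolP (P y)) => // /norP[yl _].
    exfalso; have := btw_ordS y k; have := btw_ordS y l; have := ordS_neq y hn.
    rewrite e hx; move: yl.
    have : btw k l' l || ~~ btw k l' l by case: btw.
    have := btw_ordS l' k; rewrite Sl.
    by move: hr; rewrite hx; move: hkl hl' kl'; cyc.
have := h P _ l' l k' k.
have adjS (u u' : 'I_n) : ordS u' = u -> adj u' u by move=> <-; rewrite /adj eqxx.
rewrite (adjS _ _ Sl) (adjS _ _ Sk) !orbT rad // rx_symi rad // 1?eq_sym //.
rewrite /P eqxx orbT (negbTE k'l) (negbTE k'l') => /(_ _ isT isT isT isT) A.
suff : true = false by []; apply: A => x y hxy hr; apply/idP/idP; apply: half => //.
  by rewrite edgeC //; exact: side_noncrossing.
by rewrite rx_sym.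
Qed.

(** Outside the arc from [a] to [b], the chords [k j] and [k (ordS a)] cross the same edges, among
    them [a b]. A colouring for the side extends to [D] by giving the inner points the colour of
    [a], which is also that of [b]. *)
Lemma acc_cut_side k j : btw b k a -> btw a j b -> acc D k j -> acc (side a b D) k (ordS a).
Proof.
move=> hk hj h P hP; have ha := ends_btw.
have hSab : rx k (ordS a) a b by move: hk ha; cyc.
have hSa : rx k (ordS a) a (ordS a).
  by have := btw_ordS a k; move: hk ha; cyc.
have Pab : P a = P b by apply: hP; rewrite // side_ends.
have PaS : P (ordS a) = P a.
  by apply/esym/hP => //; rewrite /adj eqxx orbT.
pose P' x := if btw a x b then P a else P x.
have hP' x y : D x y || adj x y -> rx k j x y -> P' x = P' y.
  move=> hxy hr; rewrite /P'.
  have hyx : D y x || adj y x by rewrite edgeC.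
  case: (boolP (btw a x b)) => hx; case: (boolP (btw a y b)) => hy //.
  - have := chord_side hxy hx => hy'.
    have [/eqP-> //|/eqP-> //] : y == a \/ y == b by apply/orP; move: hy hy' hx; cyc.
  - have := chord_side hyx hy => hx'.
    have [/eqP-> //|/eqP-> //] : x == a \/ x == b by apply/orP; move: hy hx' hx; cyc.
  apply: hP; first by rewrite /side hx hy !andbT.
  by move: hr hk hj ha hx hy; cyc.
have all x y : side a b D x y || adj x y -> rx k (ordS a) x y -> P x = P a.
  move=> hxy hr.
  have hyx : side a b D y x || adj y x by rewrite edgeC //; exact: side_noncrossing.
  have out u v : side a b D u v || adj u v -> rx k (ordS a) u v ->
      ~~ btw a u b -> ~~ btw a v b -> P u = P a.
    move=> huv hr' hu hv.
    have := h P' hP' u v a b; rewrite /P' (negbTE hu).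
    have -> : btw a a b = false by cyc.
    apply=> //; first exact: side_sub.
    - by move: hr' hk hj ha hu hv; cyc.
    - by rewrite hab.
    - by move: hk hj; cyc.
  have inn u v : side a b D u v || adj u v -> rx k (ordS a) u v -> btw a u b -> u = ordS a.
    case/orP => [/and3P[_ /negP //]|] /orP[] /eqP <- hr' hu; apply/eqP.
      have := btw_ordS a u; have := btw_ordS u k; have := btw_ordS u (ordS a); have := btw_ordS u b.
      by move: hr' hu hk ha; cyc.
    have := btw_ordS a (ordS v); have := btw_ordS v k; have := btw_ordS v (ordS a).
    have := btw_ordS v a; have := btw_ordS v b; have := btw_ordS a v.
    by move: hr' hu hk ha; cyc.
  case: (boolP (btw a x b)) => hx; first by rewrite (inn _ _ hxy hr hx).
  case: (boolP (btw a y b)) => hy; last exact: (out x y).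
  by rewrite (hP _ _ hxy hr) (inn _ _ hyx _ hy) // rx_sym.
by move=> x y x' y' h1 h2 h3 h4; rewrite (all _ _ h1 h2) (all _ _ h3 h4).
Qed.
End Side.

(** Each edge crossed by [k j] lies on one side of [a b], where the accordion property of that half
    links it to [a b]; and [a b] is crossed by both halves. *)
Lemma acc_glue D a b k j : noncrossing D -> D a b -> btw b k a -> btw a j b ->
  acc (side a b D) k (ordS a) -> acc (side b a D) (ordS b) j -> acc D k j.
Proof.
move=> hD hab hk hj h1 h2 P hP.
have hba : D b a by rewrite noncrossing_sym.
have ha := ends_btw hD hab; have hb := ends_btw hD hba.
have rab : rx k j a b by move: hk hj; cyc.
have Pab : P a = P b by apply: hP; rewrite ?hab.
(* The chord and the leaf are free here, because the claim is used once for each direction of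
   [a b]. *)
have key c d k' j' : D c d -> btw d k' c -> btw c j' d -> P c = P d ->
    (forall x y, D x y || adj x y -> rx k' j' x y -> P x = P y) ->
    acc (side c d D) k' (ordS c) ->
    forall x y, D x y || adj x y -> rx k' j' x y -> ~~ btw c x d -> ~~ btw c y d -> P x = P c.
  move=> hcd hk' hj' Pcd hPc hacc x y hxy hr hx hy.
  have hc := ends_btw hD hcd.
  pose P' x := if btw c x d then P c else P x.
  have hP' u v : side c d D u v || adj u v -> rx k' (ordS c) u v -> P' u = P' v.
    move=> huv hr'; rewrite /P'.
    have huv' : D u v || adj u v by exact: side_sub huv.
    have hvu' : D v u || adj v u by rewrite edgeC.
    case: (boolP (btw c u d)) => hu; case: (boolP (btw c v d)) => hv //.
    - have := chord_side hD hcd huv' hu => hv'.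
      have [/eqP-> //|/eqP-> //] : v == c \/ v == d by apply/orP; move: hv hv' hu; cyc.
    - have := chord_side hD hcd hvu' hv => hu'.
      have [/eqP-> //|/eqP-> //] : u == c \/ u == d by apply/orP; move: hv hu' hu; cyc.
    by apply: hPc => //; move: hr' hk' hj' hc hu hv; cyc.
  have := hacc P' hP' x y c d; rewrite /P' (negbTE hx).
  have -> : btw c c d = false by cyc.
  apply=> //.
  - by rewrite /side hx hy !andbT.
  - by move: hr hk' hj' hc hx hy; cyc.
  - by rewrite side_ends.
  - by move: hk' hc; cyc.
have all x y : D x y || adj x y -> rx k j x y -> P x = P a.
  move=> hxy hr.
  have hyx : D y x || adj y x by rewrite edgeC.
  case: (boolP (btw a x b || btw a y b)) => hin.
    have [hx hy] : ~~ btw b x a /\ ~~ btw b y a.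
      case/orP: hin => hin.
        by have h := chord_side hD hab hxy hin; split; move: h hin; cyc.
      by have h := chord_side hD hab hyx hin; split; move: h hin; cyc.
    rewrite Pab; apply: (key b a j k hba hj hk _ _ _ x y) => //.
    - by move=> u v huv hr'; apply: hP => //; rewrite rx_symi.
    - exact: acc_sym.
    - by rewrite rx_symi.
  case/norP: hin => hx hy.
  exact: (key a b k j hab hk hj _ _ _ x y).
by move=> x y x' y' e1 e2 e3 e4; rewrite (all _ _ e1 e2) (all _ _ e3 e4).
Qed.
End Chords.

Local Open Scope ring_scope.

(** * Couplings *)

Section Coupling.
Variable R : realFieldType.

Lemma sum_neq0 (T : finType) (P : pred T) (F : T -> R) :
  \sum_(i | P i) F i != 0 -> exists2 i, P i & F i != 0.
Proof.
move=> h; apply/exists_inP; apply: contraNT h; rewrite negb_exists_in => /forall_inP h.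
by apply/eqP/big1 => i hi; apply/eqP; rewrite -[_ == _]negbK h.
Qed.

Lemma min_supermodular (x x' y y' : R) : x <= x' -> y <= y' ->
  Num.min x y' + Num.min x' y <= Num.min x' y' + Num.min x y.
Proof.
move=> h h'; case: (leP x' y) => h1.
  by rewrite (min_l (le_trans h1 h')) (min_l (le_trans h (le_trans h1 h'))) (min_l (le_trans h h1)); lra.
case: (leP x y) => h2.
  by rewrite (min_l (le_trans h2 h')); case: (leP x' y'); lra.
by case: (leP x y') => h3; case: (leP x' y') => h4; lra.
Qed.

(** The north-west corner coupling: [q] is the mixed difference of [min (A i) (B j)], where [A] and
    [B] are the cumulated masses. It is nonnegative by supermodularity of the minimum, its marginals
    come from telescoping, and it charges [i j] only if the intervals from [A i] to [A i.+1] and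
    from [B j] to [B j.+1] overlap, hence it is monotone. *)
Lemma coupling_nat (N : nat) (mu nu : nat -> R) :
  (forall i, 0 <= mu i) -> (forall i, 0 <= nu i) ->
  \sum_(i < N) mu i = \sum_(i < N) nu i ->
  exists q : nat -> nat -> R,
  [/\ forall i j, 0 <= q i j,
      forall i, (i < N)%N -> \sum_(j < N) q i j = mu i,
      forall j, (j < N)%N -> \sum_(i < N) q i j = nu j
    & forall i j i' j', q i j != 0 -> q i' j' != 0 -> (i < i')%N -> (j <= j')%N].
Proof.
move=> hmu hnu hs.
pose A (i : nat) := \sum_(k < i) mu k; pose B (i : nat) := \sum_(k < i) nu k.
have AS i : A i.+1 = A i + mu i by rewrite /A big_ord_recr.
have BS i : B i.+1 = B i + nu i by rewrite /B big_ord_recr.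
have Ale i j : (i <= j)%N -> A i <= A j.
  by move=> /subnK <-; elim: (j - i)%N => // k IH; rewrite addSn AS; have := hmu (k + i)%N; lra.
have Ble i j : (i <= j)%N -> B i <= B j.
  by move=> /subnK <-; elim: (j - i)%N => // k IH; rewrite addSn BS; have := hnu (k + i)%N; lra.
have A0 : A 0%N = 0 by rewrite /A big_ord0.
have B0 : B 0%N = 0 by rewrite /B big_ord0.
pose q i j := Num.min (A i.+1) (B j.+1) - Num.min (A i) (B j.+1) -
  Num.min (A i.+1) (B j) + Num.min (A i) (B j).
have qpos i j : 0 <= q i j.
  by have := min_supermodular (Ale _ _ (leqnSn i)) (Ble _ _ (leqnSn j)); rewrite /q; lra.
have qn i j : q i j != 0 -> A i < B j.+1 /\ B j < A i.+1.
  have h1 := Ale _ _ (leqnSn i); have h2 := Ble _ _ (leqnSn j).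
  move=> h; split; rewrite ltNge; apply: contra h => h; apply/eqP; rewrite /q.
  - rewrite (min_r h) (min_r (le_trans h h1)) (min_r (le_trans h2 h)).
    by rewrite (min_r (le_trans h2 (le_trans h h1))); lra.
  - rewrite (min_l h) (min_l (le_trans h h2)) (min_l (le_trans h1 h)).
    by rewrite (min_l (le_trans h1 (le_trans h h2))); lra.
have tel (f : nat -> R) : \sum_(j < N) (f j.+1 - f j) = f N - f 0%N.
  by rewrite -(big_mkord xpredT (fun j => f j.+1 - f j)) telescope_sumr.
exists q; split=> //.
- move=> i hi; have hBA : A i.+1 <= B N by rewrite /B -hs; exact: Ale.
  rewrite (eq_bigr (fun j : 'I_N =>
      (Num.min (A i.+1) (B j.+1) - Num.min (A i) (B j.+1)) -
      (Num.min (A i.+1) (B j) - Num.min (A i) (B j)))); last by move=> j _; rewrite /q; lra.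
  rewrite (tel (fun j => Num.min (A i.+1) (B j) - Num.min (A i) (B j))) B0.
  have h0 i' : 0 <= A i' by rewrite -A0 Ale.
  by rewrite !(min_r (h0 _)) (min_l hBA) (min_l (le_trans (Ale _ _ (leqnSn i)) hBA)) AS; lra.
- move=> j hj; have hBA : B j.+1 <= A N by rewrite /A hs; exact: Ble.
  rewrite (eq_bigr (fun i : 'I_N =>
      (Num.min (A i.+1) (B j.+1) - Num.min (A i.+1) (B j)) -
      (Num.min (A i) (B j.+1) - Num.min (A i) (B j)))); last by move=> i _; rewrite /q; lra.
  rewrite (tel (fun i => Num.min (A i) (B j.+1) - Num.min (A i) (B j))) A0.
  have h0 i' : 0 <= B i' by rewrite -B0 Ble.
  by rewrite !(min_l (h0 _)) (min_r hBA) (min_r (le_trans (Ble _ _ (leqnSn j)) hBA)) BS; lra.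
- move=> i j i' j' /qn[_ h1] /qn[h2 _] hi; rewrite leqNgt; apply/negP => hj.
  have := Ale _ _ hi; have := Ble _ _ hj; lra.
Qed.

(* A noncrossing coupling is determined by its marginals, since on a product of two down sets
   its mass is the smaller of the two marginal masses. *)
Lemma coupling_down (T U : finType) (P1 : pred T) (P2 : pred U) (q : T -> U -> R)
    (A : pred T) (B : pred U) :
  (forall k j, P1 k -> P2 j -> 0 <= q k j) ->
  (forall k j k' j', P1 k -> P2 j -> P1 k' -> P2 j' -> q k j != 0 -> q k' j' != 0 ->
     A k -> ~~ B j -> ~~ A k' -> B j' -> false) ->
  \sum_(k | P1 k && A k) \sum_(j | P2 j && B j) q k j =
  Num.min (\sum_(k | P1 k && A k) \sum_(j | P2 j) q k j)
          (\sum_(j | P2 j && B j) \sum_(k | P1 k) q k j).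
Proof.
move=> hq hx.
pose S1 := \sum_(k | P1 k && A k) \sum_(j | P2 j && ~~ B j) q k j.
pose S2 := \sum_(k | P1 k && ~~ A k) \sum_(j | P2 j && B j) q k j.
have -> : \sum_(k | P1 k && A k) \sum_(j | P2 j) q k j =
   \sum_(k | P1 k && A k) \sum_(j | P2 j && B j) q k j + S1.
  by rewrite /S1 -big_split; apply: eq_bigr => k _; rewrite (bigID B).
have -> : \sum_(j | P2 j && B j) \sum_(k | P1 k) q k j =
   \sum_(k | P1 k && A k) \sum_(j | P2 j && B j) q k j + S2.
  by rewrite /S2 exchange_big [RHS]addrC [LHS]/= (bigID A) /= addrC.
have S1p : 0 <= S1.
  by apply: sumr_ge0 => k /andP[hk _]; apply: sumr_ge0 => j /andP[hj _]; exact: hq.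
have S2p : 0 <= S2.
  by apply: sumr_ge0 => k /andP[hk _]; apply: sumr_ge0 => j /andP[hj _]; exact: hq.
suff [->|->] : S1 = 0 \/ S2 = 0.
- by rewrite addr0; case: leP => //; lra.
- by rewrite addr0; case: leP => //; lra.
have ex (C1 : pred T) (C2 : pred U) : \sum_(k | P1 k && C1 k) \sum_(j | P2 j && C2 j) q k j != 0 ->
    exists k j, [/\ P1 k, C1 k, P2 j, C2 j & q k j != 0].
  by case/sum_neq0=> k /andP[hk1 hk2] /sum_neq0[j /andP[hj1 hj2] h]; exists k, j.
case: (eqVneq S1 0) => [|/ex[k [j [a1 a2 a3 a4 a5]]]]; first by left.
case: (eqVneq S2 0) => [|/ex[k' [j' [b1 b2 b3 b4 b5]]]]; first by right.
by have := hx k j k' j' a1 a3 b1 b3 a5 b5 a2 a4 b2 b4.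
Qed.

Variable n : nat.

Lemma coupling_cyc (a b : 'I_n) (m1 m2 : 'I_n -> R) :
  (forall i, 0 <= m1 i) -> (forall i, 0 <= m2 i) ->
  \sum_(k < n | btw b k a) m1 k = \sum_(j < n | btw a j b) m2 j ->
  exists q : 'I_n -> 'I_n -> R,
  [/\ forall i j, 0 <= q i j,
      forall k : 'I_n, btw b k a -> \sum_(j < n | btw a j b) q k j = m1 k,
      forall j : 'I_n, btw a j b -> \sum_(k < n | btw b k a) q k j = m2 j
    & forall k j k' j' : 'I_n, btw b k a -> btw a j b -> btw b k' a -> btw a j' b ->
       q k j != 0 -> q k' j' != 0 -> ~~ cr k j k' j'].
Proof.
move=> h1 h2 hs.
pose M1 (k : 'I_n) := if btw b k a then m1 k else 0.
pose M2 (j : 'I_n) := if btw a j b then m2 j else 0.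
have M1p i : 0 <= M1 i by rewrite /M1; case: ifP.
have M2p i : 0 <= M2 i by rewrite /M2; case: ifP.
pose pos (x : 'I_n) : nat := if (b <= x)%N then (x - b)%N else (x + n - b)%N.
have posl x : (pos x < n)%N by rewrite /pos; have := ltn_ord x; have := ltn_ord b; case: (leqP b x); lia.
pose posO x := Ordinal (posl x).
have posI : injective posO.
  move=> x y /(congr1 val) /=; rewrite /pos => e; apply: val_inj => /=.
  by have := ltn_ord x; have := ltn_ord y; have := ltn_ord b; move: e; case: (leqP b x); case: (leqP b y); lia.
pose rposO x := rev_ord (posO x).
have rposI : injective rposO by move=> x y /rev_ord_inj/posI.
pose mu (s : nat) := \sum_(x | posO x == s :> nat) M1 x.
pose nu (s : nat) := \sum_(x | rposO x == s :> nat) M2 x.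
have muE x : mu (posO x) = M1 x.
  by rewrite /mu (big_pred1 x) // => y; rewrite (inj_eq val_inj) (inj_eq posI).
have nuE x : nu (rposO x) = M2 x.
  by rewrite /nu (big_pred1 x) // => y; rewrite (inj_eq val_inj) (inj_eq rposI).
have [q [q1 q2 q3 q4]] : exists q : nat -> nat -> R,
  [/\ forall i j, 0 <= q i j,
      forall i, (i < n)%N -> \sum_(j < n) q i j = mu i,
      forall j, (j < n)%N -> \sum_(i < n) q i j = nu j
    & forall i j i' j', q i j != 0 -> q i' j' != 0 -> (i < i')%N -> (j <= j')%N].
  apply: coupling_nat.
  - by move=> i; apply: sumr_ge0.
  - by move=> i; apply: sumr_ge0.
  rewrite (reindex_inj posI) (eq_bigr _ (fun x _ => muE x)).
  rewrite [RHS](reindex_inj rposI) [RHS](eq_bigr _ (fun x _ => nuE x)).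
  by rewrite /M1 /M2 -!big_mkcond.
pose Q k j := q (posO k) (rposO j).
have Q1 k : \sum_j Q k j = M1 k.
  by rewrite -muE -q2 // [RHS](reindex_inj rposI).
have Q2 j : \sum_k Q k j = M2 j.
  by rewrite -nuE -q3 // [RHS](reindex_inj posI).
have Z1 (k j : 'I_n) : ~~ btw b k a -> Q k j = 0.
  move=> hk; have := Q1 k; rewrite /M1 (negbTE hk) => /eqP.
  by rewrite psumr_eq0 => [/allP/(_ j (mem_index_enum _))/eqP|i _]; rewrite ?q1.
have Z2 (k j : 'I_n) : ~~ btw a j b -> Q k j = 0.
  move=> hk; have := Q2 j; rewrite /M2 (negbTE hk) => /eqP.
  by rewrite psumr_eq0 => [/allP/(_ k (mem_index_enum _))/eqP|i _]; rewrite ?q1.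
exists Q; split.
- by move=> i j; exact: q1.
- move=> k hk; rewrite big_mkcond; have := Q1 k; rewrite /M1 hk => <-.
  by apply: eq_bigr => j _; case: ifPn => // /Z2 ->.
- move=> j hj; rewrite big_mkcond; have := Q2 j; rewrite /M2 hj => <-.
  by apply: eq_bigr => k _; case: ifPn => // /Z1 ->.
move=> k j k' j' hk hj hk' hj' n1 n2.
have a1 := q4 _ _ _ _ n1 n2; have a2 := q4 _ _ _ _ n2 n1.
apply/negP => hcr.
have : btw b k k' && btw a j j' || btw b k' k && btw a j' j by move: hk hj hk' hj' hcr; cyc.
have P1 (x y : 'I_n) : btw b x y -> (pos x < pos y)%N.
  by rewrite /pos /btw; have := ltn_ord x; have := ltn_ord y; have := ltn_ord b;
    case: (leqP b x); case: (leqP b y); lia.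
case/orP => /andP[h h'].
  have hp' : btw b j j' by move: hj hj' h'; cyc.
  by move: (a1 (P1 _ _ h)) (P1 _ _ hp') (posl j') ; rewrite /=; clear; lia.
have hp' : btw b j' j by move: hj hj' h'; cyc.
by move: (a2 (P1 _ _ h)) (P1 _ _ hp') (posl j) ; rewrite /=; clear; lia.
Qed.

Lemma coupling_cyc_uniq (a b : 'I_n) (q q' : 'I_n -> 'I_n -> R) :
  (forall k j, 0 <= q k j) -> (forall k j, 0 <= q' k j) ->
  (forall k : 'I_n, btw b k a -> \sum_(j < n | btw a j b) q k j = \sum_(j < n | btw a j b) q' k j) ->
  (forall j : 'I_n, btw a j b -> \sum_(k < n | btw b k a) q k j = \sum_(k < n | btw b k a) q' k j) ->
  (forall k j k' j' : 'I_n, btw b k a -> btw a j b -> btw b k' a -> btw a j' b ->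
       q k j != 0 -> q k' j' != 0 -> ~~ cr k j k' j') ->
  (forall k j k' j' : 'I_n, btw b k a -> btw a j b -> btw b k' a -> btw a j' b ->
       q' k j != 0 -> q' k' j' != 0 -> ~~ cr k j k' j') ->
  forall k j : 'I_n, btw b k a -> btw a j b -> q k j = q' k j.
Proof.
move=> p1 p2 r1 r2 c1 c2.
pose H (f : 'I_n -> 'I_n -> R) (U V : pred 'I_n) :=
  \sum_(k < n | btw b k a && U k) \sum_(j < n | btw a j b && V j) f k j.
have HM (f : 'I_n -> 'I_n -> R) (U V : pred 'I_n) : (forall k j, 0 <= f k j) ->
    (forall k j k' j' : 'I_n, btw b k a -> btw a j b -> btw b k' a -> btw a j' b ->
       f k j != 0 -> f k' j' != 0 -> ~~ cr k j k' j') -> (forall k k' : 'I_n, btw b k a -> btw b k' a -> btw b k' k -> U k -> U k') ->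
    (forall j j' : 'I_n, btw a j b -> btw a j' b -> btw j j' b -> V j -> V j') ->
    H f U V = Num.min (\sum_(k < n | btw b k a && U k) \sum_(j < n | btw a j b) f k j)
                      (\sum_(j < n | btw a j b && V j) \sum_(k < n | btw b k a) f k j).
  move=> f0 fc hU hV; apply: (@coupling_down _ _ (fun k : 'I_n => btw b k a) (fun j : 'I_n => btw a j b)) => //.
  move=> k j k' j' hk hj hk' hj' n1 n2 Uk Vj Uk' Vj'.
  have h1 : k != k' by apply: contraNneq Uk' => <-.
  have h2 : j != j' by apply: contraNneq Vj => ->.
  have h3 : ~~ btw b k' k by apply: contraNN Uk' => h; exact: (hU k).
  have h4 : ~~ btw j' j b by apply: contraNN Vj => h; exact: (hV j').
  by have := fc _ _ _ _ hk hj hk' hj' n1 n2; move: h1 h2 h3 h4 hk hj hk' hj'; cyc.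
have HE (U V : pred 'I_n) : (forall k k' : 'I_n, btw b k a -> btw b k' a -> btw b k' k -> U k -> U k') ->
    (forall j j' : 'I_n, btw a j b -> btw a j' b -> btw j j' b -> V j -> V j') -> H q U V = H q' U V.
  move=> hU hV; rewrite !HM //; congr Num.min; apply: eq_bigr => k /andP[hk _]; first exact: r1.
  exact: r2.
move=> k j hk hj.
(* [U] and [V] are the down sets, counted from [b], that end at [k] and [j]; [U0] and [V0] omit
   these last points. Then [q k j] is the mixed difference of the masses of the four products. *)
pose U (x : 'I_n) := (x == k) || btw b x k; pose U0 (x : 'I_n) := btw b x k.
pose V (x : 'I_n) := (x == j) || btw j x b; pose V0 (x : 'I_n) := btw j x b.
have hU : forall x x' : 'I_n, btw b x a -> btw b x' a -> btw b x' x -> U x -> U x'.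
  by move=> x x'; rewrite /U; move: hk; cyc.
have hU0 : forall x x' : 'I_n, btw b x a -> btw b x' a -> btw b x' x -> U0 x -> U0 x'.
  by move=> x x'; rewrite /U0; move: hk; cyc.
have hV : forall x x' : 'I_n, btw a x b -> btw a x' b -> btw x x' b -> V x -> V x'.
  by move=> x x'; rewrite /V; move: hj; cyc.
have hV0 : forall x x' : 'I_n, btw a x b -> btw a x' b -> btw x x' b -> V0 x -> V0 x'.
  by move=> x x'; rewrite /V0; move: hj; cyc.
have E f : f k j = H f U V - H f U0 V - H f U V0 + H f U0 V0.
  have E1 (g : 'I_n -> R) : \sum_(x < n | btw a x b && V x) g x = g j + \sum_(x < n | btw a x b && V0 x) g x.
    rewrite (bigD1 j) /=; last by rewrite hj /V eqxx.
    by congr (_ + _); apply: eq_bigl => x; rewrite /V /V0; cyc.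
  have E2 (g : 'I_n -> R) : \sum_(x < n | btw b x a && U x) g x = g k + \sum_(x < n | btw b x a && U0 x) g x.
    rewrite (bigD1 k) /=; last by rewrite hk /U eqxx.
    by congr (_ + _); apply: eq_bigl => x; rewrite /U /U0; cyc.
  by rewrite /H !E2 E1; lra.
by rewrite (E q) (E q') !HE.
Qed.
End Coupling.

(** * Laminations *)

Section Laminations.
Variables (R : realFieldType) (n : nat).
Implicit Types (a b c d i j k l x y z : 'I_n) (D : rel 'I_n) (w : 'I_n -> 'I_n -> R).

(* The coordinate on the chord a b of the sum of the d-vectors of the accordions weighted by w. *)
Definition icoord w a b :=
  \sum_(i < n | btw a i b) \sum_(j < n | btw b j a) w i j - w a b.

Definition lamination D w :=
  [/\ forall i j, w i j = w j i,
      forall i j, 0 <= w i j,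
      forall i j, w i j != 0 -> [/\ i != j, ~~ adj i j & acc D i j]
    & forall i j k l, w i j != 0 -> w k l != 0 -> ~~ cr i j k l].

Lemma icoord_sym w a b : (forall i j, w i j = w j i) -> icoord w a b = icoord w b a.
Proof.
move=> h; rewrite /icoord exchange_big /= (h a b); congr (_ - _).
by apply: eq_bigr => i _; apply: eq_bigr.
Qed.

(** A leaf along [a b] and a leaf across it would cross, so one of the two terms of [icoord]
    vanishes and they are its positive and negative parts. *)
Lemma lam_chord D w a b : lamination D w ->
  w a b = Num.max 0 (- icoord w a b) /\
  \sum_(i < n | btw a i b) \sum_(j < n | btw b j a) w i j = Num.max 0 (icoord w a b).
Proof.
case=> h1 h2 _ h4; rewrite /icoord; set S := \sum_(i < n | _) _.
have S0 : 0 <= S by apply: sumr_ge0 => i _; apply: sumr_ge0.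
suff [->|->] : S = 0 \/ w a b = 0.
- by have := h2 a b; rewrite sub0r opprK => h; rewrite (max_r h) max_l //; lra.
- by rewrite subr0 (max_r S0) max_l //; lra.
case: (eqVneq (w a b) 0) => [|hab]; [by right|left].
apply: big1 => i hi; apply: big1 => j hj; apply/eqP.
by apply: contraT => hij; have := h4 _ _ _ _ hab hij; move: hi hj; cyc.
Qed.

(* The weights left when the side between a and b is no longer dissected: the leaves entering
   it all end at [ordS a]. *)
Definition push a b w k l : R :=
  if btw a k b then
    (if btw b l a && (k == ordS a) then \sum_(j < n | btw a j b) w l j else 0)
  else if btw a l b then
    (if btw b k a && (l == ordS a) then \sum_(j < n | btw a j b) w k j else 0)
  else w k l.

Lemma push_out a b w k l : ~~ btw a k b -> ~~ btw a l b -> push a b w k l = w k l.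
Proof. by rewrite /push => /negbTE -> /negbTE ->. Qed.

Lemma push_end a b w k : btw a (ordS a) b -> btw b k a ->
  push a b w k (ordS a) = \sum_(j < n | btw a j b) w k j.
Proof.
move=> ha hk; rewrite /push ha hk eqxx /=.
by have -> : btw a k b = false by move: hk; cyc.
Qed.

Lemma push_sym a b w : (forall i j, w i j = w j i) ->
  forall i j, push a b w i j = push a b w j i.
Proof.
move=> h i j; rewrite /push (h i j).
case: (boolP (btw a i b)) => hi; case: (boolP (btw a j b)) => hj //.
have -> : btw b j a = false by move: hj; cyc.
by have -> : btw b i a = false by move: hi; cyc.
Qed.

Lemma push_row a b w k (B : pred 'I_n) : btw a (ordS a) b -> btw b k a ->
  (forall j, btw a j b -> B j) ->
  \sum_(j | B j) push a b w k j = \sum_(j | B j) w k j.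
Proof.
move=> ha hk hB; have hka : btw a k b = false by move: hk; cyc.
rewrite (bigID (fun j : 'I_n => btw a j b)) [RHS](bigID (fun j : 'I_n => btw a j b)) /=.
congr (_ + _); last by apply: eq_bigr => j /andP[_ hj]; rewrite push_out ?hka.
rewrite (bigD1 (ordS a)) /=; last by rewrite ha hB.
rewrite push_end // [X in _ + X]big1 ?addr0 => [|j /andP[/andP[_ hj] hja]]; last first.
  by rewrite /push hka hj (negbTE hja) andbF.
by apply: eq_bigl => j; case: (boolP (btw a j b)) => [/hB ->|]; rewrite ?andbF.
Qed.

(** The arc from [a] to [b] lies entirely on one side of [c d], so moving ends inside this arc does
    not change the mass across [c d]. Exchanging [c] and [d] brings the arc into the range of the
    inner sum, where [push_row] applies. *)
Lemma push_icoord a b w c d : btw a (ordS a) b -> (forall i j, w i j = w j i) ->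
  ~~ cr a b c d -> c != d -> ~~ btw a c b -> ~~ btw a d b ->
  icoord (push a b w) c d = icoord w c d.
Proof.
move=> ha hw.
wlog : c d / ~~ btw c (ordS a) d.
  move=> H hcr hcd hc hd; case: (boolP (btw c (ordS a) d)) => h; last exact: H.
  rewrite (icoord_sym _ _ (push_sym _ _ hw)) (icoord_sym _ _ hw); apply: H => //.
  - by move: h; cyc.
  - by move: hcr; cyc.
  - by rewrite eq_sym.
move=> h hcr hcd hc hd; rewrite /icoord push_out //; congr (_ - _).
apply: eq_bigr => i hi; apply: push_row => //.
- by move: h hcr hcd hc hd hi ha; cyc.
- by move=> j; move: h hcr hcd hc hd hi ha; cyc.
Qed.

Section Cut.
Variables (D : rel 'I_n) (a b : 'I_n).
Hypotheses (hD : noncrossing D) (hab : D a b).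

Let hba : D b a. Proof. by rewrite noncrossing_sym. Qed.
Let ha := ends_btw hD hab.

Lemma icoord_push w c d : (forall i j, w i j = w j i) -> side a b D c d ->
  icoord (push a b w) c d = icoord w c d.
Proof.
move=> hw /and3P[hcd hc hd]; apply: push_icoord => //.
  by case: hD => _ _ /(_ _ _ _ _ hab hcd).
by case: hD => _ /(_ _ _ hcd)/andP[].
Qed.

Lemma push_neq0 w k l : (forall i j, 0 <= w i j) -> push a b w k l != 0 ->
  [\/ [/\ ~~ btw a k b, ~~ btw a l b & w k l != 0],
      [/\ btw b k a, l = ordS a & exists2 j : 'I_n, btw a j b & w k j != 0]
    | [/\ btw b l a, k = ordS a & exists2 j : 'I_n, btw a j b & w l j != 0]].
Proof.
move=> hw.
rewrite /push; case: ifPn => hk.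
  case: ifP => [/andP[hl /eqP->] /sum_neq0 h|_]; last by rewrite eqxx.
  by constructor 3.
case: ifPn => hl.
  case: ifP => [/andP[hk' /eqP->] /sum_neq0 h|_]; last by rewrite eqxx.
  by constructor 2.
by constructor 1.
Qed.

Lemma lamination_push w : lamination D w -> lamination (side a b D) (push a b w).
Proof.
case=> h1 h2 h3 h4; split.
- exact: push_sym.
- move=> k l; rewrite /push; do 2?[case: ifP => _]; rewrite ?sumr_ge0 //.
  by case: ifP => _; rewrite ?sumr_ge0.
- have nadj (k : 'I_n) : btw b k a -> k != ordS a /\ ~~ adj k (ordS a).
    move=> hk; split; first by move: hk ha; cyc.
    apply/negP => /orP[/eqP/ordS_inj e|/eqP e]; first by move: hk; rewrite e; cyc.
    by have := btw_ordS (ordS a) b; rewrite e; move: hk ha; cyc.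
  have acc' (k j : 'I_n) : btw b k a -> btw a j b -> w k j != 0 -> acc (side a b D) k (ordS a).
    by move=> hk hj /h3[_ _ h]; exact: (acc_cut_side hD hab hk hj h).
  move=> k l /(push_neq0 h2)[[hk hl hw]|[hk -> [j hj hw]]|[hl -> [j hj hw]]].
  + by have [e1 e2 e3] := h3 _ _ hw; split=> //; apply/(acc_side hD hab).
  + by have [e1 e2] := nadj _ hk; split=> //; exact: acc' hw.
  + have [e1 e2] := nadj _ hl; split; rewrite 1?eq_sym 1?adjC //.
    by apply: acc_sym; exact: acc' hw.
(* A pushed leaf comes from a leaf of [w] with the same ends outside the arc. All moved ends
   coincide in [ordS a], so two pushed leaves can cross only if the leaves they come from do. *)
have wit (k l : 'I_n) : push a b w k l != 0 -> exists k' l', w k' l' != 0 /\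
    [|| [&& ~~ btw a k b, ~~ btw a l b, k == k' & l == l'],
        [&& btw b k a, l == ordS a, k == k' & btw a l' b] |
        [&& btw b l a, k == ordS a, l == l' & btw a k' b]].
  move=> /(push_neq0 h2)[[hk hl hw]|[hk -> [j hj hw]]|[hl -> [j hj hw]]].
  - by exists k, l; rewrite hk hl !eqxx hw.
  - by exists k, j; rewrite hk hj !eqxx hw orbT.
  - by exists j, l; rewrite hl hj !eqxx h1 hw !orbT.
move=> i j k l /wit[i' [j' [hw hij]]] /wit[k' [l' [hw' hkl]]].
have hcr := h4 _ _ _ _ hw hw'; clear - ha hij hkl hcr.
by case/or3P: hij => /and4P[e1 e2 e3 e4]; case/or3P: hkl => /and4P[f1 f2 f3 f4];
  move: ha e1 e2 e3 e4 f1 f2 f3 f4 hcr; cyc.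
Qed.

Lemma side_leaf w k l : lamination (side a b D) w -> btw a l b -> w k l != 0 ->
  btw b k a /\ l = ordS a.
Proof. by case=> _ _ h _ hl /h[h1 h2 h3]; exact: (acc_side_end hD hab h3). Qed.

Lemma side_total w : lamination (side a b D) w ->
  \sum_(i < n | btw a i b) \sum_(j < n | btw b j a) w i j =
  \sum_(k < n | btw b k a) w k (ordS a).
Proof.
move=> hw; rewrite (bigD1 (ordS a)) //= [X in _ + X]big1 ?addr0 => [|i /andP[hi hia]].
  by apply: eq_bigr => j _; case: hw.
apply: big1 => j hj; apply/eqP; apply: contraT => hij.
have [] := @side_leaf w j i hw hi; first by case: hw => ->.
by move=> _ e; rewrite e eqxx in hia.
Qed.

End Cut.

Lemma side_total2 D a b w : noncrossing D -> D a b -> lamination (side b a D) w ->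
  \sum_(i < n | btw a i b) \sum_(j < n | btw b j a) w i j =
  \sum_(k < n | btw a k b) w (ordS b) k.
Proof.
move=> hD hab hw; rewrite exchange_big /=.
have hba : D b a by rewrite noncrossing_sym.
rewrite -(eq_bigr _ (fun k _ => (let: And4 h _ _ _ := hw in h) k (ordS b))).
rewrite -(side_total hD hba hw); apply: eq_bigr => i _; apply: eq_bigr => j _.
by case: hw.
Qed.

(* The leaves crossing a b are the noncrossing coupling of their traces on the two sides. *)
Lemma lamination_glue D a b w1 w2 : noncrossing D -> D a b ->
  lamination (side a b D) w1 -> lamination (side b a D) w2 ->
  icoord w1 a b = icoord w2 a b ->
  exists w, [/\ lamination D w,
    forall c d, side a b D c d -> icoord w c d = icoord w1 c d
  & forall c d, side b a D c d -> icoord w c d = icoord w2 c d].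
Proof.
move=> hD hab L1 L2 hx.
have hba : D b a by rewrite noncrossing_sym.
have ha := ends_btw hD hab; have hb := ends_btw hD hba.
have [s1 p1 u1 c1] := L1; have [s2 p2 u2 c2] := L2.
have [e1 t1] := lam_chord a b L1; have [e2 t2] := lam_chord a b L2.
(* The two marginals have equal mass because both masses are the positive part of the common
   coordinate on [a b]. *)
have [q [qp q1 q2 qc]] : exists q : 'I_n -> 'I_n -> R,
  [/\ forall i j, 0 <= q i j,
      forall k : 'I_n, btw b k a -> \sum_(j < n | btw a j b) q k j = w1 k (ordS a),
      forall j : 'I_n, btw a j b -> \sum_(k < n | btw b k a) q k j = w2 (ordS b) j
    & forall k j k' j' : 'I_n, btw b k a -> btw a j b -> btw b k' a -> btw a j' b ->
       q k j != 0 -> q k' j' != 0 -> ~~ cr k j k' j'].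
  apply: coupling_cyc => //.
  by rewrite -(side_total hD hab L1) -(side_total2 hD hab L2) t1 t2 hx.
pose w k j := if ~~ btw a k b && ~~ btw a j b then w1 k j else
  if ~~ btw b k a && ~~ btw b j a then w2 k j else
  if btw b k a then q k j else q j k.
have wo k j : ~~ btw a k b -> ~~ btw a j b -> w k j = w1 k j by rewrite /w => -> ->.
have sw k j : w k j = w j k.
  rewrite /w s1 s2 ![in RHS](andbC (~~ btw _ j _)).
  case: ifPn => // A1; case: ifPn => // A2; case: ifPn => A3; case: ifPn => A4 //.
    by exfalso; move: A1 A2 A3 A4; cyc.
  by exfalso; move: A1 A2 A3 A4; cyc.
(* The only pair common to both sides is [a b], where each weight is the negative part of the common
   coordinate. *)
have w12 k j : ~~ btw a k b -> ~~ btw a j b -> ~~ btw b k a -> ~~ btw b j a -> w1 k j = w2 k j.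
  move=> h1 h2 h3 h4; case: (eqVneq k j) => [->|kj].
    transitivity (0 : R); [|apply/esym]; apply/eqP; apply: contraT.
      by move=> /u1[]; rewrite eqxx.
    by move=> /u2[]; rewrite eqxx.
  have : (k == a) && (j == b) || (k == b) && (j == a) by have := ends_neq hD hab; move: h1 h2 h3 h4 kj; cyc.
  have e12 : w1 a b = w2 a b by rewrite e1 e2 hx.
  by case/orP => /andP[/eqP-> /eqP->]; rewrite // s1 s2.
have wi k j : ~~ btw b k a -> ~~ btw b j a -> w k j = w2 k j.
  move=> h1 h2; rewrite /w; case: ifP => [/andP[h3 h4]|_]; first exact: w12.
  by rewrite h1 h2.
have wm k j : btw b k a -> btw a j b -> w k j = q k j by rewrite /w => -> ->; rewrite andbF.
have cases (k j : 'I_n) : [\/ ~~ btw a k b /\ ~~ btw a j b, ~~ btw b k a /\ ~~ btw b j a,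
     btw b k a /\ btw a j b | btw b j a /\ btw a k b].
  case: (boolP (btw a k b)) => h1; case: (boolP (btw a j b)) => h2.
  - by constructor 2; split; [move: h1|move: h2]; cyc.
  - case: (boolP (btw b j a)) => h3; first by constructor 4.
    by constructor 2; split=> //; move: h1; cyc.
  - case: (boolP (btw b k a)) => h3; first by constructor 3.
    by constructor 2; split=> //; move: h2; cyc.
  - by constructor 1.
(* The pushes of [w] to the two sides give back [w1] and [w2], so [icoord_push] transfers their
   coordinates to [w]. *)
have P1 k j : push a b w k j = w1 k j.
  have Z x y : btw a y b -> ~~ (btw b x a && (y == ordS a)) -> w1 x y = 0.
    move=> hy h; apply/eqP; apply: contraT => hn; case/negP: h.
    by have [-> ->] := side_leaf hD hab L1 hy hn; rewrite eqxx.
  have T x : btw b x a -> \sum_(j < n | btw a j b) w x j = w1 x (ordS a).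
    by move=> hx'; rewrite -q1 //; apply: eq_bigr => z hz; apply: wm.
  rewrite /push; case: ifPn => hk.
    case: ifPn => [/andP[hj /eqP->]|h]; first by rewrite T // s1.
    by rewrite s1 Z.
  case: ifPn => hj; last exact: wo.
  by case: ifPn => [/andP[hk' /eqP->]|h]; [rewrite T|rewrite Z].
have P2 k j : push b a w k j = w2 k j.
  have Z x y : btw b y a -> ~~ (btw a x b && (y == ordS b)) -> w2 x y = 0.
    move=> hy h; apply/eqP; apply: contraT => hn; case/negP: h.
    by have [-> ->] := side_leaf hD hba L2 hy hn; rewrite eqxx.
  have T x : btw a x b -> \sum_(j < n | btw b j a) w x j = w2 x (ordS b).
    by move=> hx'; rewrite s2 -q2 //; apply: eq_bigr => z hz; rewrite sw; apply: wm.
  rewrite /push; case: ifPn => hk.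
    case: ifPn => [/andP[hj /eqP->]|h]; first by rewrite T // s2.
    by rewrite s2 Z.
  case: ifPn => hj; last exact: wi.
  by case: ifPn => [/andP[hk' /eqP->]|h]; [rewrite T|rewrite Z].
exists w; split.
- have qn1 k j : btw b k a -> btw a j b -> q k j != 0 -> w1 k (ordS a) != 0.
    move=> hk hj hq; rewrite -q1 // psumr_neq0 //; apply/hasP; exists j; rewrite ?mem_index_enum //.
    by rewrite hj lt_neqAle eq_sym hq qp.
  have qn2 k j : btw b k a -> btw a j b -> q k j != 0 -> w2 (ordS b) j != 0.
    move=> hk hj hq; rewrite -q2 // psumr_neq0 //; apply/hasP; exists k; rewrite ?mem_index_enum //.
    by rewrite hk lt_neqAle eq_sym hq qp.
  have accm k j : btw b k a -> btw a j b -> q k j != 0 ->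
      [/\ k != j, ~~ adj k j & acc D k j].
    move=> hk hj hq; have [_ _ a1] := u1 _ _ (qn1 _ _ hk hj hq).
    have [_ _ a2] := u2 _ _ (qn2 _ _ hk hj hq).
    split; last exact: (acc_glue hD hab hk hj).
      by move: hk hj; cyc.
    apply/negP => /orP[]/eqP e.
      by have := btw_ordS k a; have := btw_ordS k b; rewrite e; move: hk hj; cyc.
    by have := btw_ordS j a; have := btw_ordS j b; rewrite e; move: hk hj; cyc.
  split=> //.
  + by move=> k j; rewrite /w; do 3?[case: ifP => _].
  + move=> k j; case: (cases k j) => -[hk hj].
    * by rewrite wo // => /u1[? ? h]; split=> //; apply/(acc_side hD hab).
    * by rewrite wi // => /u2[? ? h]; split=> //; apply/(acc_side hD hba).
    * by rewrite wm //; exact: accm.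
    * rewrite sw wm // => /(accm _ _ hk hj)[e3 e4 e5]; rewrite eq_sym adjC; split=> //.
      exact: acc_sym.
  have half k j k' j' : btw b k a -> btw a j b -> q k j != 0 -> w k' j' != 0 -> ~~ cr k j k' j'.
    move=> hk hj hq; case: (cases k' j') => -[hk' hj'].
    * rewrite wo // => hn; have := c1 _ _ _ _ (qn1 _ _ hk hj hq) hn.
      by move: hk hj hk' hj' ha; cyc.
    * rewrite wi // => hn; have := c2 _ _ _ _ (qn2 _ _ hk hj hq) hn.
      by move: hk hj hk' hj' hb; cyc.
    * by rewrite wm // => hn; exact: qc.
    * rewrite sw wm // => hn; have := qc _ _ _ _ hk hj hk' hj' hq hn.
      by cyc.
  move=> k j k' j' h h'; case: (cases k j) => -[hk hj].
  + case: (cases k' j') => -[hk' hj'].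
    * by apply: c1; rewrite -wo.
    * by have := ends_neq hD hab; move: hk hj hk' hj'; cyc.
    * by rewrite crC half // -wm.
    * have := half _ _ _ _ hk' hj' _ h; rewrite -wm // sw => /(_ h'); cyc.
  + case: (cases k' j') => -[hk' hj'].
    * by have := ends_neq hD hab; move: hk hj hk' hj'; cyc.
    * by apply: c2; rewrite -wi.
    * by rewrite crC half // -wm.
    * have := half _ _ _ _ hk' hj' _ h; rewrite -wm // sw => /(_ h'); cyc.
  + by apply: half => //; rewrite -wm.
  + have := half _ _ _ _ hk hj _ h'; rewrite -wm // sw => /(_ h); cyc.
- move=> c d hcd; rewrite -(icoord_push hD hab sw hcd) /icoord P1; congr (_ - _).
  by apply: eq_bigr => i _; apply: eq_bigr => j _; rewrite P1.
- move=> c d hcd; rewrite -(icoord_push hD hba sw hcd) /icoord P2; congr (_ - _).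
  by apply: eq_bigr => i _; apply: eq_bigr => j _; rewrite P2.
Qed.

Lemma side_or D a b c d : noncrossing D -> D a b -> D c d -> side a b D c d \/ side b a D c d.
Proof.
case=> _ _ h hab hcd; have := h _ _ _ _ hab hcd; rewrite /side hcd /=.
move=> hc; apply/orP; move: hc; cyc.
Qed.

Definition lam_unique D := forall w w', lamination D w -> lamination D w' ->
  (forall c d, D c d -> icoord w c d = icoord w' c d) -> forall i j, w i j = w' i j.

Lemma lam_unique_cut D a b : noncrossing D -> D a b ->
  lam_unique (side a b D) -> lam_unique (side b a D) -> lam_unique D.
Proof.
move=> hD hab U1 U2 w w' L L' hx.
have hba : D b a by rewrite noncrossing_sym.
have ha := ends_btw hD hab; have hb := ends_btw hD hba.
have [s _ _ c] := L; have [s' _ _ c'] := L'.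
have E1 k j : push a b w k j = push a b w' k j.
  apply: U1; try exact: lamination_push.
  by move=> x y hxy; rewrite !(icoord_push hD hab) //; apply: hx; case/and3P: hxy.
have E2 k j : push b a w k j = push b a w' k j.
  apply: U2; try exact: lamination_push.
  by move=> x y hxy; rewrite !(icoord_push hD hba) //; apply: hx; case/and3P: hxy.
(* The values of the two pushes at [ordS a] and [ordS b] are the marginals of the leaves crossing
   [a b]. *)
have M : forall k j : 'I_n, btw b k a -> btw a j b -> w k j = w' k j.
  apply: coupling_cyc_uniq.
  - by case: L.
  - by case: L'.
  - by move=> k hk; have := E1 k (ordS a); rewrite !push_end.
  - move=> j hj; have := E2 j (ordS b); rewrite !push_end //.
    rewrite (eq_bigr (fun k => w k j)) => [|k _]; last by [].
    by rewrite [RHS](eq_bigr (fun k => w' k j)).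
  - by move=> k j k' j' _ _ _ _; exact: c.
  - by move=> k j k' j' _ _ _ _; exact: c'.
move=> k j.
case: (boolP (btw a k b)) => h1; case: (boolP (btw a j b)) => h2.
- have h3 : ~~ btw b k a by move: h1; cyc.
  have h4 : ~~ btw b j a by move: h2; cyc.
  by have := E2 k j; rewrite !push_out.
- case: (boolP (btw b j a)) => h3; first by rewrite s s'; exact: M.
  have h4 : ~~ btw b k a by move: h1; cyc.
  by have := E2 k j; rewrite !push_out.
- case: (boolP (btw b k a)) => h3; first exact: M.
  have h4 : ~~ btw b j a by move: h2; cyc.
  by have := E2 k j; rewrite !push_out.
- by have := E1 k j; rewrite !push_out.
Qed.
End Laminations.

(** * The corner system of a cell *)

Section Clamp.
Variable R : realFieldType.
Implicit Types (a b p q r t : R).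

(** One step of the corner recursion preserves clamped maps of slope 1 or -1: the slope changes sign
    and the two bounds exchange their roles. *)
Lemma clamp_step p q r (e : bool) a b t : p <= q ->
  Num.min (a - Num.max p (Num.min q (if e then r + t else r - t))) b =
  Num.max (Num.min (a - q) b)
    (Num.min (Num.min (a - p) b) (if ~~ e then (a - r) + t else (a - r) - t)).
Proof.
move=> pq.
have -> : (if ~~ e then (a - r) + t else (a - r) - t) = a - (if e then r + t else r - t).
  by case: e => /=; lra.
move: (if e then r + t else r - t) => z.
have mono x x' : x <= x' -> Num.min x b <= Num.min x' b.
  by move=> h; rewrite le_min ge_min h ge_min lexx orbT.
have lez x x' : x <= x' -> a - x' <= a - x by move=> h; rewrite lerD2l lerN2.
case: (leP q z) => [qz|/ltW zq].
  by rewrite (max_r pq) max_l // le_min !ge_min (lez _ _ qz) lexx !orbT.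
case: (leP p z) => [pz|/ltW zp].
  have -> : Num.min (Num.min (a - p) b) (a - z) = Num.min (a - z) b.
    by rewrite -minA minC -minA (min_l (lez _ _ pz)) minC.
  by rewrite max_r // mono // lez.
have -> : Num.min (Num.min (a - p) b) (a - z) = Num.min (a - p) b.
  by rewrite min_l // ge_min lez.
by rewrite max_r // mono // lez.
Qed.

(** A clamped translation fixes [q] or [p] according to the sign of [r]; a clamped reflection fixes
    its centre [r / 2] moved into the interval. *)
Lemma clamp_fixed p q r (e : bool) : p <= q ->
  exists t, Num.max p (Num.min q (if e then r + t else r - t)) = t.
Proof.
move=> pq; case: e.
  case: (leP 0 r) => hr; [exists q|exists p].
    by rewrite min_l ?max_r //; lra.
  by rewrite (min_r (y := r + p)) ?max_l //; lra.
exists (Num.max p (Num.min q (r / 2))).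
case: (leP q (r / 2)) => h1; first by rewrite (max_r pq) min_l ?max_r //; lra.
case: (leP p (r / 2)) => h2; first by rewrite min_r ?max_r //; lra.
by rewrite min_r ?max_l //; lra.
Qed.
End Clamp.

Section Cyclic.
Variable n : nat.
Implicit Types (i j k u v x y z : 'I_n).

Definition next_in (K : {set 'I_n}) (nx : 'I_n -> 'I_n) :=
  forall u, u \in K -> [/\ nx u \in K, nx u != u & forall k, k \in K -> ~~ btw u k (nx u)].

Section NextIn.
Variables (K : {set 'I_n}) (nx : 'I_n -> 'I_n).
Hypothesis hK : next_in K nx.

(** The element of [S] with the shortest way up to [z] works, since otherwise its successor would be
    nearer; the way from [z] to itself counts as a full turn. Any [S] stable under [nx] is allowed,
    which makes [K] a single orbit in [next_orbit]. *)
Lemma next_cover (S : {set 'I_n}) u0 z : u0 \in S -> S \subset K ->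
  (forall u, u \in S -> nx u \in S) -> exists2 u, u \in S & hb u z (nx u).
Proof.
move=> hu0 hSK hS.
pose d u : nat := if (u < z)%N then (z - u)%N else (z + n - u)%N.
case: (arg_minnP d hu0) => u hu hmin; exists u => //.
have [_ hne _] := hK (subsetP hSK _ hu).
have := hmin _ (hS _ hu); apply: contraTT => h; rewrite -ltnNge.
have {h} : (z == u) || btw u (nx u) z by move: h hne; cyc.
rewrite /d /btw -val_eqE; move: hne; rewrite -val_eqE /=.
have := ltn_ord u; have := ltn_ord z; have := ltn_ord (nx u).
by case: (ltnP u z); case: (ltnP (nx u) z); lia.
Qed.

Lemma next_orbit (S : {set 'I_n}) u0 v : u0 \in S -> S \subset K ->
  (forall u, u \in S -> nx u \in S) -> v \in K -> v \in S.
Proof.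
move=> h0 hS hc hv; have [u hu hb1] := next_cover v h0 hS hc.
have [_ _ /(_ v hv)] := hK (subsetP hS _ hu); move: hb1.
rewrite /hb => /orP[->//|/andP[/eqP/val_inj -> _] _]; exact: hc.
Qed.

(** Together with [next_arc_uniq]: the half-open arcs from [u] to [nx u] partition the circle.
    Injectivity and surjectivity of [nx] on [K] follow by locating vertices in them. *)
Lemma next_arc u0 z : u0 \in K -> exists2 u, u \in K & hb u z (nx u).
Proof. by move=> h; apply: (next_cover z h (subxx _)) => u hu; case: (hK hu). Qed.

Lemma next_arc_uniq u v z : u \in K -> v \in K -> hb u z (nx u) -> hb v z (nx v) -> u = v.
Proof.
move=> hu hv; have [a1 a2 a3] := hK hu; have [b1 b2 b3] := hK hv.
by have := a3 _ hv; have := a3 _ b1; have := b3 _ hu; have := b3 _ a1; move: a2 b2; cyc.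
Qed.

Lemma next_inj u v : u \in K -> v \in K -> nx u = nx v -> u = v.
Proof.
move=> hu hv e; apply: (next_arc_uniq (z := nx u) hu hv); have [_ h _] := hK hu.
  by move: h; cyc.
by have [_ h' _] := hK hv; rewrite e; move: h'; cyc.
Qed.

Lemma next_surj v : v \in K -> exists2 u, u \in K & nx u = v.
Proof.
move=> hv; have [u hu h] := next_arc v hv; exists u => //.
have [_ _ /(_ v hv)] := hK hu; move: h; rewrite /hb.
by move=> /orP[->//|/andP[/eqP/val_inj -> _] _].
Qed.

Variable R : realFieldType.
Variable y : 'I_n -> R.
Hypothesis y0 : forall u, u \in K -> 0 <= y u.

(* The system tying the corner weights of a cell to the weights of its edges. *)
Definition corner_system (c : 'I_n -> R) :=
  forall u, u \in K -> c (nx u) = Num.min (y (nx u) - c u) (y (nx (nx u))).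

Lemma corner_le c u : corner_system c -> u \in K -> c u <= y u /\ c u <= y (nx u).
Proof.
move=> hc hu.
have le2 v : v \in K -> c v <= y (nx v).
  move=> hv; have [v' hv' <-] := next_surj hv.
  by rewrite (hc _ hv') ge_min lexx orbT.
have [v hv e] := next_surj hu.
have p v' : v' \in K -> 0 <= c v'.
  move=> hv'; have [v'' hv'' <-] := next_surj hv'; rewrite hc //.
  rewrite le_min subr_ge0 le2 //=; apply: y0.
  by have [h _ _] := hK hv''; have [] := hK h.
split; last exact: le2.
by rewrite -e hc // ge_min lerBlDr lerDl p.
Qed.

Lemma corner_ge0 c u : corner_system c -> u \in K -> 0 <= c u.
Proof.
move=> hc hu; have [v hv <-] := next_surj hu; have [_ h] := corner_le hc hv.
rewrite hc // le_min subr_ge0 h; apply: y0.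
by have [h' _ _] := hK hv; have [] := hK h'.
Qed.

(* Run once around the cell, the recursion is t |-> max p (min q (r +- t)), which has a fixed
   point. *)
Lemma corner_exists : exists c, corner_system c.
Proof.
case: (set_0Vmem K) => [e|[u0 hu0]].
  by exists (fun _ => 0) => u; rewrite e inE.
(* Extended by the identity, [nx] becomes an injection of a finite type, so the iterates from [u0]
   close up after [m] steps. *)
pose f x := if x \in K then nx x else x.
have fI : injective f.
  move=> u v; rewrite /f; case: ifPn => hu; case: ifPn => hv //.
  - exact: next_inj.
  - by move=> e; rewrite -e in hv; have [h _ _] := hK hu; rewrite h in hv.
  - by move=> e; rewrite e in hu; have [h _ _] := hK hv; rewrite h in hu.
pose s (k : nat) := iter k f u0.
have sK (k : nat) : s k \in K by elim: k => //= k IH; rewrite /f IH; have [] := hK IH.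
have sS (k : nat) : s k.+1 = nx (s k) by rewrite /= /f sK.
pose m := fingraph.order f u0.
have m0 : (0 < m)%N by exact: order_gt0.
have sm : s m = s 0%N by exact: iter_order.
have sper (k : nat) : s (k + m)%N = s k by rewrite /s iterD -/(s m) sm.
(* The corner weights along the cycle when the first one is [t]. The initial clamping gives stage 0
   the shape kept by [clamp_step], and it acts as the identity at the fixed point ([g0]). *)
pose fix g (t : R) (k : nat) := if k is k'.+1 then Num.min (y (s k'.+1) - g t k') (y (s k'.+2))
  else Num.max 0 (Num.min (y (s 1%N)) t).
have gS t (k : nat) : g t k.+1 = Num.min (y (s k.+1) - g t k) (y (s k.+2)) by [].
have ys (k : nat) : 0 <= y (s k) by exact: y0.
have gle t (k : nat) : 0 <= g t k <= y (s k.+1).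
  elim: k => [|k /andP[IH1 IH2]]; first by rewrite /g le_max lexx ge_max ge_min lexx ys.
  by rewrite gS ge_min lexx orbT le_min subr_ge0 IH2 ys.
have shape (k : nat) : exists p q r (e : bool), p <= q /\
    forall t, g t k = Num.max p (Num.min q (if e then r + t else r - t)).
  elim: k => [|k [p [q [r [e [pq IH]]]]]].
    exists 0, (y (s 1%N)), 0, true; split; first exact: ys.
    by move=> t; rewrite add0r.
  exists (Num.min (y (s k.+1) - q) (y (s k.+2))), (Num.min (y (s k.+1) - p) (y (s k.+2))),
    (y (s k.+1) - r), (~~ e).
  split; first by rewrite le_min !ge_min lexx !orbT !andbT; apply/orP; left; lra.
  by move=> t; rewrite gS IH clamp_step.
have [t ht] : exists t, g t m = t.
  have [p [q [r [e [pq IH]]]]] := shape m.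
  by have [t ht] := clamp_fixed r e pq; exists t; rewrite IH.
have g0 : g t 0%N = t.
  have /andP[] := gle t m; rewrite ht -/(s m.+1) -[m.+1]add1n sper => h1 h2.
  by rewrite /g (min_r h2) max_r.
have gper (k : nat) : g t (k + m)%N = g t k.
  elim: k => [|k IH]; first by rewrite add0n ht g0.
  by rewrite addSn !gS IH -!addSn !sper.
have gmod (k : nat) : g t (k %% m)%N = g t k.
  rewrite [in RHS](divn_eq k m); elim: (k %/ m)%N => [|l IH]; first by rewrite mul0n.
  by rewrite mulSn -addnA [(m + _)%N]addnC gper.
have smod (k : nat) : s (k %% m)%N = s k.
  rewrite [in RHS](divn_eq k m); elim: (k %/ m)%N => [|l IH]; first by rewrite mul0n.
  by rewrite mulSn -addnA [(m + _)%N]addnC sper.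
pose c v := g t (findex f u0 v).
have cs (k : nat) : c (s k) = g t k.
  by rewrite /c -smod findex_iter ?gmod // ltn_mod.
exists c => u hu.
have hS : u \in [set v in K | [exists k : 'I_m, s k == v]].
  apply: (@next_orbit _ u0) => //.
  - by rewrite inE hu0; apply/existsP; exists (Ordinal m0).
  - by apply/subsetP => v; rewrite inE => /andP[].
  - move=> v; rewrite !inE => /andP[hv /existsP[k /eqP hk]]; have [-> _ _] := hK hv.
    have hm : (k.+1 %% m < m)%N by rewrite ltn_mod.
    by apply/existsP; exists (Ordinal hm); rewrite smod sS hk.
move: hS; rewrite inE => /andP[_ /existsP[k /eqP <-]].
by rewrite -sS cs cs gS -sS.
Qed.

(** Solutions that agree at one vertex agree all around. If they differ everywhere, the strict
    inequality between them reverses at each step, so [nx] exchanges the vertices where one or the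
    other is smaller and [#|K|] is even. At a vertex with [y u = 0] both solutions vanish. *)
Lemma corner_uniq c c' : odd #|K| || [exists u in K, y u == 0] ->
  corner_system c -> corner_system c' -> {in K, c =1 c'}.
Proof.
move=> hodd hc hc' u hu; apply/eqP.
have prop v : v \in K -> c v = c' v -> c (nx v) = c' (nx v) by move=> hv e; rewrite hc // hc' // e.
suff [v hv e] : exists2 v, v \in K & c v == c' v.
  have : u \in [set v in K | c v == c' v].
    apply: (@next_orbit _ v) => //; first by rewrite inE hv e.
      by apply/subsetP => x; rewrite inE => /andP[].
    move=> x; rewrite !inE => /andP[hx /eqP ex]; have [-> _ _] := hK hx.
    by apply/eqP/prop.
  by rewrite inE => /andP[].
case/orP: hodd => [hodd|/exists_inP[v hv /eqP yv]]; last first.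
  exists v => //; have [h1 _] := corner_le hc hv; have [h2 _] := corner_le hc' hv.
  have := corner_ge0 hc hv; have := corner_ge0 hc' hv; rewrite yv in h1 h2; lra.
apply/exists_inP; apply: contraT; rewrite negb_exists_in => /forall_inP hne.
pose S (f f' : 'I_n -> R) := [set v in K | f v < f' v].
have half f f' : corner_system f -> corner_system f' -> {in K, forall v, f v != f' v} ->
    (#|S f f'| <= #|S f' f|)%N.
  move=> hf hf' hn; have inj : {in S f f' &, injective nx}.
    by move=> v v'; rewrite !inE => /andP[hv _] /andP[hv' _]; exact: next_inj.
  rewrite -(card_in_imset inj); apply/subset_leq_card/subsetP => z /imsetP[v].
  rewrite !inE => /andP[hv hlt] -> {z}; have [hv' _ _] := hK hv.
  rewrite hv' lt_neqAle eq_sym hn //= hf // hf' //.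
  by rewrite le_min !ge_min lexx orbT andbT; apply/orP; left; lra.
have hne' : {in K, forall v, c' v != c v} by move=> v hv; rewrite eq_sym hne.
have : #|K| = (#|S c c'| + #|S c' c|)%N.
  rewrite -cardsUI; have -> : S c c' :&: S c' c = set0.
    by apply/setP => v; rewrite !inE; case: ltgtP; rewrite !andbF.
  rewrite cards0 addn0; apply: eq_card => v; rewrite !inE -andb_orr.
  by case: (boolP (v \in K)) => //= hv; rewrite -neq_lt hne.
have -> : #|S c c'| = #|S c' c|.
  by apply/eqP; rewrite eqn_leq !half.
by rewrite addnn => e; rewrite e odd_double in hodd.
Qed.
End NextIn.
End Cyclic.

(** * Dissections with a single cell *)

Section Star.
Variables (n : nat) (D : rel 'I_n) (K : {set 'I_n}) (nx : 'I_n -> 'I_n).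
Implicit Types (i j k l u v x y z : 'I_n).

(* All the chords of [D] are edges of the cell with vertex set [K]. *)
Record star : Prop := Star {
  star_noncrossing : noncrossing D;
  star_next : next_in K nx;
  star_pt : exists u, u \in K;
  star_ge3 : forall u, u \in K -> nx (nx u) != u;
  star_edge : forall u, u \in K -> nx u = ordS u \/ D u (nx u);
  star_chord : forall x y, D x y -> x \in K /\ y = nx x \/ y \in K /\ x = nx y }.

Hypothesis hs : star.
Let hD := star_noncrossing hs.
Let hK := star_next hs.

Definition same i j p q : bool := (i == p) && (j == q) || (i == q) && (j == p).

Lemma star_nxK u : u \in K -> nx u \in K. Proof. by case/hK. Qed.
Lemma star_neq u : u \in K -> nx u != u. Proof. by case/hK. Qed.
Lemma star_gap u k : u \in K -> k \in K -> ~~ btw u k (nx u).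
Proof. by move=> hu; case: (hK hu) => _ _; apply. Qed.

Lemma star_n i j : i != j -> (1 < n)%N.
Proof. by rewrite -val_eqE /=; have := ltn_ord i; have := ltn_ord j; lia. Qed.

Lemma star_Db u : u \in K -> D u (nx u) || adj u (nx u).
Proof. by move=> hu; case: (star_edge hs hu) => [->|->] //; rewrite /adj eqxx orbT. Qed.

(* The edges met by a chord ending in the arcs of u and v of the cell. *)
Lemma star_rx i j u v x y : i != j -> u \in K -> v \in K ->
  hb u i (nx u) -> hb v j (nx v) -> D x y || adj x y -> rx i j x y ->
  [|| same x y (ord_pred i) i, same x y (ord_pred j) j |
      (u != v) && (same x y u (nx u) || same x y v (nx v))].
Proof.
move=> hij hu hv hi hj hxy hr; have hn := star_n hij.
have nu := star_neq hu; have nv := star_neq hv.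
have adjc z w : ordS z = w -> rx i j z w -> same z w (ord_pred i) i || same z w (ord_pred j) j.
  move=> <- hr'; have : (ordS z == i) || (ordS z == j).
    have := btw_ordS z i; have := btw_ordS z j; move: hr'; cyc.
  by case/orP => /eqP <-; rewrite ordSK /same !eqxx ?orbT.
have symc p q : same x y p q = same y x p q by rewrite /same orbC andbC; congr (_ || _); rewrite andbC.
have chordc z w : z \in K -> w = nx z -> rx i j z w ->
    (u != v) && (same z w u (nx u) || same z w v (nx v)).
  move=> hz -> hr'; have nz := star_neq hz.
  have : hb z i (nx z) && ~~ hb z j (nx z) || hb z j (nx z) && ~~ hb z i (nx z).
    by move: hr' nz; cyc.
  case/orP => /andP[h1 h2].
    have e := next_arc_uniq hK hz hu h1 hi.
    rewrite -e /same !eqxx /= andbT; apply: contraNneq h2 => ->; exact: hj.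
  have e := next_arc_uniq hK hz hv h1 hj.
  by rewrite -e /same !eqxx /= orbT andbT eq_sym; apply: contraNneq h2 => ->.
case/orP: hxy => [/(star_chord hs)[[hx e]|[hy e]]|]; last first.
  rewrite /adj; case/orP => /eqP e; first by case/orP: (adjc _ _ e hr) => ->; rewrite ?orbT.
  by rewrite rx_sym in hr; rewrite !symc; case/orP: (adjc _ _ e hr) => ->; rewrite ?orbT.
- by rewrite rx_sym in hr; rewrite !symc (chordc y x hy e hr) !orbT.
- by rewrite (chordc x y hx e hr) !orbT.
Qed.

Lemma same_P (P : 'I_n -> bool) x y p q : same x y p q -> P p = P q -> P x = P y.
Proof. by case/orP => /andP[/eqP-> /eqP->]. Qed.

(** The form in which the accordion property is refuted below: by [star_rx] a colouring only has to
    be checked on the boundary edges ending in [i] and [j] and, when their arcs differ, on two cell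
    edges. *)
Lemma star_colour i j u v (P : 'I_n -> bool) : acc D i j -> i != j -> u \in K -> v \in K ->
  hb u i (nx u) -> hb v j (nx v) ->
  P (ord_pred i) = P i -> P (ord_pred j) = P j ->
  (u != v -> P u = P (nx u) /\ P v = P (nx v)) ->
  P i = P j /\ (u != v -> P i = P u /\ P i = P v).
Proof.
move=> hacc hij hu hv hi hj Pi Pj Puv; have hn := star_n hij.
have hP x y : D x y || adj x y -> rx i j x y -> P x = P y.
  move=> hxy hr; case/or3P: (star_rx hij hu hv hi hj hxy hr) => [h|h|/andP[/Puv[h1 h2]]].
  - exact: same_P h Pi.
  - exact: same_P h Pj.
  - by case/orP=> h; exact: (same_P h).
have rad (k l : 'I_n) : k != l -> rx k l (ord_pred k) k.
  move=> hkl; have := btw_ordS (ord_pred k) l; have := ordS_neq (ord_pred k) hn.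
  by rewrite ord_predK; move: hkl; cyc.
have adp (k : 'I_n) : D (ord_pred k) k || adj (ord_pred k) k by rewrite /adj ord_predK eqxx orbT.
have ri := rad _ _ hij.
have rj : rx i j (ord_pred j) j by rewrite rx_symi; apply: rad; rewrite eq_sym.
have key := hacc P hP (ord_pred i) i _ _ (adp i) ri; rewrite Pi in key.
split; first by rewrite (key _ _ (adp j) rj) Pj.
move=> uv; have nu := star_neq hu; have nv := star_neq hv.
have g1 := star_gap hu hv; have g2 := star_gap hv hu.
have g3 := star_gap hu (star_nxK hv); have g4 := star_gap hv (star_nxK hu).
split; [apply: (key u (nx u))|apply: (key v (nx v))]; rewrite ?star_Db //.
  by move: hi hj uv nu nv g1 g2 g3 g4; cyc.
by move: hi hj uv nu nv g1 g2 g3 g4; cyc.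
Qed.

Lemma pred_neq i j : i != j -> ~~ adj i j ->
  [/\ j != ord_pred i, ord_pred j != i & ord_pred j != ord_pred i].
Proof.
move=> hij hadj; have Si := ord_predK i; have Sj := ord_predK j; split.
- by apply: contra hadj => /eqP ->; rewrite /adj Si eqxx orbT.
- by apply: contra hadj => /eqP <-; rewrite /adj Sj eqxx.
- by apply: contra hij => /eqP e; rewrite -Si -e Sj.
Qed.

(** If the arcs of [i] and [j] are distinct and not consecutive, no crossed edge leaves the closed
    arc of [u], which contains [i] but not [j]. If they coincide, the boundary edge ending in [i] is
    isolated from the one ending in [j]. *)
Lemma star_acc_next i j u v : acc D i j -> i != j -> ~~ adj i j -> u \in K -> v \in K ->
  hb u i (nx u) -> hb v j (nx v) -> v = nx u \/ u = nx v.
Proof.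
move=> hacc hij hadj hu hv hi hj; have hn := star_n hij.
have Si := ord_predK i; have Sj := ord_predK j.
have nSi := ordS_neq (ord_pred i) hn; have nSj := ordS_neq (ord_pred j) hn.
rewrite Si in nSi; rewrite Sj in nSj.
have [a1 a2 a3] := pred_neq hij hadj.
have nu := star_neq hu; have nv := star_neq hv.
case: (eqVneq u v) => [uv|uv].
  exfalso.
  have [] := @star_colour i j u v (fun x => (x == i) || (x == ord_pred i)) hacc hij hu hv hi hj.
  - by rewrite eqxx orbT eqxx.
  - by rewrite (eq_sym j i) (negbTE hij) (negbTE a1) (negbTE a2) (negbTE a3).
  - by rewrite uv eqxx.
  by rewrite eqxx (eq_sym j i) (negbTE hij) (negbTE a1).
case: (eqVneq v (nx u)) => [|n1]; [by left|]; case: (eqVneq u (nx v)) => [|n2]; [by right|].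
exfalso.
have g1 := star_gap hu hv; have g2 := star_gap hv hu.
have g3 := star_gap hu (star_nxK hv); have g4 := star_gap hv (star_nxK hu).
have b1 := btw_ordS (ord_pred i) u; have b2 := btw_ordS (ord_pred j) v.
have b3 := btw_ordS (ord_pred i) (nx u); have b4 := btw_ordS (ord_pred j) (nx v).
rewrite Si in b1 b3; rewrite Sj in b2 b4.
pose P x := (x == u) || hb u x (nx u).
have Pi : P i by rewrite /P hi orbT.
have Pi' : P (ord_pred i) by rewrite /P; move: hi nu b1 b3 nSi; cyc.
have Pj : P j = false.
  by apply/negbTE; rewrite /P; move: hj nu nv uv g1 g2 g3 g4 n1 n2; cyc.
have Pj' : P (ord_pred j) = false.
  by apply/negbTE; rewrite /P; move: hj nu nv uv g1 g2 g3 g4 n1 n2 b2 b4 nSj; cyc.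
have [] := @star_colour i j u v P hacc hij hu hv hi hj.
- by rewrite Pi Pi'.
- by rewrite Pj Pj'.
- move=> _; split; rewrite /P.
    by move: nu; cyc.
  have -> : (v == u) || hb u v (nx u) = false.
    by apply/negbTE; move: nu nv uv g1 g2 g3 g4 n1 n2; cyc.
  by symmetry; apply/negbTE; move: nu nv uv g1 g2 g3 g4 n1 n2; cyc.
by rewrite Pi Pj.
Qed.

(** For any other [i], the boundary edge ending in [i] has no vertex in common with the cell edges
    leaving [u] and [nx u] nor with the boundary edge ending in [j]. *)
Lemma star_acc_end i j u : acc D i j -> i != j -> ~~ adj i j -> u \in K ->
  hb u i (nx u) -> hb (nx u) j (nx (nx u)) ->
  (i == ordS u) || (i == nx u).
Proof.
move=> hacc hij hadj hu hi hj; have hn := star_n hij.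
have hv := star_nxK hu; have hw := star_nxK hv.
have Si := ord_predK i; have Sj := ord_predK j.
have [a1 a2 a3] := pred_neq hij hadj.
apply: contraT => /norP[i1 i2].
have nu := star_neq hu; have nv := star_neq hv; have n3 := star_ge3 hs hu.
have g1 := star_gap hu hw; have g2 := star_gap hv hu.
have iu : i != u by move: hi nu; cyc.
have i'u : ord_pred i != u by apply: contra i1 => /eqP <-; rewrite Si.
have b1 := btw_ordS (ord_pred i) u; have b2 := btw_ordS (ord_pred i) (nx u).
have nSi := ordS_neq (ord_pred i) hn; rewrite Si in b1 b2 nSi.
have F x : x \in [:: u; nx u; nx (nx u)] -> (x == i) || (x == ord_pred i) = false.
  rewrite !inE => hx; apply/negbTE; case/or3P: hx => /eqP ->.
  - by move: iu i'u; cyc.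
  - by move: i2 b1 b2 iu i'u nSi hi nu; cyc.
  - by move: i2 b1 b2 iu i'u nSi hi nu n3 nv g1; cyc.
have [] := @star_colour i j u (nx u) (fun x => (x == i) || (x == ord_pred i)) hacc hij hu hv hi hj.
- by rewrite eqxx orbT eqxx.
- by rewrite (eq_sym j i) (negbTE hij) (negbTE a1) (negbTE a2) (negbTE a3).
- by move=> _; rewrite !F ?inE ?eqxx ?orbT.
by rewrite eqxx (eq_sym j i) (negbTE hij) (negbTE a1).
Qed.

Lemma star_acc_end2 i j u : acc D i j -> i != j -> ~~ adj i j -> u \in K ->
  hb u i (nx u) -> hb (nx u) j (nx (nx u)) ->
  (j == ordS (nx u)) || (j == nx (nx u)).
Proof.
move=> hacc hij hadj hu hi hj; have hn := star_n hij.
have hv := star_nxK hu; have hw := star_nxK hv.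
have Si := ord_predK i; have Sj := ord_predK j.
have [a1 a2 a3] : [/\ i != ord_pred j, ord_pred i != j & ord_pred i != ord_pred j].
  by apply: pred_neq; rewrite 1?eq_sym 1?adjC.
apply: contraT => /norP[i1 i2].
have nu := star_neq hu; have nv := star_neq hv; have n3 := star_ge3 hs hu.
have g1 := star_gap hu hw; have g2 := star_gap hv hu.
have iu : j != nx u by move: hj nv; cyc.
have i'u : ord_pred j != nx u by apply: contra i1 => /eqP <-; rewrite Sj.
have b1 := btw_ordS (ord_pred j) (nx u); have b2 := btw_ordS (ord_pred j) (nx (nx u)).
have nSi := ordS_neq (ord_pred j) hn; rewrite Sj in b1 b2 nSi.
have F x : x \in [:: u; nx u; nx (nx u)] -> (x == j) || (x == ord_pred j) = false.
  rewrite !inE => hx; apply/negbTE; case/or3P: hx => /eqP ->.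
  - by move: i2 b1 b2 iu i'u nSi hj nu n3 nv g2; cyc.
  - by move: iu i'u; cyc.
  - by move: i2 b1 b2 iu i'u nSi hj nv; cyc.
have [] := @star_colour i j u (nx u) (fun x => (x == j) || (x == ord_pred j)) hacc hij hu hv hi hj.
- by rewrite (negbTE hij) (negbTE a1) (negbTE a2) (negbTE a3).
- by rewrite eqxx orbT eqxx.
- by move=> _; rewrite !F ?inE ?eqxx ?orbT.
by rewrite eqxx (negbTE hij) (negbTE a1).
Qed.

(** The accordions of a single cell. If e_u is the unit vector of the edge [u (nx u)], their
    coordinates are -e_u along the edge, e_u + e_(nx u) around the corner [nx u], and e_u for the
    leaf that stops at [nx (nx u)]. *)
Definition star_leaf u i j := [|| D u (nx u) && same i j u (nx u),
  D u (nx u) && D (nx u) (nx (nx u)) && same i j (ordS u) (ordS (nx u)) |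
  D u (nx u) && same i j (ordS u) (nx (nx u))].

Lemma sameC i j p q : same i j p q = same j i p q.
Proof. by rewrite /same orbC (andbC (i == q)) (andbC (i == p)). Qed.

Lemma star_leafC u i j : star_leaf u i j = star_leaf u j i.
Proof. by rewrite /star_leaf !(sameC i). Qed.

Lemma star_accP i j : acc D i j -> i != j -> ~~ adj i j ->
  exists2 u, u \in K & star_leaf u i j.
Proof.
move=> hacc hij hadj.
have [u0 hu0] := star_pt hs.
have [u hu hi] := next_arc hK i hu0; have [v hv hj] := next_arc hK j hu0.
wlog e : i j u v hacc hij hadj hu hv hi hj / v = nx u.
  move=> H; case: (star_acc_next hacc hij hadj hu hv hi hj) => e; first exact: (H i j u v).
  have [] := H j i v u (acc_sym hacc) _ _ hv hu hj hi e; rewrite 1?eq_sym 1?adjC //.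
  by move=> t ht; exists t; rewrite // star_leafC.
subst v.
have := star_acc_end2 hacc hij hadj hu hi hj; have := star_acc_end hacc hij hadj hu hi hj.
have eD t : t \in K -> ~~ adj t (nx t) -> D t (nx t).
  by move=> ht; case: (star_edge hs ht) => // ->; rewrite /adj eqxx.
case/orP => /eqP ei; case/orP => /eqP ej; subst.
- case: (star_edge hs hu) => e1; first by move: hadj; rewrite e1 /adj eqxx.
  exists u => //; rewrite /star_leaf e1 /same !eqxx /=.
  by case: (star_edge hs hv) => [->|->]; rewrite ?eqxx ?orbT.
- case: (star_edge hs hu) => e1.
    exists (nx u); first exact: star_nxK.
    by rewrite -e1 in hadj *; rewrite /star_leaf /same !eqxx eD // star_nxK.
  by exists u => //; rewrite /star_leaf e1 /same !eqxx /= !orbT.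
- by move: hadj; rewrite /adj eqxx.
- exists (nx u); first exact: star_nxK.
  by rewrite /star_leaf /same !eqxx eD // star_nxK.
Qed.

(** The two cell edges at [nx u] are crossed, and under the last two hypotheses the crossed boundary
    edges ending in [i] and [j] are attached to them. *)
Lemma star_acc_intro i j u : i != j -> u \in K -> hb u i (nx u) -> hb (nx u) j (nx (nx u)) ->
  (ord_pred i == u) || (i == nx u) -> (ord_pred j == nx u) || (j == nx (nx u)) -> acc D i j.
Proof.
move=> hij hu hi hj ei ej P hP.
have hv := star_nxK hu; have nu := star_neq hu; have nv := star_neq hv; have n3 := star_ge3 hs hu.
have g1 := star_gap hu (star_nxK hv); have g2 := star_gap hv hu.
have Pu : P u = P (nx u).
  by apply: hP; rewrite ?star_Db //; move: hi hj nu nv n3 g1 g2; cyc.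
have Pv : P (nx u) = P (nx (nx u)).
  by apply: hP; rewrite ?star_Db //; move: hi hj nu nv n3 g1 g2; cyc.
have all x y : D x y || adj x y -> rx i j x y -> P x = P (nx u).
  move=> hxy hr; have e := hP _ _ hxy hr.
  case/or3P: (star_rx hij hu hv hi hj hxy hr) => [|/orP|].
  - have [h|h] : P (ord_pred i) = P (nx u) \/ P i = P (nx u).
      by case/orP: ei => /eqP ->; [left|right].
    + by case/orP => /andP[/eqP ex /eqP ey]; congruence.
    + by case/orP => /andP[/eqP ex /eqP ey]; congruence.
  - have h : P (ord_pred j) = P (nx u) \/ P j = P (nx u).
      by case/orP: ej => /eqP ->; [left|right].
    by case=> /andP[/eqP ex /eqP ey]; case: h => h; congruence.
  - by case/andP=> _; case/orP => /orP[]/andP[/eqP -> _].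
by move=> x y x' y' h1 h2 h3 h4; rewrite (all _ _ h1 h2) (all _ _ h3 h4).
Qed.

Lemma star_Dbtw u : u \in K -> D u (nx u) -> btw u (ordS u) (nx u).
Proof. by move=> hu hd; exact: ends_btw hD hd. Qed.

Lemma same_acc i j p q : same i j p q -> [/\ p != q, ~~ adj p q & acc D p q] ->
  [/\ i != j, ~~ adj i j & acc D i j].
Proof.
case/orP => /andP[/eqP-> /eqP->] // [h1 h2 h3]; rewrite eq_sym adjC; split=> //.
exact: acc_sym.
Qed.

Lemma star_leaf_acc i j u : u \in K -> star_leaf u i j ->
  [/\ i != j, ~~ adj i j & acc D i j].
Proof.
move=> hu; have hv := star_nxK hu; have hw := star_nxK hv.
have nu := star_neq hu; have nv := star_neq hv; have n3 := star_ge3 hs hu.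
have g1 := star_gap hu hw; have g2 := star_gap hv hu.
have [t ht et] := next_surj hK hu.
have gt1 := star_gap ht hv; have gt2 := star_gap hv ht.
have nt := star_neq ht; have nt3 := star_ge3 hs ht.
case/or3P => [/andP[hd]|/andP[/andP[hd hd']]|/andP[hd]] hsm; apply: (same_acc hsm).
- have [_ /(_ _ _ hd)/andP[d1 d2] _] := hD; split=> //.
  apply: (@star_acc_intro _ _ t); rewrite ?et ?eqxx ?orbT //.
    by move: nt; rewrite et; cyc.
  by move: nu; cyc.
- have b1 := star_Dbtw hu hd; have b2 := star_Dbtw hv hd'.
  split; first by rewrite (inj_eq (@ordS_inj n)) eq_sym.
    apply/negP => /orP[]/eqP/ordS_inj e.
      by move: b1; rewrite e; cyc.
    by move: b2; rewrite e (negbTE g2).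
  apply: (@star_acc_intro _ _ u); rewrite ?ordSK ?eqxx //.
  + by rewrite (inj_eq (@ordS_inj n)) eq_sym.
  + by move: b1; cyc.
  + by move: b2; cyc.
- have b1 := star_Dbtw hu hd.
  have ne : ordS u != nx (nx u) by move: b1 g1 nu nv n3 g2; cyc.
  split=> //.
    apply/negP => /orP[]/eqP e; last by move: n3; rewrite (ordS_inj e) eqxx.
    have := btw_ordS (ordS u) (nx u); rewrite e; move: b1 g1 g2 nu nv n3; cyc.
  apply: (@star_acc_intro _ _ u); rewrite ?ordSK ?eqxx ?orbT //.
  + by move: b1; cyc.
  + by move: nv; cyc.
Qed.

(* A single boolean gathering what [cyc] has to know about two corners of the cell. *)
Lemma star_pair u u' : u \in K -> u' \in K -> u != u' ->
  [&& u != u', nx u != nx u', ~~ btw u u' (nx u), ~~ btw u' u (nx u'),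
   ~~ btw u (nx u') (nx u), ~~ btw u' (nx u) (nx u'),
   btw u (ordS u) (nx u) || (ordS u == nx u), btw u' (ordS u') (nx u') || (ordS u' == nx u'),
   (u' == nx u) ==> (ordS u' == ordS (nx u)), (nx u' == u) ==> (ordS (nx u') == ordS u),
   ~~ btw (nx u) u' (nx (nx u)), ~~ btw (nx u) (nx u') (nx (nx u)),
   ~~ btw (nx u) u (nx (nx u)), ~~ btw u (nx (nx u)) (nx u),
   nx (nx u) != u, nx (nx u) != nx u,
   btw (nx u) (ordS (nx u)) (nx (nx u)) || (ordS (nx u) == nx (nx u)),
   ~~ btw (nx u') u (nx (nx u')), ~~ btw (nx u') (nx u) (nx (nx u')),
   ~~ btw (nx u') u' (nx (nx u')), ~~ btw u' (nx (nx u')) (nx u'),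
   nx (nx u') != u', nx (nx u') != nx u',
   btw (nx u') (ordS (nx u')) (nx (nx u')) || (ordS (nx u') == nx (nx u')),
   nx (nx u) != nx (nx u'), ~~ btw u (nx (nx u')) (nx u), ~~ btw u' (nx (nx u)) (nx u'),
   ~~ btw (nx u) (nx (nx u')) (nx (nx u)) & ~~ btw (nx u') (nx (nx u)) (nx (nx u'))].
Proof.
move=> hu hu' uu; have hv := star_nxK hu; have hv' := star_nxK hu'.
have hw := star_nxK hv; have hw' := star_nxK hv'.
have arc t : t \in K -> btw t (ordS t) (nx t) || (ordS t == nx t).
  by move=> ht; case: (star_edge hs ht) => [->|/(star_Dbtw ht)->]; rewrite ?eqxx ?orbT.
rewrite !star_gap // !star_neq // !(star_ge3 hs) // !arc // uu /=.
have vv : nx u != nx u' by apply: contra uu => /eqP/(next_inj hK hu hu')->.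
have ww : nx (nx u) != nx (nx u') by apply: contra vv => /eqP/(next_inj hK hv hv')->.
rewrite vv ww !andbT /=; apply/andP; split; apply/implyP => /eqP ->; exact: eqxx.
Qed.

Section Pair.
Variables u u' : 'I_n.
Hypotheses (hu : u \in K) (hu' : u' \in K) (hd : D u (nx u)) (hd' : D u' (nx u')).

Let b : btw u (ordS u) (nx u). Proof. exact: star_Dbtw. Qed.
Let b' : btw u' (ordS u') (nx u'). Proof. exact: star_Dbtw. Qed.

(** In these names [C] is a leaf around a corner, [T] a leaf stopping at a vertex of the cell, [F] a
    leaf along an edge. The crossings of a [T] with the next [T] and the next [C] are the origin of
    the minimum in [corner_system]. *)
Lemma star_CC : D (nx u) (nx (nx u)) -> D (nx u') (nx (nx u')) ->
  ~~ cr (ordS u) (ordS (nx u)) (ordS u') (ordS (nx u')).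
Proof.
move=> d2 d2'; have b2 := star_Dbtw (star_nxK hu) d2; have b2' := star_Dbtw (star_nxK hu') d2'.
case: (eqVneq u u') => [<-|uu]; first by cyc.
by move: (star_pair hu hu' uu) b b' b2 b2'; cyc.
Qed.

Lemma star_CT : D (nx u) (nx (nx u)) -> u != nx u' ->
  ~~ cr (ordS u) (ordS (nx u)) (ordS u') (nx (nx u')).
Proof.
move=> d2; have b2 := star_Dbtw (star_nxK hu) d2.
case: (eqVneq u u') => [<-|uu]; first by cyc.
by move: (star_pair hu hu' uu) b b' b2; cyc.
Qed.

Lemma star_TT : u' != nx u -> u != nx u' ->
  ~~ cr (ordS u) (nx (nx u)) (ordS u') (nx (nx u')).
Proof.
case: (eqVneq u u') => [<-|uu]; first by cyc.
by move: (star_pair hu hu' uu) b b'; cyc.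
Qed.

Lemma star_TT_next : u' = nx u -> cr (ordS u) (nx (nx u)) (ordS u') (nx (nx u')).
Proof.
move=> e; have uu : u != u' by rewrite e eq_sym star_neq.
by move: (star_pair hu hu' uu) b b' e; cyc.
Qed.

Lemma star_TC_next : u' = nx u -> D (nx u') (nx (nx u')) ->
  cr (ordS u) (nx (nx u)) (ordS u') (ordS (nx u')).
Proof.
move=> e d2; have b2 := star_Dbtw (star_nxK hu') d2.
have uu : u != u' by rewrite e eq_sym star_neq.
by move: (star_pair hu hu' uu) b b' b2 e; cyc.
Qed.

Lemma star_FC : D (nx u') (nx (nx u')) -> u != u' -> u != nx u' ->
  ~~ cr u (nx u) (ordS u') (ordS (nx u')).
Proof.
move=> d2 uu; have b2 := star_Dbtw (star_nxK hu') d2.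
by move: (star_pair hu hu' uu) b b' b2; cyc.
Qed.

Lemma star_FT : u != u' -> ~~ cr u (nx u) (ordS u') (nx (nx u')).
Proof. by move=> uu; move: (star_pair hu hu' uu) b b'; cyc. Qed.

Lemma star_FF : ~~ cr u (nx u) u' (nx u').
Proof.
case: (eqVneq u u') => [<-|uu]; first by cyc.
by move: (star_pair hu hu' uu) b b'; cyc.
Qed.
End Pair.
End Star.

Section StarLam.
Variables (R : realFieldType) (n : nat) (D : rel 'I_n) (K : {set 'I_n}) (nx : 'I_n -> 'I_n).
Hypothesis hs : star D K nx.
Implicit Types (i j k l u v x y z : 'I_n) (w : 'I_n -> 'I_n -> R).
Let hD := star_noncrossing hs.
Let hK := star_next hs.

Definition corner w u := if D u (nx u) && D (nx u) (nx (nx u)) then w (ordS u) (ordS (nx u)) else 0.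
Definition stop w u := if D u (nx u) then w (ordS u) (nx (nx u)) else 0.

Let noK u : u \in K -> D u (nx u) -> ordS u \notin K.
Proof. by move=> hu hd; apply/negP => /(star_gap hs hu); rewrite (star_Dbtw hs). Qed.

Let nDS u : u \in K -> nx u = ordS u -> D u (nx u) = false.
Proof.
move=> hu e; apply/negbTE/negP => hd; have := star_Dbtw hs hu hd.
by rewrite e; cyc.
Qed.

Lemma sum_at (P : pred 'I_n) (a : 'I_n) (x : R) : (x != 0 -> P a) ->
  \sum_(j | P j) x * (j == a)%:R = x.
Proof.
move=> h; case: (eqVneq x 0) => [->|/h Pa].
  by rewrite big1 // => j _; rewrite mul0r.
rewrite (bigD1 a) //= eqxx mulr1 big1 ?addr0 // => j /andP[_ /negbTE->].
by rewrite mulr0.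
Qed.

(** In the arc of [v], a leaf crossing the edge [v v'] can only end at [ordS v]; its other end is
    [ordS u], [ordS v'] or [v''], one for each term. If [v' v''] is a boundary edge the last two
    points coincide, and the default value 0 of [corner] prevents double counting. *)
Lemma star_sum w u : (forall i j, w i j = w j i) ->
  (forall i j, w i j != 0 -> exists2 t, t \in K & star_leaf D nx t i j) ->
  u \in K -> D (nx u) (nx (nx u)) ->
  \sum_(i < n | btw (nx u) i (nx (nx u))) \sum_(j < n | btw (nx (nx u)) j (nx u)) w i j =
  corner w u + corner w (nx u) + stop w (nx u).
Proof.
move=> sw hw hu hd; set v := nx u; set v' := nx v; set v'' := nx v'.
have hv : v \in K by exact: (star_nxK hs).
have hv' : v' \in K by exact: (star_nxK hs).
have hv'' : v'' \in K by exact: (star_nxK hs).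
have bv := star_Dbtw hs hv hd; rewrite -/v' in bv.
have uv : u != v by rewrite eq_sym (star_neq hs).
have uv' : u != v' by rewrite eq_sym (star_ge3 hs).
have vv' : v != v' by rewrite eq_sym (star_neq hs).
have vv'' : v != v'' by rewrite eq_sym (star_ge3 hs).
have v'v'' : v' != v'' by rewrite eq_sym (star_neq hs).
have g1 : ~~ btw v u v' by exact: (star_gap hs).
have g2 : ~~ btw v v'' v' by exact: (star_gap hs).
have g3 : ~~ btw v' v v'' by exact: (star_gap hs).
have g4 : ~~ btw u v' v by exact: (star_gap hs).
have g5 : ~~ btw u v'' v by exact: (star_gap hs).
have hdv : D v v' by [].
have noKv : ordS v \notin K by exact: noK.
have arcv t : t \in K -> D t (nx t) -> btw v (ordS t) v' -> t = v.
  move=> ht dt h; apply: (next_arc_uniq hK ht hv (z := ordS t)).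
    by have := star_Dbtw hs ht dt; cyc.
  by rewrite -/v'; move: h; cyc.
rewrite (bigD1 (ordS v)) //= [X in _ + X]big1 ?addr0; last first.
  move=> i /andP[hi hiv]; apply: big1 => j hj; apply/eqP; apply: contraT => /hw[t ht].
  have iK : i \notin K by apply/negP => /(star_gap hs hv); rewrite hi.
  have nt := star_nxK hs ht; have nnt := star_nxK hs nt.
  case/or3P => [/andP[dt]|/andP[/andP[dt dt']]|/andP[dt]] /orP[]/andP[/eqP ei _].
  - by rewrite ei ht in iK.
  - by rewrite ei nt in iK.
  - by rewrite ei in hi hiv; rewrite (arcv t) ?eqxx in hiv.
  - by rewrite ei in hi hiv; rewrite (arcv (nx t)) ?eqxx in hiv.
  - by rewrite ei in hi hiv; rewrite (arcv t) ?eqxx in hiv.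
  - by rewrite ei nnt in iK.
rewrite (eq_bigr (fun j => corner w u * (j == ordS u)%:R + corner w v * (j == ordS v')%:R +
    stop w v * (j == v'')%:R)).
  rewrite !big_split /= !sum_at //.
  - by rewrite /stop; case: ifP => [_ _|]; rewrite ?eqxx //; move: uv uv' vv' vv'' v'v'' g2 g3; cyc.
  - rewrite /corner -/v' -/v''; case: ifP => [/andP[_ d] _|]; rewrite ?eqxx //.
    by have := star_Dbtw hs hv' d; rewrite -/v''; move: vv'' v'v'' vv' g3; cyc.
  - rewrite /corner -/v -/v'; case: ifP => [/andP[d _] _|]; rewrite ?eqxx //.
    by have := star_Dbtw hs hu d; rewrite -/v; move: vv' uv uv' g1 g4; cyc.
move=> j hj.
have ne1 : ordS u != ordS v' by rewrite (inj_eq (@ordS_inj n)).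
case: (eqVneq j (ordS v')) => [ej|nj].
  rewrite ej eq_sym (negbTE ne1) mulr0 add0r mulr1 /corner /stop hdv -/v' -/v''.
  case: (star_edge hs hv') => e.
    have d0 : D v' v'' = false := nDS hv' e.
    by rewrite -/v'' in e; rewrite d0 /= e eqxx mulr1 add0r.
  have e' := star_Dbtw hs hv' e; rewrite -/v'' in e e'.
  rewrite e; suff -> : ordS v' == v'' = false by rewrite mulr0 addr0.
  by apply/negbTE; move: e'; cyc.
rewrite mulr0 addr0.
case: (eqVneq j (ordS u)) => [ej|nj2].
  case: (star_edge hs hu) => e.
    by exfalso; move: hj; rewrite ej -e -/v; cyc.
  have e' := star_Dbtw hs hu e; rewrite -/v in e e'.
  rewrite mulr1 /corner -/v -/v' e hdv /= ej sw.
  suff -> : ordS u == v'' = false by rewrite mulr0 addr0.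
  apply/negbTE/negP => /eqP h; have := noK hu e; rewrite h.
  by rewrite hv''.
rewrite mulr0 add0r.
case: (eqVneq j v'') => [ej|nj3]; first by rewrite mulr1 /stop -/v' hdv ej.
rewrite mulr0; apply/eqP; apply: contraT => /hw[t ht].
have nt := star_nxK hs ht; have nnt := star_nxK hs nt.
case/or3P => [/andP[dt]|/andP[/andP[dt dt']]|/andP[dt]] /orP[]/andP[/eqP ei /eqP ej].
- by move: noKv; rewrite ei ht.
- by move: noKv; rewrite ei nt.
- by move: nj; rewrite ej -(ordS_inj ei) eqxx.
- by move: nj2; rewrite ej (next_inj hK hu ht (ordS_inj ei)) eqxx.
- by move: nj3; rewrite ej -(ordS_inj ei) eqxx.
- by move: noKv; rewrite ei nnt.
Qed.

Lemma lam_star_leaf w i j : lamination D w -> w i j != 0 -> exists2 t, t \in K & star_leaf D nx t i j.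
Proof. by case=> _ _ h _ /h[h1 h2 h3]; exact: (star_accP hs). Qed.

Definition edge_weight (x : 'I_n -> 'I_n -> R) u := if D u (nx u) then Num.max 0 (x u (nx u)) else 0.

Lemma edge_weight_ge0 (x : 'I_n -> 'I_n -> R) u : 0 <= edge_weight x u.
Proof. by rewrite /edge_weight; case: ifP => // _; rewrite le_max lexx. Qed.

Lemma star_balance w u : lamination D w -> u \in K ->
  edge_weight (icoord w) (nx u) = corner w u + corner w (nx u) + stop w (nx u).
Proof.
move=> L hu; rewrite /edge_weight; case: ifP => hd; last first.
  by rewrite /corner /stop hd andbF !addr0.
have [_ <-] := lam_chord (nx u) (nx (nx u)) L.
apply: star_sum => //; first by case: L.
by move=> i j; exact: lam_star_leaf.
Qed.

(** By [star_balance] the two arguments of the minimum are the corner weight of [nx u] plus, in the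
    first, the stopping leaf of [nx u] and, in the second, the corner and stopping leaves of
    [nx (nx u)]. The stopping leaf of [nx u] crosses both of the latter, so one of the two excesses
    is zero. *)
Lemma star_corner_system w : lamination D w -> corner_system K nx (edge_weight (icoord w)) (corner w).
Proof.
move=> L u hu; have hv := star_nxK hs hu; have hv' := star_nxK hs hv.
have [sw pw _ cw] := L.
have pc t : 0 <= corner w t by rewrite /corner; case: ifP.
have pt t : 0 <= stop w t by rewrite /stop; case: ifP.
have e1 := star_balance L hu; have e2 := star_balance L hv.
have := pc u; have := pc (nx u); have := pc (nx (nx u)).
have := pt (nx u); have := pt (nx (nx u)) => p1 p2 p3 p4 p5.
suff : stop w (nx u) = 0 \/ corner w (nx (nx u)) = 0 /\ stop w (nx (nx u)) = 0.
  by case: leP => h; lra.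
case: (eqVneq (stop w (nx u)) 0) => [|nz]; [by left|right].
have hd : D (nx u) (nx (nx u)) by move: nz; rewrite /stop; case: ifP; rewrite ?eqxx.
have wz : w (ordS (nx u)) (nx (nx (nx u))) != 0 by move: nz; rewrite /stop hd.
split; apply/eqP; apply: contraT.
  rewrite /corner; case: ifP => [/andP[d1 d2] h|]; rewrite ?eqxx //.
  have := cw _ _ _ _ wz h.
  by rewrite (star_TC_next hs hv hv' hd d1).
rewrite /stop; case: ifP => [d1 h|]; rewrite ?eqxx //.
have := cw _ _ _ _ wz h.
by rewrite (star_TT_next hs hv hv' hd d1).
Qed.

Lemma star_unique : odd #|K| || [exists u in K, ~~ D u (nx u)] -> lam_unique R D.
Proof.
move=> hodd w w' L L' hx.
have E u : edge_weight (icoord w) u = edge_weight (icoord w') u.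
  by rewrite /edge_weight; case: ifP => // h; rewrite hx.
have S := star_corner_system L; have S' := star_corner_system L'.
have cE : {in K, corner w =1 corner w'}.
  apply: (@corner_uniq _ K nx hK _ (edge_weight (icoord w))) => //.
  - by move=> u _; exact: edge_weight_ge0.
  - case/orP: hodd => [->//|/exists_inP[u hu hd]]; apply/orP; right.
    by apply/exists_inP; exists u; rewrite // /edge_weight (negbTE hd).
  - by move=> u hu; rewrite S' // !E.
have tE : {in K, stop w =1 stop w'}.
  move=> v hv; have [u hu e] := next_surj hK hv; rewrite -e.
  have := star_balance L hu; have := star_balance L' hu; rewrite E !cE //; first by lra.
  exact: (star_nxK hs).
have sW : forall i j, w i j = w j i by case: L.
have sW' : forall i j, w' i j = w' j i by case: L'.
have same_E i j p q : same i j p q -> w p q = w' p q -> w i j = w' i j.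
  by case/orP => /andP[/eqP-> /eqP->] // h; rewrite sW sW'.
have key i j t : t \in K -> star_leaf D nx t i j -> w i j = w' i j.
  move=> ht; case/or3P => [/andP[d]|/andP[/andP[d d']]|/andP[d]] hsm; apply: (same_E _ _ _ _ hsm).
  - by have [-> _] := lam_chord t (nx t) L; have [-> _] := lam_chord t (nx t) L'; rewrite hx.
  - by have := cE t ht; rewrite /corner d d'.
  - by have := tE t ht; rewrite /stop d.
move=> i j; case: (eqVneq (w i j) 0) => [h0|/(lam_star_leaf L)[t ht h]]; last exact: key ht h.
case: (eqVneq (w' i j) 0) => [->//|/(lam_star_leaf L')[t ht h]]; exact: key ht h.
Qed.

Lemma cr_same i j k l p q r t : same i j p q -> same k l r t -> cr i j k l = cr p q r t.
Proof.
by case/orP => /andP[/eqP-> /eqP->]; case/orP => /andP[/eqP-> /eqP->]; cyc.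
Qed.

Lemma star_exists (x : 'I_n -> 'I_n -> R) : (forall i j, x i j = x j i) ->
  exists2 w, lamination D w & forall a b, D a b -> icoord w a b = x a b.
Proof.
move=> sx; pose y := edge_weight x.
have y0 u : u \in K -> 0 <= y u by move=> _; exact: edge_weight_ge0.
have [c hc] := corner_exists hK y0.
have c0 u : u \in K -> 0 <= c u by exact: (corner_ge0 hK y0 hc).
have cle u : u \in K -> c u <= y u /\ c u <= y (nx u) by exact: (corner_le hK y0 hc).
pose pr v := odflt v [pick u in K | nx u == v].
have prE u : u \in K -> pr (nx u) = u.
  move=> hu; rewrite /pr; case: pickP => [t /andP[ht /eqP e]|/(_ u)] /=.
    exact: (next_inj hK ht hu e).
  by rewrite hu eqxx.
(* What the corners at the two ends of the edge leave of its weight goes to the leaf that stops. *)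
pose t v := y v - c (pr v) - c v.
have tE u : u \in K -> y (nx u) = c u + c (nx u) + t (nx u).
  by move=> hu; rewrite /t prE //; lra.
have t0 v : v \in K -> 0 <= t v.
  move=> hv; have [u hu <-] := next_surj hK hv.
  have := hc u hu; have := tE u hu; case: (leP (y (nx u) - c u) (y (nx (nx u)))); lra.
have tD v : v \in K -> t v != 0 -> D v (nx v).
  move=> hv; apply: contraNT => hd; have yv : y v = 0 by rewrite /y /edge_weight (negbTE hd).
  have := t0 v hv; have [u hu e] := next_surj hK hv; rewrite -e in yv *.
  have := tE u hu; have := c0 u hu; have := c0 _ (star_nxK hs hu) => h1 h2 h3 h4.
  by apply/eqP; lra.
have cD u : u \in K -> c u != 0 -> D u (nx u) && D (nx u) (nx (nx u)).
  move=> hu; apply: contraNT; rewrite negb_and; have [h1 h2] := cle u hu; have h3 := c0 u hu.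
  rewrite /y /edge_weight in h1 h2.
  by case/orP => /negbTE h; rewrite h in h1 h2; apply/eqP; lra.
pose d u := Num.max 0 (- x u (nx u)).
have d0 u : 0 <= d u by rewrite /d le_max lexx.
pose isC u i j := D u (nx u) && D (nx u) (nx (nx u)) && same i j (ordS u) (ordS (nx u)).
pose isT u i j := D u (nx u) && same i j (ordS u) (nx (nx u)).
pose isF u i j := D u (nx u) && same i j u (nx u).
pose w i j := \sum_(u in K) ((isC u i j)%:R * c u + (isT u i j)%:R * t u + (isF u i j)%:R * d u).
have KS u v : u \in K -> v \in K -> D u (nx u) -> (ordS u == v) = false.
  by move=> hu hv hd; apply/negbTE; apply: contraNneq (noK hu hd) => ->.
have SK u v : u \in K -> v \in K -> D u (nx u) -> (v == ordS u) = false.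
  by move=> hu hv hd; rewrite eq_sym KS.
have pick1 u (f : 'I_n -> R) : u \in K -> \sum_(v in K) (v == u)%:R * f v = f u.
  move=> hu; rewrite (bigD1 u) //= eqxx mul1r big1 ?addr0 // => v /andP[_ /negbTE ->].
  by rewrite mul0r.
have wF u : u \in K -> D u (nx u) -> w u (nx u) = d u.
  move=> hu hd; have nu := star_nxK hs hu; rewrite -[RHS](pick1 u) //; apply: eq_bigr => v hv.
  have nv := star_nxK hs hv; have nnv := star_nxK hs nv.
  have -> : isC v u (nx u) = false.
    by apply/negbTE/negP => /andP[/andP[d1 d2]]; rewrite /same !SK.
  have -> : isT v u (nx u) = false.
    by apply/negbTE/negP => /andP[d1]; rewrite /same !(SK v) // andbF.
  have -> : isF v u (nx u) = (v == u).
    apply/idP/eqP => [/andP[_ /orP[]/andP[/eqP-> //]]|->]; last by rewrite /isF hd /same !eqxx.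
    by move=> /eqP e; have := star_ge3 hs hv; rewrite e eqxx.
  by rewrite !mul0r !add0r.
have wC u : u \in K -> D u (nx u) -> D (nx u) (nx (nx u)) -> w (ordS u) (ordS (nx u)) = c u.
  move=> hu d1 d2; have nu := star_nxK hs hu; rewrite -[RHS](pick1 u) //; apply: eq_bigr => v hv.
  have nv := star_nxK hs hv; have nnv := star_nxK hs nv.
  have -> : isT v (ordS u) (ordS (nx u)) = false.
    by apply/negbTE/negP => /andP[_]; rewrite /same !(KS _ (nx (nx v))) // !andbF.
  have -> : isF v (ordS u) (ordS (nx u)) = false.
    by apply/negbTE/negP => /andP[_]; rewrite /same !(KS u) .
  have -> : isC v (ordS u) (ordS (nx u)) = (v == u).
    apply/idP/eqP => [/andP[_ /orP[]/andP[/eqP/ordS_inj e1 /eqP/ordS_inj e2]]|->] //.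
      by have := star_ge3 hs hv; rewrite -e1 e2 eqxx.
    by rewrite /isC d1 d2 /same !eqxx.
  by rewrite !mul0r !addr0.
have wT u : u \in K -> D u (nx u) -> w (ordS u) (nx (nx u)) = t u.
  move=> hu d1; have nu := star_nxK hs hu; have nnu := star_nxK hs nu.
  rewrite -[RHS](pick1 u) //; apply: eq_bigr => v hv.
  have nv := star_nxK hs hv; have nnv := star_nxK hs nv.
  have -> : isC v (ordS u) (nx (nx u)) = false.
    by apply/negbTE/negP => /andP[/andP[e1 e2]]; rewrite /same !(SK _ (nx (nx u))) // !andbF.
  have -> : isF v (ordS u) (nx (nx u)) = false.
    by apply/negbTE/negP => /andP[_]; rewrite /same !(KS u).
  have -> : isT v (ordS u) (nx (nx u)) = (v == u).
    apply/idP/eqP => [/andP[_ /orP[]/andP[/eqP e1 /eqP e2]]|->].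
    + by rewrite (ordS_inj e1).
    + by have := KS _ _ hu nnv d1; rewrite e1 eqxx.
    by rewrite /isT d1 /same !eqxx.
  by rewrite !mul0r !addr0 add0r.
have wn i j : w i j != 0 -> exists2 u, u \in K &
   [\/ isC u i j /\ c u != 0, isT u i j /\ t u != 0 | isF u i j /\ d u != 0].
  case/sum_neq0=> u hu h; exists u => //.
  have z (e : bool) (r : R) : ~~ (e && (r != 0)) -> e%:R * r = 0.
    by case: e => [/negPn/eqP->|]; rewrite ?mulr0 ?mul0r.
  case: (boolP (isC u i j && (c u != 0))) => [/andP[]|hC]; first by constructor 1.
  case: (boolP (isT u i j && (t u != 0))) => [/andP[]|hT]; first by constructor 2.
  by constructor 3; apply/andP; apply: contraNT h => hF; rewrite !z // !addr0.
have sw i j : w i j = w j i.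
  by apply: eq_bigr => u _; rewrite /isC /isT /isF !(sameC i j).
have leafw i j : w i j != 0 -> exists2 u, u \in K & star_leaf D nx u i j.
  move=> /wn[u hu h]; exists u => //; rewrite /star_leaf.
  by case: h => -[]; rewrite /isC /isT /isF => -> _; rewrite ?orbT.
have dc u : d u != 0 -> y u = 0.
  rewrite /d /y /edge_weight; case: ifP => // _; case: (leP 0 (- x u (nx u))) => h1; rewrite ?eqxx //.
  by rewrite max_l //; lra.
have cz u : u \in K -> y u = 0 -> c u = 0.
  by move=> hu e; have [] := cle u hu; have := c0 u hu; rewrite e; lra.
have cz' u : u \in K -> y (nx u) = 0 -> c u = 0.
  by move=> hu e; have [] := cle u hu; have := c0 u hu; rewrite e; lra.
have tz u : u \in K -> y u = 0 -> t u = 0.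
  move=> hu e; have [v hv ev] := next_surj hK hu; have := tE v hv.
  have := c0 v hv; have := c0 _ (star_nxK hs hv); have := t0 _ (star_nxK hs hv); rewrite ev e; lra.
(* If mass is left on the edge of [u], the minimum defining [c u] is its second argument [y (nx u)],
   so the corner [c u] uses up the next edge. This is the noncrossing condition for stopping
   leaves. *)
have tnext u : u \in K -> t u != 0 -> c (nx u) = 0 /\ t (nx u) = 0.
  move=> hu nz; have nu := star_nxK hs hu; have nnu := star_nxK hs nu.
  have [v hv ev] := next_surj hK hu.
  have e1 := tE v hv; have e2 := tE u hu; have e3 := hc v hv; rewrite ev in e1 e3.
  have : 0 < t u by rewrite lt_neqAle eq_sym nz t0.
  have := c0 _ nu; have := t0 _ nu.
  by move: e3; case: (leP (y u - c v) (y (nx u))) => h e3 h1 h2 h3; split; lra.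
have L : lamination D w.
  split=> //.
  - move=> i j; apply: sumr_ge0 => u hu; rewrite !addr_ge0 // mulr_ge0 ?ler0n //; [exact: c0|exact: t0].
  - by move=> i j /leafw[u hu h]; exact: (star_leaf_acc hs hu h).
  move=> i j k l /wn[u hu h1] /wn[v hv h2].
  have nu := star_nxK hs hu; have nv := star_nxK hs hv.
  case: h1 => -[h1 n1]; case: h2 => -[h2 n2].
  - case/andP: h1 => /andP[a1 a2] h1; case/andP: h2 => /andP[b1 b2] h2.
    by rewrite (cr_same h1 h2); exact: (star_CC hs).
  - case/andP: h1 => /andP[a1 a2] h1; case/andP: h2 => b1 h2.
    rewrite (cr_same h1 h2); apply: (star_CT hs) => //.
    by apply: contraNneq n1 => ->; have [-> _] := tnext v hv n2.
  - case/andP: h1 => /andP[a1 a2] h1; case/andP: h2 => b1 h2.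
    rewrite (cr_same h1 h2) crC; apply: (star_FC hs) => //; apply: contraNneq n1 => e.
      by rewrite -e (cz v hv (dc v n2)).
    by rewrite (cz' u hu) // -e (dc v n2).
  - case/andP: h1 => a1 h1; case/andP: h2 => /andP[b1 b2] h2.
    rewrite (cr_same h1 h2) crC; apply: (star_CT hs) => //.
    by apply: contraNneq n2 => ->; have [-> _] := tnext u hu n1.
  - case/andP: h1 => a1 h1; case/andP: h2 => b1 h2.
    rewrite (cr_same h1 h2); apply: (star_TT hs) => //.
      by apply: contraNneq n2 => ->; have [_ ->] := tnext u hu n1.
    by apply: contraNneq n1 => ->; have [_ ->] := tnext v hv n2.
  - case/andP: h1 => a1 h1; case/andP: h2 => b1 h2.
    rewrite (cr_same h1 h2) crC; apply: (star_FT hs) => //; apply: contraNneq n1 => e.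
    by rewrite -e (tz v hv (dc v n2)).
  - case/andP: h1 => a1 h1; case/andP: h2 => /andP[b1 b2] h2.
    rewrite (cr_same h1 h2); apply: (star_FC hs) => //; apply: contraNneq n2 => e.
      by rewrite -e (cz u hu (dc u n1)).
    by rewrite (cz' v hv) // -e (dc u n1).
  - case/andP: h1 => a1 h1; case/andP: h2 => b1 h2.
    rewrite (cr_same h1 h2); apply: (star_FT hs) => //; apply: contraNneq n2 => e.
    by rewrite -e (tz u hu (dc u n1)).
  - case/andP: h1 => a1 h1; case/andP: h2 => b1 h2.
    by rewrite (cr_same h1 h2); exact: (star_FF hs).
exists w => //.
have key v : v \in K -> D v (nx v) -> icoord w v (nx v) = x v (nx v).
  move=> hv hd; have [u hu ev] := next_surj hK hv.
  rewrite /icoord wF // -ev (star_sum sw leafw hu) ?ev //.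
  have cornE z : z \in K -> corner w z = c z.
    move=> hz; rewrite /corner; case: ifPn => [/andP[d1 d2]|h]; first by rewrite wC.
    by apply/esym/eqP; apply: contraNT h; exact: cD.
  rewrite !cornE // /stop hd wT //.
  have := tE u hu; rewrite ev => <-; rewrite /y /edge_weight hd /d.
  by case: (leP 0 (x v (nx v))) => h; case: leP => h'; lra.
move=> a b hab; case: (star_chord hs hab) => -[hK1 e]; subst.
  exact: key.
by rewrite icoord_sym // sx; apply: key => //; rewrite noncrossing_sym.
Qed.
End StarLam.

(** * Existence and uniqueness of laminations by induction on the dissection *)

Section Core.
Variables (R : realFieldType) (n : nat).
Implicit Types (a b c d i j k l u v x y z : 'I_n) (D : rel 'I_n).

Record even_cell D (K : {set 'I_n}) (nx : 'I_n -> 'I_n) : Prop := EvenCell {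
  even_pt : exists u, u \in K;
  even_next : next_in K nx;
  even_ge3 : forall u, u \in K -> nx (nx u) != u;
  even_edge : forall u, u \in K -> D u (nx u);
  even_chord : forall x y, x \in K -> y \in K -> D x y -> y = nx x \/ x = nx y;
  even_card : ~~ odd #|K| }.

(** The edges of the cell are chords of the side, so its vertices avoid the removed arc and no
    dropped chord joins two of them. *)
Lemma even_cell_side D a b K nx : noncrossing D -> D a b ->
  even_cell (side a b D) K nx -> even_cell D K nx.
Proof.
move=> hD hab [h1 h2 h3 h4 h5 h6]; split=> //.
  by move=> u /h4/and3P[].
have out u : u \in K -> ~~ btw a u b by move=> /h4/and3P[].
by move=> x y hx hy hxy; apply: h5; rewrite // /side hxy !out.
Qed.

Definition lam_exists D := forall x : 'I_n -> 'I_n -> R, (forall i j, x i j = x j i) ->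
  exists2 w, lamination D w & forall a b, D a b -> icoord w a b = x a b.

Section OneCell.
Variable D : rel 'I_n.
Hypotheses (hD : noncrossing D) (hn : (2 < n)%N).

Definition outer a b := D a b && [forall c : 'I_n, btw a c b ==> [forall d : 'I_n, ~~ D c d]].
Hypothesis hout : forall a b, D a b -> outer a b || outer b a.
(** If [outer] holds in both directions, [a b] is the only chord and either side could be taken as
    the cell; comparing the labels chooses one. *)
Definition oriented a b := outer a b && (outer b a ==> (a < b)%N).
Definition center := [set v : 'I_n | [forall a : 'I_n, forall b : 'I_n, oriented a b ==> ~~ btw a v b]].
Definition center_next u := odflt (ordS u) [pick b | oriented u b].

Lemma outer_end a b c d : outer a b -> D c d -> ~~ btw a c b.
Proof.
case/andP=> _ /forallP/(_ c) h hcd; apply/negP => hc; move: h; rewrite hc => /forallP/(_ d).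
by rewrite hcd.
Qed.

Lemma oriented_D a b : oriented a b -> D a b.
Proof. by case/andP=> /andP[]. Qed.

Lemma oriented_or a b : D a b -> oriented a b || oriented b a.
Proof.
move=> hab; have := hout hab; have := ends_neq hD hab; rewrite /oriented -val_eqE /=.
by case: (outer a b) (outer b a) => [] [] //=; case: ltngtP.
Qed.

Lemma oriented_anti a b : oriented a b -> ~~ oriented b a.
Proof.
case/andP=> h1 h2; apply/negP => /andP[h3 h4]; move: h2 h4; rewrite h1 h3 /=; lia.
Qed.

Lemma centerP v : reflect (forall a b, oriented a b -> ~~ btw a v b) (v \in center).
Proof.
rewrite inE; apply: (iffP forallP) => [h a b|h a].
  by move/forallP: (h a) => /(_ b)/implyP.
by apply/forallP => b; apply/implyP; exact: h.
Qed.

Lemma end_center c d : D c d -> c \in center.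
Proof. by move=> h; apply/centerP => a b /andP[ho _]; exact: outer_end ho h. Qed.

Lemma center_nextP u : oriented u (center_next u) \/
  center_next u = ordS u /\ forall b, ~~ oriented u b.
Proof.
rewrite /center_next; case: pickP => [b|h]; [by left|right]; split=> // b.
by rewrite h.
Qed.

Lemma center_next_D u b : oriented u b -> center_next u = b.
Proof.
move=> h; case: (center_nextP u) => [h'|[_ /(_ b)]]; last by rewrite h.
have sD := noncrossing_sym _ _ hD.
have hd := oriented_D h; have hd' := oriented_D h'.
have : ~~ btw u (center_next u) b.
  by case/andP: h => ho _; apply: (outer_end (d := u) ho); rewrite sD.
have : ~~ btw u b (center_next u).
  by case/andP: h' => ho _; apply: (outer_end (d := u) ho); rewrite sD.
by move: (ends_neq hD hd) (ends_neq hD hd'); cyc.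
Qed.

Lemma center_star : star D center center_next.
Proof.
have sD := noncrossing_sym _ _ hD.
split=> //.
- move=> u hu; case: (center_nextP u) => [h|[-> h]].
    have hd := oriented_D h; split.
    + by apply: (end_center (d := u)); rewrite sD.
    + by rewrite eq_sym (ends_neq hD hd).
    + by move=> k /centerP; apply.
  split; last by move=> k _; exact: btw_ordS.
    apply/centerP => a b hab; have h1 := btw_ordS u a; have h2 := btw_ordS u b.
    have h3 : ~~ btw a u b by move/centerP: hu; apply.
    have h4 : u != a by apply: contraTneq hab => <-; exact: h.
    have h5 := ends_neq hD (oriented_D hab).
    by move: h1 h2 h3 h4 h5; cyc.
  exact: ordS_neq (ltnW hn).
- case: (pickP (fun p : 'I_n * 'I_n => D p.1 p.2)) => [[a b] /= h|h].
    by exists a; exact: end_center h.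
  exists (Ordinal (ltnW (ltnW hn))); apply/centerP => a b /oriented_D hab.
  by have := h (a, b); rewrite /= hab.
- move=> u hu; case: (center_nextP u) => [h|[e h]]; case: (center_nextP (center_next u)) => [h'|[e' h']].
  + apply/eqP => e; rewrite e in h'.
    by have := oriented_anti h; rewrite h'.
  + rewrite e'; apply/eqP => e; have := ends_nadj hD (oriented_D h).
    by rewrite /adj e eqxx orbT.
  + apply/eqP => e2; rewrite e2 in h'; have := ends_nadj hD (oriented_D h').
    by rewrite /adj e eqxx orbT.
  + rewrite e' e; apply/eqP => /(congr1 (@nat_of_ord n)); rewrite ordSE ordSE.
    have := ltn_ord u; case: (u.+1 =P n) => h1.
      by case: (1 =P n) => h2; lia.
    by case: (u.+2 =P n) => h2; lia.
- by move=> u hu; case: (center_nextP u) => [/oriented_D|[]]; [right|left].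
- move=> x y hxy; case/orP: (oriented_or hxy) => h; [left|right].
    by rewrite (center_next_D h) (end_center hxy).
  by rewrite (center_next_D h); split=> //; apply: (end_center (d := x)); rewrite sD.
Qed.
End OneCell.

Theorem lam_exists_unique D : noncrossing D ->
  lam_exists D /\ ((forall K nx, ~ even_cell D K nx) -> lam_unique R D).
Proof.
have [m] := ubnP #|[set p : 'I_n * 'I_n | D p.1 p.2]|.
elim: m D => // m IH D hm hD.
(* With at most two points any two distinct ones are adjacent, so there are neither chords nor
   leaves, and no cell with three vertices to work with. *)
have [hn|hn] := leqP n 2.
  have small i j : i != j -> adj i j.
    rewrite /adj -!(inj_eq (@ord_inj n)) !ordSE; have := ltn_ord i; have := ltn_ord j.
    by case: (i.+1 =P n) => h1; case: (j.+1 =P n) => h2; lia.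
  have noD x y : ~~ D x y.
    by apply/negP => h; have [_ /(_ _ _ h)/andP[/small ->]] := hD.
  have w0 w i j : lamination D w -> w i j = 0.
    case=> _ _ h _; apply/eqP; apply: contraT => /h[h1 h2 _].
    by rewrite small in h2.
  split=> [x _|_ w w' L L' _ i j]; last by rewrite !w0.
  exists (fun _ _ => 0); last by move=> a b; rewrite (negbTE (noD a b)).
  by split=> // i j; rewrite eqxx.
case: (pickP (fun p : 'I_n * 'I_n => [&& D p.1 p.2, ~~ outer D p.1 p.2 & ~~ outer D p.2 p.1])).
  move=> [a b] /= /and3P[hab h1 h2]; have hba : D b a by rewrite noncrossing_sym.
  (* A chord with an end strictly beyond [c d] is dropped by [side c d D], so the number of chords
     decreases. *)
  have small c d : D c d -> ~~ outer D c d ->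
      (#|[set p : 'I_n * 'I_n | side c d D p.1 p.2]| < m)%N.
    move=> hcd; rewrite /outer hcd /= negb_forall => /existsP[x].
    rewrite negb_imply negb_forall => /andP[hx /existsP[y]]; rewrite negbK => hxy.
    apply: leq_trans (_ : (#|[set p : 'I_n * 'I_n | D p.1 p.2]| <= m)%N); last by rewrite -ltnS.
    apply: proper_card; apply/properP; split.
      by apply/subsetP => p; rewrite !inE => /and3P[].
    by exists (x, y); rewrite !inE /= /side hxy ?hx.
  have [E1 U1] := IH _ (small _ _ hab h1) (side_noncrossing a b hD).
  have [E2 U2] := IH _ (small _ _ hba h2) (side_noncrossing b a hD).
  split=> [x sx|hne].
    have [w1 L1 X1] := E1 x sx; have [w2 L2 X2] := E2 x sx.
    have e : icoord w1 a b = icoord w2 a b.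
      rewrite X1 ?side_ends // X2 // /side hab.
      by cyc.
    have [w [L X X']] := lamination_glue hD hab L1 L2 e.
    exists w => // c d hcd; case: (side_or hD hab hcd) => h; first by rewrite X // X1.
    by rewrite X' // X2.
  apply: (lam_unique_cut hD hab).
    by apply: U1 => K nx /(even_cell_side hD hab); exact: hne.
  by apply: U2 => K nx /(even_cell_side hD hba); exact: hne.
move=> hout.
have {}hout a b : D a b -> outer D a b || outer D b a.
  by move=> h; have := hout (a, b); rewrite /= h /= -negb_or => /negbFE.
have hs := center_star hD hn hout.
split; first exact: (star_exists hs).
move=> hne; apply: (star_unique hs); apply: contraT => /norP[h1 h2].
exfalso; apply: (hne (center D) (center_next D)); split=> //.
- exact: star_pt hs.
- exact: star_next hs.
- exact: star_ge3 hs.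
- by move=> u hu; apply: contraT => hd; case/exists_inP: h2; exists u.
- by move=> x y _ _ /(star_chord hs)[] []; [left|right].
Qed.
End Core.

(** * Leaves beyond an even cell *)

Section EvenLeaves.
Local Open Scope nat_scope.
Variables (n : nat) (D : rel 'I_n) (K : {set 'I_n}) (nx : 'I_n -> 'I_n).
Hypotheses (hD : noncrossing D) (hc : even_cell D K nx).
Implicit Types (a b c d i j k u v x y z : 'I_n).
Let hK := even_next hc.

Definition neighbour u k := btw u k (nx u) && (D u k || adj u k).
(* The vertex following u in the cell lying beyond the edge (u, nx u). *)
Definition beyond u :=
  [arg min_(k < ordS u | neighbour u k) (if (k < nx u)%N then nx u - k else nx u + n - k)].

Lemma beyondP u : u \in K ->
  neighbour u (beyond u) /\ forall k, neighbour u k -> ~~ btw u (beyond u) k.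
Proof.
move=> hu; have hd := even_edge hc hu.
have h0 : neighbour u (ordS u) by rewrite /neighbour (ends_btw hD hd) /adj eqxx orbT.
rewrite /beyond; case: arg_minnP => // k hk hmin; split=> // l hl.
have := hmin _ hl; apply: contraTN => h; rewrite -ltnNge.
case/andP: hk => hk _; case/andP: hl => hl _; move: h hk hl.
have := ltn_ord u; have := ltn_ord k; have := ltn_ord l; have := ltn_ord (nx u).
by rewrite /btw; case: (ltnP k (nx u)); case: (ltnP l (nx u)); lia.
Qed.

Lemma edge_nocross x y x' y' : D x y || adj x y -> D x' y' || adj x' y' -> ~~ cr x y x' y'.
Proof.
have h a b c d : adj a b -> ~~ cr a b c d.
  case/orP => /eqP <-.
    by move: (btw_ordS a c) (btw_ordS a d); cyc.
  by move: (btw_ordS b c) (btw_ordS b d); cyc.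
case/orP => h1; last by move=> _; exact: h.
case/orP => h2; last by rewrite crC; exact: h.
by case: hD => _ _; apply.
Qed.

Lemma even_arc u d : u \in K -> d \in K \/ exists2 w, w \in K & btw w d (nx w).
Proof.
move=> hu; have [w hw] := next_arc hK d hu.
case/orP => [h|/andP[/eqP/val_inj -> _]]; first by right; exists w.
by left; case: (hK hw).
Qed.

Lemma even_facts u : u \in K ->
  [&& u != nx u, nx u != nx (nx u), nx (nx u) != u, ~~ btw u (nx (nx u)) (nx u),
    ~~ btw (nx u) u (nx (nx u)), btw u (beyond u) (nx u) &
    btw (nx u) (beyond (nx u)) (nx (nx u))].
Proof.
move=> hu; have [hv nu gu] := hK hu; have [hw nv gv] := hK hv.
rewrite eq_sym nu eq_sym nv (even_ge3 hc hu) gu // gv //=.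
by have [/andP[-> _] _] := beyondP hu; have [/andP[-> _] _] := beyondP hv.
Qed.

Lemma corner_vertex u d : u \in K -> D (nx u) d -> ~~ btw u d (nx u) ->
  ~~ btw (nx u) d (nx (nx u)) -> d = u \/ d = nx (nx u).
Proof.
move=> hu hd h1 h2; have [hv nu gu] := hK hu.
have [hdK|[w hw hwd]] := even_arc d hu.
  case: (even_chord hc hv hdK hd) => [->|e]; [by right|left].
  exact: (next_inj hK hdK hu (esym e)).
exfalso; have [_ _ /(_ _ _ _ _ (even_edge hc hw) hd)] := hD.
have uw : u != w by apply: contraNneq h1 => ->.
have vw : nx u != w by apply: contraNneq h2 => ->.
have nuw : nx u != nx w by apply: contra uw => /eqP e; rewrite (next_inj hK hu hw e).
have [_ nw gw] := hK hw.
by move: hwd uw vw nuw nw (gw _ hv); cyc.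
Qed.

(** A chord crossing the leaf may cross neither a cell edge nor the edges from [u] and [nx u] to the
    ends of the leaf. What remains besides the two cell edges are chords at [u] or [nx u] into the
    arcs, excluded because [beyond] is the extreme neighbour, and chords inside the cell, excluded
    by [corner_vertex]. *)
Lemma beyond_cross u c d : u \in K -> D c d ->
  cr (beyond u) (beyond (nx u)) c d = same c d u (nx u) || same c d (nx u) (nx (nx u)).
Proof.
move=> hu; have [hv nu gu] := hK hu.
have hF := even_facts hu; have [/andP[_ z1] z2] := beyondP hu.
have [/andP[_ z1'] z2'] := beyondP hv.
have one x y : D x y -> btw (beyond u) x (beyond (nx u)) ->
    cr (beyond u) (beyond (nx u)) x y = same x y u (nx u) || same x y (nx u) (nx (nx u)).
  move=> hxy hx; have hxy' : D x y || adj x y by rewrite hxy.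
  have c1 := edge_nocross hxy' z1; have c2 := edge_nocross hxy' z1'.
  have [_ _ c3] := hD; have c4 := c3 _ _ _ _ hxy (even_edge hc hu).
  have c5 := c3 _ _ _ _ hxy (even_edge hc hv).
  have sxy := noncrossing_sym x y hD.
  case: (eqVneq x (nx u)) => [ex|xv].
    rewrite ex in hxy c1 c2 c4 c5 *.
    have d1 : btw (nx u) y (nx (nx u)) -> ~~ btw (nx u) (beyond (nx u)) y.
      by move=> h; apply: z2'; rewrite /neighbour h hxy.
    have d2 : (btw u y (nx u) || btw (nx u) y (nx (nx u))) || ((y == u) || (y == nx (nx u))).
      case: (boolP (btw u y (nx u))) => //= h; case: (boolP (btw (nx u) y (nx (nx u)))) => //= h'.
      by have [->|->] := corner_vertex hu hxy h h'; rewrite eqxx ?orbT.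
    move/implyP: d1 => d1; rewrite /same; move: hF c1 c2 c4 c5 d1 d2 (ends_neq hD hxy); cyc.
  have d1 : btw u x (nx u) -> y != u.
    move=> h; apply: contraTneq hx => e; have : ~~ btw u (beyond u) x.
      by apply: z2; rewrite /neighbour h -e -sxy hxy.
    by move: hF h; cyc.
  move/implyP: d1 => d1; rewrite /same.
  by move: hF hx xv c1 c2 c4 c5 d1 (ends_neq hD hxy); cyc.
move=> hcd; have hdc : D d c by rewrite noncrossing_sym.
case: (boolP (btw (beyond u) c (beyond (nx u)))) => h1; first exact: one.
case: (boolP (btw (beyond u) d (beyond (nx u)))) => h2.
  have := one _ _ hdc h2; rewrite !(sameC c d) => <-; cyc.
by rewrite /same; move: hF h1 h2; cyc.
Qed.

Lemma beyond_not_chord u c d : u \in K -> D c d -> ~~ same (beyond u) (beyond (nx u)) c d.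
Proof.
move=> hu hcd; have hF := even_facts hu; have [_ _ c3] := hD.
have := c3 _ _ _ _ hcd (even_edge hc hu); rewrite /same; move: hF; cyc.
Qed.

Lemma beyond_neq u : u \in K -> beyond u != beyond (nx u).
Proof. by move=> hu; have := even_facts hu; cyc. Qed.

Lemma beyond_nadj u : u \in K -> ~~ adj (beyond u) (beyond (nx u)).
Proof.
move=> hu; apply/negP => /orP[]/eqP e.
  by have := btw_ordS (beyond u) (nx u); rewrite e; move: (even_facts hu); cyc.
by have := btw_ordS (beyond (nx u)) u; rewrite e; move: (even_facts hu); cyc.
Qed.

(** The leaf crosses all the edges of the path [beyond u], [u], [nx u], [beyond (nx u)], and every
    other edge it crosses has an end on this path. *)
Lemma beyond_acc u : u \in K -> acc D (beyond u) (beyond (nx u)).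
Proof.
move=> hu P hP; have [hv nu gu] := hK hu.
have hF := even_facts hu; have [/andP[_ z1] z2] := beyondP hu.
have [/andP[_ z1'] z2'] := beyondP hv.
have hd := even_edge hc hu; have hd' := even_edge hc hv.
have P1 : P u = P (beyond u) by apply: hP => //; move: hF; cyc.
have P2 : P u = P (nx u) by apply: hP; rewrite ?hd //; move: hF; cyc.
have P4 : P (nx u) = P (beyond (nx u)) by apply: hP => //; move: hF; cyc.
have one x y : D x y || adj x y -> rx (beyond u) (beyond (nx u)) x y ->
    (x == beyond u) || btw (beyond u) x (beyond (nx u)) -> P x = P (nx u).
  move=> hxy hr; have Pxy := hP _ _ hxy hr.
  have c1 := edge_nocross hxy z1; have c2 := edge_nocross hxy z1'.
  have c4 : ~~ cr x y u (nx u) by apply: edge_nocross; rewrite // hd.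
  have c5 : ~~ cr x y (nx u) (nx (nx u)) by apply: edge_nocross; rewrite // hd'.
  have nxy : x != y by move: hr; cyc.
  case: (eqVneq x (beyond u)) => [->|xz]; first by rewrite -P1 P2.
  case: (eqVneq x (nx u)) => [-> //|xv] /= hx.
  have d1 : btw u x (nx u) -> y != u.
    move=> h; apply: contraTneq hx => e; have : ~~ btw u (beyond u) x.
      by apply: z2; rewrite /neighbour h -e adjC noncrossing_sym.
    by move: hF h; cyc.
  move/implyP: d1 => d1.
  have /eqP ey : y == beyond (nx u) by move: hF hx xv c1 c2 c4 c5 d1 nxy hr; cyc.
  by rewrite Pxy ey.
have all x y : D x y || adj x y -> rx (beyond u) (beyond (nx u)) x y -> P x = P (nx u).
  move=> hxy hr; have hyx : D y x || adj y x by rewrite edgeC.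
  have [h|h] : (x == beyond u) || btw (beyond u) x (beyond (nx u)) \/
     (y == beyond u) || btw (beyond u) y (beyond (nx u)).
    by apply/orP; move: hr hF; cyc.
  - exact: one hxy hr h.
  - by rewrite (hP _ _ hxy hr) (one y x) // rx_sym.
by move=> x y x' y' h1 h2 h3 h4; rewrite (all _ _ h1 h2) (all _ _ h3 h4).
Qed.

Lemma beyond_nocross u u' : u \in K -> u' \in K ->
  ~~ cr (beyond u) (beyond (nx u)) (beyond u') (beyond (nx u')).
Proof.
move=> hu hu'; have [hv nu gu] := hK hu; have [hw nv gv] := hK hv.
have [hv' nu' gu'] := hK hu'; have [hw' nv' gv'] := hK hv'.
case: (eqVneq u u') => [<-|uu]; first by move: (even_facts hu); cyc.
have vv : nx u != nx u' by apply: contra uu => /eqP/(next_inj hK hu hu')->.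
have f1 : (u' == nx u) ==> (beyond u' == beyond (nx u)) by apply/implyP => /eqP ->.
have f2 : (nx u' == u) ==> (beyond (nx u') == beyond u) by apply/implyP => /eqP ->.
have := even_facts hu; have := even_facts hu'.
move: (gu _ hu') (gu _ hv') (gu _ hw') (gv _ hu') (gv _ hv') (gv _ hw').
move: (gu' _ hu) (gu' _ hv) (gu' _ hw) (gv' _ hu) (gv' _ hv) (gv' _ hw).
by move: uu vv f1 f2; cyc.
Qed.
End EvenLeaves.

From mathcomp Require Import all_classical all_reals all_analysis.

Import numFieldNormedType.Exports.

Local Open Scope classical_set_scope.
Local Open Scope ring_scope.

(** * Fans from unique representations *)

Section CoordSum.
Variables (R : realType) (V : vectType R) (m : nat) (X : m.-tuple V) (c : 'I_m -> R).

Definition coord_sum (v : V) : R := \sum_i c i * coord X i v.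

Lemma coord_sum_scalar : scalar coord_sum.
Proof.
move=> k u v; rewrite /coord_sum mulr_sumr -big_split /=; apply: eq_bigr => i _.
by rewrite linearP mulrDr mulrCA.
Qed.
HB.instance Definition _ := GRing.isLinear.Build R V R *%R coord_sum coord_sum_scalar.

Lemma coord_sumE i : free X -> coord_sum X`_i = if insub i is Some j then c j else 0.
Proof.
move=> fX; rewrite /coord_sum; case: insubP => [j _ <-|hi].
  rewrite (bigD1 j) //= coord_free // eqxx mulr1 big1 ?addr0 // => k /negbTE h.
  by rewrite coord_free // eq_sym h mulr0.
by apply: big1 => k _; rewrite nth_default ?linear0 ?mulr0 // size_tuple leqNgt.
Qed.
End CoordSum.

Section Cones.
Variables (R : realType) (V : vectType R) (T : finType) (dv : T -> V).
Implicit Types (E F : {set T}) (W : T -> R).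

(** Weights indexed by the elements of [T], and equal to 0 outside [E], can be compared for
    different sets [E], unlike weights indexed by positions in a list. *)
Lemma cone_genP E v : cone_gen [seq dv e | e <- enum E] v <->
  exists W, [/\ forall e, 0 <= W e, forall e, e \notin E -> W e = 0
     & v = \sum_e W e *: dv e].
Proof.
have sumE W : (forall e, e \notin E -> W e = 0) ->
    \sum_e W e *: dv e = \sum_(e <- enum E) W e *: dv e.
  move=> h; rewrite big_enum /= [LHS](bigID (mem E)) /= [X in _ + X]big1 ?addr0 //.
  by move=> e /h ->; rewrite scale0r.
split=> [[w [w0 ->]]|[W [W0 WE ->]]].
  exists (fun e => if e \in E then w (index e (enum E)) else 0).
  split=> [e|e /negbTE -> //|]; first by case: ifP.
  rewrite sumE => [|e /negbTE -> //]; case: (pickP (mem E)) => [e0 he0|h]; last first.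
    have -> : enum E = [::] by apply/eqP; rewrite -size_eq0 -cardE (eq_card0 h).
    by rewrite big_nil big_ord0.
  rewrite (big_nth e0) big_mkord size_map; apply: eq_bigr => i _.
  rewrite (nth_map e0) // -mem_enum mem_nth // index_uniq ?enum_uniq //.
rewrite sumE //; case: (pickP (mem E)) => [e0 he0|h]; last first.
  have -> : enum E = [::] by apply/eqP; rewrite -size_eq0 -cardE (eq_card0 h).
  by exists (fun _ => 0); split=> //; rewrite big_nil big_ord0.
exists (fun i => W (nth e0 (enum E) i)); split=> //.
rewrite (big_nth e0) big_mkord size_map; apply: eq_bigr => i _.
by rewrite (nth_map e0).
Qed.

Variable Delta : {set T} -> Prop.
Hypothesis Dsub : forall E F : {set T}, Delta E -> F \subset E -> Delta F.
Hypothesis Dex : forall v, exists W,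
  [/\ forall e, 0 <= W e, Delta [set e | W e != 0]%SET & v = \sum_e W e *: dv e].
Hypothesis Duniq : forall W W', (forall e, 0 <= W e) -> (forall e, 0 <= W' e) ->
  Delta [set e | W e != 0]%SET -> Delta [set e | W' e != 0]%SET ->
  \sum_e W e *: dv e = \sum_e W' e *: dv e -> W =1 W'.

Lemma Delta_supp E W : Delta E -> (forall e, e \notin E -> W e = 0) ->
  Delta [set e | W e != 0]%SET.
Proof.
move=> hE h; apply: (Dsub hE); apply/fintype.subsetP => e; rewrite inE.
by apply: contraR => /h ->.
Qed.

(** The positive and the negative part of the coefficients of a linear relation are two weightings
    supported in [E] with the same sum; by uniqueness they are equal, so the coefficients vanish. *)
Lemma Delta_free E : Delta E -> free [seq dv e | e <- enum E].
Proof.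
move=> hE; pose s := [seq dv e | e <- enum E].
rewrite -[[seq dv e | e <- enum E]]/(tval (in_tuple s)).
apply/freeP => k hk i.
case: (pickP (mem E)) => [e0 he0|h]; last first.
  have e : enum E = [::] by apply/eqP; rewrite -size_eq0 -cardE (eq_card0 h).
  by move: i k hk; rewrite /s e /= => -[].
have ss : size s = size (enum E) by rewrite size_map.
pose f e := if e \in E then (if insub (index e (enum E)) is Some j then k j else 0) else 0.
have fi (j : 'I_(size s)) : f (nth e0 (enum E) j) = k j.
  have hj : (j < size (enum E))%N by rewrite -ss.
  by rewrite /f -mem_enum mem_nth // index_uniq ?enum_uniq // valK.
have fE e : e \notin E -> f e = 0 by rewrite /f => /negbTE ->.
have sumf : \sum_e f e *: dv e = 0.
  rewrite -[RHS]hk [LHS](bigID (mem E)) /= [X in _ + X]big1 ?addr0; last first.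
    by move=> e /fE ->; rewrite scale0r.
  rewrite -big_enum (big_nth e0) big_mkord -ss; apply: eq_bigr => j _.
  by rewrite fi (nth_map e0) // -ss.
pose p e := Num.max 0 (f e); pose q e := Num.max 0 (- f e).
have pq e : f e = p e - q e.
  by rewrite /p /q; case: (leP 0 (f e)) => h; case: (leP 0 (- f e)) => h'; lra.
have : p =1 q.
  apply: Duniq.
  - by move=> e; rewrite le_max lexx.
  - by move=> e; rewrite le_max lexx.
  - by apply: Delta_supp hE _ => e /fE h; rewrite /p h maxxx.
  - by apply: Delta_supp hE _ => e /fE h; rewrite /q h oppr0 maxxx.
  apply/eqP; rewrite -subr_eq0 -sumrB -[X in _ == X]sumf; apply/eqP.
  by apply: eq_bigr => e _; rewrite -scalerBl -pq.
by move/(_ (nth e0 (enum E) i)) => h; rewrite -fi pq h subrr.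
Qed.

Lemma cone_zero E (f : {scalar V}) : (forall e, e \in E -> 0 <= f (dv e)) ->
  cone_gen [seq dv e | e <- enum E] `&` [set v | f v = 0] =
  cone_gen [seq dv e | e <- enum [set e in E | f (dv e) == 0]%SET].
Proof.
move=> hf; apply/seteqP; split=> v.
  case=> /cone_genP[W [W0 WE ->]] /= f0; apply/cone_genP; exists W; split=> // e.
  rewrite inE negb_and => /orP[/WE//|fe].
  case: (boolP (e \in E)) => [he|/WE//].
  move/eqP: f0; rewrite linear_sum /= psumr_eq0 => [/allP/(_ e (mem_index_enum _))|e' _].
    by rewrite linearZ /= mulf_eq0 (negbTE fe) orbF => /eqP.
  rewrite linearZ /=; case: (boolP (e' \in E)) => [/hf h|/WE->]; last by rewrite mul0r.
  by rewrite mulr_ge0.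
case/cone_genP=> W [W0 WE ->]; split; last first.
  rewrite /= linear_sum big1 // => e _; rewrite linearZ /=.
  case: (boolP (e \in [set e in E | f (dv e) == 0]%SET)) => [|/WE->]; last by rewrite mul0r.
  by rewrite inE => /andP[_ /eqP->]; rewrite mulr0.
apply/cone_genP; exists W; split=> // e he; apply: WE; rewrite inE (negbTE he).
by [].
Qed.

(** As the generators are free, there is a linear form equal to 0 on those of [F] and to 1 on the
    others; it is nonnegative on the cone and cuts out the face. *)
Lemma cone_face E F : Delta E -> F \subset E ->
  is_face (cone_gen [seq dv e | e <- enum F]) (cone_gen [seq dv e | e <- enum E]).
Proof.
move=> hE hFE; pose s := [seq dv e | e <- enum E].
have fs : free (in_tuple s) by exact: Delta_free.
have ss : size s = size (enum E) by rewrite size_map.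
have [g hg] : exists g : {scalar V}, forall e, e \in E -> g (dv e) = (e \notin F)%:R.
  case: (pickP (mem E)) => [e0 he0|h]; last first.
    by exists (coord_sum (in_tuple s) (fun _ => 0)) => e; have := h e; rewrite /= => ->.
  exists (coord_sum (in_tuple s) (fun i => (nth e0 (enum E) i \notin F)%:R)) => e he.
  have hi : (index e (enum E) < size s)%N by rewrite ss index_mem mem_enum.
  have -> : dv e = (in_tuple s)`_(index e (enum E)).
    by rewrite /= (nth_map e0) -?ss // nth_index // mem_enum.
  rewrite -[LHS]/(coord_sum _ _ _) coord_sumE //; case: insubP => [j _ hj|]; last by rewrite hi.
  by rewrite hj nth_index // mem_enum.
have g0 e : e \in E -> 0 <= g (dv e) by move=> he; rewrite hg // ler0n.
exists g.
  move=> v /cone_genP[W [W0 WE ->]]; rewrite linear_sum; apply: sumr_ge0 => e _.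
  rewrite linearZ /=; case: (boolP (e \in E)) => [/g0 h|/WE->]; last by rewrite mul0r.
  by rewrite mulr_ge0.
suff e : [set e in E | g (dv e) == 0]%SET = F by rewrite cone_zero // e.
apply/setP => e; rewrite inE; case: (boolP (e \in E)) => he /=; last first.
  by apply/esym/negbTE; apply: contraNN he => /(fintype.subsetP hFE).
by rewrite hg // pnatr_eq0 eqb0 negbK.
Qed.

Lemma fan_of_unique_rep : complete_simplicial_fan
  [set cone_gen [seq dv e | e <- enum E] | E in [set E | Delta E]].
Proof.
split.
- split.
  + by move=> _ [E hE <-]; exists [seq dv e | e <- enum E].
  + move=> _ tau [E hE <-] [f hf ->]; exists [set e in E | f (dv e) == 0]%SET.
      by apply: (Dsub hE); apply/fintype.subsetP => e; rewrite inE => /andP[].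
    rewrite cone_zero // => e he; apply: hf; apply/cone_genP.
    exists (fun e' => (e' == e)%:R); split.
    * by move=> e'; rewrite ler0n.
    * by move=> e' he'; case: eqP => // e1; rewrite e1 he in he'.
    rewrite (bigD1 e) //= eqxx scale1r big1 ?addr0 // => e' /negbTE ->.
    by rewrite scale0r.
  + move=> _ _ [E hE <-] [F hF <-].
    (* A vector of both cones has two weightings, supported in [E] and in [F]; they coincide by
       uniqueness, so the support lies in the intersection. *)
    have -> : cone_gen [seq dv e | e <- enum E] `&` cone_gen [seq dv e | e <- enum F] =
        cone_gen [seq dv e | e <- enum (E :&: F)%SET].
      apply/seteqP; split=> v.
        case=> /cone_genP[W [W0 WE ->]] /cone_genP[W' [W0' WE' e]].
        have eW := Duniq W0 W0' (Delta_supp hE WE) (Delta_supp hF WE') e.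
        apply/cone_genP; exists W; split=> // x; rewrite inE negb_and => /orP[/WE//|h].
        by rewrite eW WE'.
      case/cone_genP=> W [W0 WE ->]; split; apply/cone_genP; exists W; split=> // x hx;
        by apply: WE; rewrite inE (negbTE hx) ?andbF.
    split; apply: cone_face => //; [exact: finset.subsetIl|exact: finset.subsetIr].
- by move=> _ [E hE <-]; exists [seq dv e | e <- enum E] => //; exact: Delta_free.
- apply/seteqP; split=> // v _; have [W [W0 hW e]] := Dex v.
  exists (cone_gen [seq dv e | e <- enum [set e | W e != 0]%SET]); first by exists [set e | W e != 0]%SET.
  apply/cone_genP; exists W; split=> // x; rewrite inE negbK => /eqP //.
Qed.
End Cones.

(** * The cone of an even cell is not simplicial *)

Section AlternatingSign.
Variables (n : nat) (K : {set 'I_n}) (nx : 'I_n -> 'I_n).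
Hypotheses (hK : next_in K nx) (hodd : ~~ odd #|K|).

Definition below (u : 'I_n) := #|[set k in K | (k < u)%N]%SET|.

(** [below] is the rank in [K], which grows by one along [nx] except for the return from rank
    [#|K| - 1] to rank 0; that return changes the parity because [#|K|] is even. *)
Lemma below_next u : u \in K -> odd (below (nx u)) = ~~ odd (below u).
Proof.
move=> hu; have [hv nu gu] := hK hu; rewrite -val_eqE /= in nu.
have [h|h] : (u < nx u \/ nx u < u)%N by move: nu; case: (ltngtP u (nx u)) => //; auto.
- suff -> : below (nx u) = (below u).+1 by [].
  rewrite /below -add1n -(cards1 u) -cardsUI.
  have -> : ([set u] :&: [set k in K | (k < u)%N])%SET = finset.set0.
    by apply/setP => k; rewrite !inE; case: eqP => //= ->; rewrite ltnn andbF.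
  rewrite cards0 addn0; apply: eq_card => k; rewrite !inE.
  case: (eqVneq k u) => [->|ku] /=; first by rewrite hu h.
  case: (boolP (k \in K)) => //= hk; have := gu k hk; rewrite /btw.
  by move: ku; rewrite -val_eqE /=; lia.
- have -> : below (nx u) = 0%N.
    apply/eqP; rewrite cards_eq0; apply/eqP/setP => k; rewrite !inE.
    by apply/negbTE/negP => /andP[/gu]; rewrite /btw; lia.
  have e : #|K| = (below u).+1.
    rewrite /below -add1n -(cards1 u) -cardsUI.
    have -> : ([set u] :&: [set k in K | (k < u)%N])%SET = finset.set0.
      by apply/setP => k; rewrite !inE; case: eqP => //= ->; rewrite ltnn andbF.
    rewrite cards0 addn0; apply: eq_card => k; rewrite !inE.
    case: (eqVneq k u) => [->//|ku] /=.
    case: (boolP (k \in K)) => //= hk; have := gu k hk; rewrite /btw.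
    by move: ku; rewrite -val_eqE /=; lia.
  by move: hodd; rewrite e /= negbK => ->.
Qed.
End AlternatingSign.

Section NotSimplicial.
Variables (R : realType) (V : vectType R) (n : nat) (K : {set 'I_n}) (nx : 'I_n -> 'I_n).
Variables (ev : 'I_n -> V) (f : 'I_n -> {scalar V}).
Hypotheses (hK : next_in K nx) (hodd : ~~ odd #|K|) (K0 : exists u, u \in K).
Hypothesis hge3 : forall u, u \in K -> nx (nx u) != u.
Hypothesis fE : forall i j, i \in K -> j \in K -> f i (ev j) = (i == j)%:R.

Let v u := ev u + ev (nx u).

Let nK u : u \in K -> nx u \in K. Proof. by case/hK. Qed.

Let fv i u : i \in K -> u \in K -> f i (v u) = (i == u)%:R + (i == nx u)%:R.
Proof. by move=> hi hu; rewrite /v linearD /= !fE // nK. Qed.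

(* The d-vectors around an even cell satisfy one relation with alternating signs, and
   each of them spans an extreme ray, so their cone has too many rays. *)
Lemma even_cone_not_simplicial (C : set V) :
  (forall x, C x <-> exists2 a : 'I_n -> R, (forall u, 0 <= a u) & x = \sum_(u in K) a u *: v u) ->
  ~ exists2 s : seq V, free s & C = cone_gen s.
Proof.
move=> hC [s fs Cs].
have relation : \sum_(u in K) (-1) ^+ odd (below K u) *: v u = 0.
  rewrite (eq_bigr (fun u => (-1) ^+ odd (below K u) *: ev u - (-1) ^+ odd (below K (nx u)) *: ev (nx u))).
    rewrite sumrB; apply/eqP; rewrite subr_eq0; apply/eqP.
    have inj : {in K &, injective nx} by move=> x y; exact: (next_inj hK).
    have e : K = [set nx u | u in K]%SET.
      apply/setP => x; apply/idP/imsetP => [hx|[y hy ->]]; last exact: nK.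
      by have [y hy <-] := next_surj hK hx; exists y.
    by rewrite -[RHS](big_imset (fun x => (-1) ^+ odd (below K x) *: ev x) inj) -e.
  by move=> u hu; rewrite /v scalerDr (below_next hK hodd hu) signrN scaleNr opprK.
pose t := in_tuple s; pose m := size s.
have /boolp.choice[beta hb] : forall i : 'I_m, exists b : 'I_n -> R,
    (forall u, 0 <= b u) /\ s`_i = \sum_(u in K) b u *: v u.
  move=> i.
  have : C s`_i.
    rewrite Cs; exists (fun j : nat => (j == i)%:R); split=> [j|]; first by rewrite ler0n.
    rewrite (bigD1 i) //= eqxx scale1r big1 ?addr0 // => j /negbTE h.
    by have -> : (j == i :> nat) = false by []; rewrite scale0r.
  by move/hC => [a a0 e]; exists a.
have /boolp.choice[alpha ha] : forall u, exists b : 'I_m -> R, u \in K ->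
    (forall i, 0 <= b i) /\ v u = \sum_i b i *: s`_i.
  move=> u.
  case: (boolP (u \in K)) => hu; last by exists (fun _ => 0).
  have : C (v u).
    apply/hC; exists (fun w => (w == u)%:R) => [w|]; first by rewrite ler0n.
    rewrite (bigD1 u) //= eqxx scale1r big1 ?addr0 // => w /andP[_ /negbTE h].
    by rewrite h scale0r.
  by rewrite Cs => -[w [w0 e]]; exists (fun i => w i).
have fvu z u : z \in K -> u \in K -> f z (v u) =
    \sum_(i < m) \sum_(w in K) alpha u i * (beta i w * f z (v w)).
  move=> hz hu; have [a0 ->] := ha u hu; rewrite linear_sum; apply: eq_bigr => i _.
  have [b0 ->] := hb i; rewrite linearZ /= linear_sum mulr_sumr; apply: eq_bigr => w _.
  by rewrite linearZ.
have fv0 z w : z \in K -> w \in K -> 0 <= f z (v w).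
  by move=> hz hw; rewrite fv // addr_ge0 ?ler0n.
(* The vector [v u] is extreme: a form [f z] with [z] different from [u] and [nx u] vanishes on
   [v u], is nonnegative on all the generators and positive on [v w]. So no generator [s_i] used by
   [v u] can involve [v w]. The choice is [z = nx w] when [w = nx u], and [z = w] otherwise. *)
have zero u i w : u \in K -> w \in K -> w != u -> alpha u i * beta i w = 0.
  move=> hu hw wu; have [a0 _] := ha u hu; have [b0 _] := hb i.
  have [z hz [z1 z2 z3]] : exists2 z : 'I_n, z \in K & [/\ z != u, z != nx u & f z (v w) != 0].
    have [_ nw _] := hK hw; have hnw := nK hw.
    case: (eqVneq w (nx u)) => [e|wnu].
      exists (nx w) => //; split; first by rewrite e hge3.
        by rewrite -e.
      by rewrite fv // eqxx (negbTE nw) add0r oner_neq0.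
    exists w => //; split=> //.
    by rewrite fv // eqxx [w == nx w]eq_sym (negbTE nw) addr0 oner_neq0.
  have := fvu z u hz hu; rewrite fv // (negbTE z1) (negbTE z2) addr0 => /esym/eqP.
  rewrite psumr_eq0 => [/allP/(_ i (mem_index_enum _))|j _]; last first.
    apply: sumr_ge0 => w' hw'; rewrite !mulr_ge0 ?fv0 //; by have [] := hb j.
  rewrite psumr_eq0 => [/allP/(_ w (mem_index_enum _))|w' hw']; last by rewrite !mulr_ge0 ?fv0.
  by rewrite hw mulrA mulf_eq0 (negbTE z3) orbF => /eqP.
have ray u : u \in K -> exists i, alpha u i * beta i u != 0.
  move=> hu; have := fvu u u hu hu; have [_ nu _] := hK hu.
  rewrite fv // eqxx [u == nx u]eq_sym (negbTE nu) addr0 => e.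
  case: (pickP (fun i => alpha u i * beta i u != 0)) => [i hi|h]; first by exists i.
  move: e; rewrite big1 => [/eqP|i _]; first by rewrite oner_eq0.
  apply: big1 => w hw; rewrite mulrA; case: (eqVneq w u) => [->|wu].
    by have /negbFE/eqP-> := h i; rewrite mul0r.
  by rewrite zero // mul0r.
have /boolp.choice[iota hi] : forall u, exists i : 'I_m, u \in K -> alpha u i * beta i u != 0.
  have [u0 hu0] := K0; have [i0 _] := ray u0 hu0.
  move=> u; by case: (boolP (u \in K)) => [/ray[i hi]|_]; [exists i|exists i0].
have sray u : u \in K -> s`_(iota u) = beta (iota u) u *: v u.
  move=> hu; have [b0 ->] := hb (iota u); rewrite (bigD1 u) //= big1 ?addr0 // => w /andP[hw wu].
  have /eqP := zero u (iota u) w hu hw wu; have := hi u hu; rewrite !mulf_eq0.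
  by case/norP => /negbTE -> _ /= /eqP ->; rewrite scale0r.
have iinj : {in K &, injective iota}.
  move=> u u' hu hu' e; apply/eqP; apply: contraT; rewrite eq_sym => nuu.
  have /eqP := zero u (iota u) u' hu hu' nuu; have := hi u hu; rewrite !mulf_eq0.
  case/norP => /negbTE -> _ /=; have := hi u' hu'; rewrite -e mulf_eq0.
  by case/norP => _ /negbTE ->.
(* The alternating relation rewritten on the free family [s], where [s_(iota u)] is a nonzero
   multiple of [v u]. As [iota] is injective on [K], the coefficient at [iota u0] is a single
   nonzero term. *)
pose g i := \sum_(u in K | iota u == i) (-1) ^+ odd (below K u) * (beta (iota u) u)^-1.
have bn u : u \in K -> beta (iota u) u != 0 by move=> /hi; rewrite mulf_eq0 => /norP[].
have gs : \sum_i g i *: t`_i = 0.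
  rewrite -[RHS]relation (partition_big iota xpredT) //=; apply: eq_bigr => i _.
  rewrite scaler_suml; apply: eq_bigr => u /andP[hu /eqP <-].
  by rewrite sray // scalerA -mulrA mulVf ?bn // mulr1.
have [u0 hu0] := K0.
have /freeP/(_ g gs (iota u0)) : free t by [].
rewrite /g (bigD1 u0) /=; last by rewrite hu0 eqxx.
rewrite big1 ?addr0 => [/eqP|u /andP[/andP[hu /eqP e] nu]]; last first.
  by rewrite (iinj _ _ hu hu0 e) eqxx in nu.
by rewrite mulf_eq0 signr_eq0 invr_eq0 (negbTE (bn _ hu0)).
Qed.
End NotSimplicial.

(** * Plane geometry *)

Section Plane.
Variables (R : realType) (N : nat) (p : 'I_N -> R * R).
Hypothesis hp : clockwise p.
Implicit Types (a b c d i j k l u v : 'I_N) (x y : R * R).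

Definition ar i j x := signed_area2 (p i) (p j) x.

Lemma ar_swap i j x : ar j i x = - ar i j x.
Proof. by rewrite /ar /signed_area2; ring. Qed.

Lemma ar_btw i j k : btw i j k -> ar i j (p k) < 0.
Proof.
case/or3P => /andP[h1 h2].
- exact: hp h1 h2.
- have -> : ar i j (p k) = ar j k (p i) by rewrite /ar /signed_area2; ring.
  exact: hp h1 h2.
- have -> : ar i j (p k) = ar k i (p j) by rewrite /ar /signed_area2; ring.
  exact: hp h1 h2.
Qed.

Lemma ar_in a b k : btw a k b -> 0 < ar a b (p k).
Proof. by move=> h; rewrite ar_swap oppr_gt0; apply: ar_btw; move: h; cyc. Qed.

Lemma ar_out a b k : btw b k a -> ar a b (p k) < 0.
Proof. by move=> h; apply: ar_btw; move: h; cyc. Qed.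

Lemma ar_l a b : ar a b (p a) = 0. Proof. by rewrite /ar /signed_area2; ring. Qed.
Lemma ar_r a b : ar a b (p b) = 0. Proof. by rewrite /ar /signed_area2; ring. Qed.

Lemma ar_le0 a b k : ~~ btw a k b -> ar a b (p k) <= 0.
Proof.
move=> h; case: (eqVneq k a) => [->|ka]; first by rewrite ar_l.
case: (eqVneq k b) => [->|kb]; first by rewrite ar_r.
case: (eqVneq a b) => [->|ab]; first by have -> : ar b b (p k) = 0 by rewrite /ar /signed_area2; ring.
by apply/ltW/ar_out; move: h ka kb ab; cyc.
Qed.

Lemma ar_ge0 a b k : ~~ btw b k a -> 0 <= ar a b (p k).
Proof. by move/ar_le0; rewrite ar_swap; lra. Qed.

Lemma ar_comb (A : {set 'I_N}) (w : 'I_N -> R) x i j : \sum_(k in A) w k = 1 ->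
  x.1 = \sum_(k in A) w k * (p k).1 -> x.2 = \sum_(k in A) w k * (p k).2 ->
  ar i j x = \sum_(k in A) w k * ar i j (p k).
Proof.
move=> h e1 e2; rewrite /ar /signed_area2 e1 e2.
rewrite [RHS](eq_bigr (fun k => ((p j).1 - (p i).1) * (w k * (p k).2) -
   ((p j).2 - (p i).2) * (w k * (p k).1) +
   w k * ((p i).1 * ((p j).2 - (p i).2) - (p i).2 * ((p j).1 - (p i).1)))); last by move=> k _; ring.
rewrite [RHS]big_split /= sumrB -!mulr_sumr -mulr_suml h; ring.
Qed.

Lemma sum_set2 (T : finType) (i j : T) (F : T -> R) : i != j ->
  \sum_(k in [set i; j]%SET) F k = F i + F j.
Proof.
move=> ij; rewrite (bigD1 i) ?inE ?eqxx //= (bigD1 j) /=; last by rewrite !inE eqxx orbT eq_sym.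
rewrite big1 ?addr0 // => k; rewrite !inE => /andP[/andP[/orP[]/eqP-> h1] h2].
  by rewrite eqxx in h1.
by rewrite eqxx in h2.
Qed.

Lemma hull2_ar i j x : i != j -> hull p [set i; j]%SET x -> ar i j x = 0.
Proof.
move=> ij [w [w0 w1 e1 e2]]; rewrite (ar_comb i j w1 e1 e2) sum_set2 //.
by rewrite ar_l ar_r !mulr0 addr0.
Qed.

Lemma hull_interior_sub (T : finType) (q : T -> R * R) (A : {set T}) x : hull_interior q A x -> hull q A x.
Proof. by case=> w [w0 w1 e1 e2]; exists w; split=> // i; exact: ltW. Qed.

(* Barycenters only depend on the mass and on the two first moments of the weights. *)
Lemma hull_reweight (T : finType) (q : T -> R * R) (A B : {set T}) (w w' : T -> R) x :
  (forall z, 0 <= w' z) -> \sum_(z in A) w z = 1 ->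
  x.1 = \sum_(z in A) w z * (q z).1 -> x.2 = \sum_(z in A) w z * (q z).2 ->
  (forall g, [\/ g = fun=> 1, g = fun z => (q z).1 | g = fun z => (q z).2] ->
     \sum_(z in B) w' z * g z = \sum_(z in A) w z * g z) -> hull q B x.
Proof.
move=> w0 w1 e1 e2 E; exists w'; split=> //.
- rewrite -w1 -[RHS](eq_bigr _ (fun z _ => mulr1 (w z))) -[LHS](eq_bigr _ (fun z _ => mulr1 (w' z))).
  by apply: E; constructor 1.
- by rewrite e1 E //; constructor 2.
- by rewrite e2 E //; constructor 3.
Qed.

Lemma hull_sub (T : finType) (q : T -> R * R) (A B : {set T}) x : A \subset B -> hull q A x -> hull q B x.
Proof.
move=> /fintype.subsetP hAB [w [w0 w1 e1 e2]].
apply: (hull_reweight (w' := fun z => if z \in A then w z else 0) _ w1 e1 e2) => [z|F _]; first by case: ifP.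
rewrite (bigID (mem A)) /= [X in _ + X]big1 ?addr0 => [|z /andP[_ /negbTE->]]; last by rewrite mul0r.
rewrite (eq_bigl (fun z => z \in A)) => [|z]; first by apply: eq_bigr => z ->.
by case: (boolP (z \in A)) => [/hAB->|]; rewrite ?andbF.
Qed.

Lemma set2C (T : finType) (i j : T) : [set i; j]%SET = [set j; i]%SET.
Proof. by apply/setP => k; rewrite !inE orbC. Qed.

Lemma nocross_side i j k l : i != j -> ~~ cr i j k l ->
  ~~ btw i k j && ~~ btw i l j || ~~ btw j k i && ~~ btw j l i.
Proof. by cyc. Qed.

(** If [i j] and [k l] are not interlaced, [k] and [l] are weakly on the same side of the line
    through [i] and [j]. An interior point of [k l] on that line then forces both ends onto it, so
    the two chords are equal. *)
Lemma cross_cr i j k l : i != j -> k != l -> [set i; j]%SET != [set k; l]%SET ->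
  cross p [set i; j]%SET [set k; l]%SET -> cr i j k l.
Proof.
move=> ij kl nE [x [h1 [w [w0 w1 e1 e2]]]]; apply: contraT => /(nocross_side ij) hside.
have h0 := hull2_ar ij (hull_interior_sub h1).
rewrite (ar_comb i j w1 e1 e2) sum_set2 // in h0.
have z z0 : (z0 \in [set k; l]%SET) -> ar i j (p z0) = 0 -> (z0 == i) || (z0 == j).
  move=> _ hz; apply: contraT => /norP[n1 n2].
  have [h|h] : btw i z0 j \/ btw j z0 i by apply/orP; move: ij n1 n2; cyc.
    by have := ar_in h; rewrite hz ltxx.
  by have := ar_out h; rewrite hz ltxx.
suff [hk hl] : ar i j (p k) = 0 /\ ar i j (p l) = 0.
  have := z k; have := z l; rewrite !inE !eqxx orbT /= => /(_ isT hl) a1 /(_ isT hk) a2.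
  case/negP: nE; apply/eqP; move: a1 a2 kl; case/orP => /eqP->; case/orP => /eqP->; rewrite ?eqxx //.
  by rewrite set2C.
have wk := w0 k; have wl := w0 l.
case/orP: hside => /andP[/[dup] s1 s2 s3].
  have := ar_le0 s1; have := ar_le0 s3 => a1 a2.
  by split; apply/eqP; apply: contraT => ne; exfalso; move: h0 wk wl a1 a2 ne; nra.
have := ar_ge0 s1; have := ar_ge0 s3 => a1 a2.
by split; apply/eqP; apply: contraT => ne; exfalso; move: h0 wk wl a1 a2 ne; nra.
Qed.

Lemma pos2 (u v s t : R) : 0 < u -> 0 < v -> 0 <= s -> 0 <= t -> s + t = 1 -> 0 < s * u + t * v.
Proof.
move=> u0 v0 s0 t0 st; case: (eqVneq s 0) => [s1|s1].
  have -> : t = 1 by lra.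
  by rewrite s1 mul0r add0r mul1r.
by rewrite ltr_pwDl ?mulr_ge0 ?mulr_gt0 // ?ltW // lt_neqAle eq_sym s1.
Qed.

Lemma hull_disjoint i j k l x : i != j -> k != l -> ~~ cr i j k l ->
  i != k -> i != l -> j != k -> j != l ->
  hull p [set i; j]%SET x -> ~ hull p [set k; l]%SET x.
Proof.
move=> ij kl hcr ik il jk jl h1 [w [w0 w1 e1 e2]].
have h0 := hull2_ar ij h1; rewrite (ar_comb i j w1 e1 e2) sum_set2 // in h0.
rewrite sum_set2 // in w1; have wk := w0 k; have wl := w0 l.
have [/andP[a1 a2]|/andP[a1 a2]] : btw i k j && btw i l j \/ btw j k i && btw j l i.
- by apply/orP; move: ij ik il jk jl hcr; cyc.
- have := pos2 (ar_in a1) (ar_in a2) wk wl w1; rewrite h0 ltxx //.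
- have n1 := ar_out a1; have n2 := ar_out a2; rewrite -oppr_gt0 in n1; rewrite -oppr_gt0 in n2.
  by have := pos2 n1 n2 wk wl w1; rewrite !mulrN -opprD h0 oppr0 ltxx.
Qed.

Lemma cr_cross_btw i j k l : btw i k j -> btw j l i ->
  cross p [set i; j]%SET [set k; l]%SET.
Proof.
move=> h1 h2; have ij : i != j by move: h1; cyc.
have kl : k != l by move: h1 h2; cyc.
have a1 := ar_in h1; have a2 := ar_out h2.
have a3 : 0 < ar k l (p j) by apply: ar_in; move: h1 h2; cyc.
have a4 : ar k l (p i) < 0 by apply: ar_out; move: h1 h2; cyc.
pose s := ar k l (p j) - ar k l (p i).
have s0 : 0 < s by rewrite /s; lra.
have sE : s = ar i j (p k) - ar i j (p l) by rewrite /s /ar /signed_area2; ring.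
(* The barycentric coordinates of the intersection point on each of the two chords, as ratios of
   areas by Cramer's rule. *)
pose wi := ar k l (p j) / s; pose wj := - ar k l (p i) / s.
pose wk := - ar i j (p l) / s; pose wl := ar i j (p k) / s.
have pw (a b : 'I_N) (u v : R) : a != b -> 0 < u -> 0 < v -> u + v = 1 ->
    hull_interior p [set a; b]%SET (u * (p a).1 + v * (p b).1, u * (p a).2 + v * (p b).2).
  move=> ab u0 v0 uv; exists (fun z => if z == a then u else v).
  have ba : (b == a) = false by rewrite eq_sym (negbTE ab).
  split; rewrite ?sum_set2 ?eqxx ?ba //.
  by move=> z; case: ifP.
exists (wi * (p i).1 + wj * (p j).1, wi * (p i).2 + wj * (p j).2); split.
  apply: pw => //; rewrite /wi /wj; [by rewrite divr_gt0| by rewrite divr_gt0 // oppr_gt0|].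
  by rewrite -mulrDl -/s mulfV // gt_eqF.
have -> : (wi * (p i).1 + wj * (p j).1, wi * (p i).2 + wj * (p j).2) =
          (wk * (p k).1 + wl * (p l).1, wk * (p k).2 + wl * (p l).2).
  rewrite /wi /wj /wk /wl !(mulrAC _ s^-1) -!mulrDl.
  by congr (_ / _, _ / _); rewrite /ar /signed_area2; ring.
apply: pw => //; rewrite /wk /wl; [by rewrite divr_gt0 // oppr_gt0| by rewrite divr_gt0|].
by rewrite -mulrDl addrC -sE mulfV // gt_eqF.
Qed.

Lemma cr_cross i j k l : cr i j k l -> cross p [set i; j]%SET [set k; l]%SET.
Proof.
case/orP => /andP[h1 h2].
  rewrite (set2C k l); apply: cr_cross_btw; move: h1 h2; cyc.
by apply: cr_cross_btw; move: h1 h2; cyc.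
Qed.

(* The mass put on the far side of the chord is transported onto its ends along the
   segments that cross it. *)
Lemma hull_split (V : {set 'I_N}) a b x : a \in V -> b \in V -> a != b ->
  hull p V x -> ar a b x <= 0 -> hull p [set k in V | ~~ btw a k b]%SET x.
Proof.
move=> aV bV ab [w [w0 w1 e1 e2]] hx.
pose F k := (k \in V) && btw a k b; pose G k := (k \in V) && btw b k a.
pose A := \sum_(k | F k) w k * ar a b (p k); pose B := \sum_(l | G l) w l * - ar a b (p l).
have dec (g : 'I_N -> R) : \sum_(k in V) w k * g k =
    \sum_(k | F k) w k * g k + \sum_(l | G l) w l * g l + w a * g a + w b * g b.
  rewrite (bigD1 a) //= (bigD1 b) /=; last by rewrite bV eq_sym.
  rewrite (bigID (fun k : 'I_N => btw a k b)) /=.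
  rewrite (eq_bigl F) => [|k]; last by rewrite /F; case: (k \in V) => //=; move: ab; cyc.
  rewrite [X in _ + (_ + (_ + X))](eq_bigl G) => [|k]; last first.
    by rewrite /G; case: (k \in V) => //=; move: ab; cyc.
  ring.
have A0 : 0 <= A by apply: sumr_ge0 => k /andP[_ h]; rewrite mulr_ge0 // ltW // ar_in.
have B0 : 0 <= B by apply: sumr_ge0 => k /andP[_ h]; rewrite mulr_ge0 // oppr_ge0 ltW // ar_out.
have AB : A <= B.
  have eB : B = - \sum_(l | G l) w l * ar a b (p l).
    by rewrite /B -sumrN; apply: eq_bigr => l _; rewrite mulrN.
  move: hx; rewrite (ar_comb a b w1 e1 e2) dec ar_l ar_r !mulr0 !addr0 eB /A; lra.
case: (eqVneq A 0) => [Az|An].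
  apply: (hull_reweight w0 w1 e1 e2) => g _.
  rewrite [RHS](bigID (fun k : 'I_N => btw a k b)) /= [X in X + _]big1 ?add0r => [|k hk].
    by apply: eq_bigl => k; rewrite inE.
  move/eqP: Az; rewrite psumr_eq0 => [/allP/(_ k (mem_index_enum _))|k' /andP[_ h]]; last first.
    by rewrite mulr_ge0 // ltW // ar_in.
  rewrite /F hk /= mulf_eq0; case/andP: hk => _ hk.
  by rewrite (gt_eqF (ar_in hk)) orbF => /eqP ->; rewrite mul0r.
have Bp : 0 < B by rewrite (lt_le_trans _ AB) // lt_neqAle eq_sym An.
(* For each pair [k], [l] on opposite sides, the affine relation between the points [k], [l], [a],
   [b] is applied with factor [w k * w l / B]. In total this removes all the mass beyond the chord
   and the proportion [A / B], at most 1, of the mass on the near side. *)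
pose S (f : 'I_N -> 'I_N -> R) := \sum_(k | F k) \sum_(l | G l) w k * w l / B * f k l.
pose w' k := if btw b k a then w k * (1 - A / B) else
   if k == a then w a + S (fun k l => ar k l (p b)) else w b + S (fun k l => - ar k l (p a)).
have S0 f : (forall k l, F k -> G l -> 0 <= f k l) -> 0 <= S f.
  move=> hf; apply: sumr_ge0 => k hk; apply: sumr_ge0 => l hl.
  by rewrite !mulr_ge0 ?invr_ge0 ?hf // ltW.
have E (g : 'I_N -> R) : (forall k l, - ar a b (p l) * g k + ar a b (p k) * g l =
      ar k l (p b) * g a - ar k l (p a) * g b) ->
    \sum_(k in [set k in V | ~~ btw a k b]%SET) w' k * g k = \sum_(k in V) w k * g k.
  move=> hg.
  have -> : \sum_(k in [set k in V | ~~ btw a k b]%SET) w' k * g k =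
     \sum_(l | G l) w l * (1 - A / B) * g l + (w a + S (fun k l => ar k l (p b))) * g a +
     (w b + S (fun k l => - ar k l (p a))) * g b.
    rewrite (bigD1 a) /=; last by rewrite inE aV; cyc.
    rewrite (bigD1 b) /=; last by rewrite inE bV eq_sym ab andbT; cyc.
    rewrite (eq_bigl G) => [|k]; last first.
      by rewrite /G inE; case: (k \in V) => //=; move: ab; cyc.
    rewrite (eq_bigr (fun l => w l * (1 - A / B) * g l)) => [|l /andP[_ hl]]; last by rewrite /w' hl.
    rewrite /w' !eqxx eq_sym (negbTE ab).
    have -> : btw b a a = false by cyc.
    have -> : btw b b a = false by cyc.
    ring.
  rewrite dec.
  have e : S (fun k l => - ar a b (p l) * g k + ar a b (p k) * g l) =
      S (fun k l => ar k l (p b)) * g a + S (fun k l => - ar k l (p a)) * g b.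
    rewrite /S !mulr_suml -big_split /=; apply: eq_bigr => k _.
    rewrite !mulr_suml -big_split /=; apply: eq_bigr => l _; rewrite hg; ring.
  have e' : S (fun k l => - ar a b (p l) * g k + ar a b (p k) * g l) =
      \sum_(k | F k) w k * g k + A / B * \sum_(l | G l) w l * g l.
    rewrite /S (eq_bigr (fun k => w k * g k / B * B + w k * ar a b (p k) / B * \sum_(l | G l) w l * g l)).
      rewrite big_split /=; congr (_ + _).
        by apply: eq_bigr => k _; rewrite divfK // gt_eqF.
      by rewrite -mulr_suml -mulr_suml.
    move=> k _; rewrite {2}/B !mulr_sumr -big_split /=; apply: eq_bigr => l _; ring.
  have -> : \sum_(l | G l) w l * (1 - A / B) * g l = (1 - A / B) * \sum_(l | G l) w l * g l.
    by rewrite mulr_sumr; apply: eq_bigr => l _; ring.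
  move: e; rewrite e'; lra.
apply: (hull_reweight _ w1 e1 e2 (w' := w')) => [k|g hg].
  rewrite /w'; case: ifP => _.
    by rewrite mulr_ge0 // subr_ge0 ler_pdivrMr // mul1r.
  case: ifP => _; rewrite addr_ge0 // S0 // => u v /andP[_ hu] /andP[_ hv].
    by apply/ltW/ar_in; move: hu hv; cyc.
  by rewrite oppr_ge0; apply/ltW/ar_out; move: hu hv; cyc.
by apply: E => k l; case: hg => ->; rewrite /ar /signed_area2; ring.
Qed.

(** By [hull_split] all the mass can be taken weakly on one side of the chord. The areas then have
    one sign and weighted sum 0, so no mass is left off the ends. *)
Lemma hull_on_chord (V : {set 'I_N}) a b x : a \in V -> b \in V -> a != b ->
  hull p V x -> ar a b x = 0 -> hull p [set a; b]%SET x.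
Proof.
move=> aV bV ab hx h0.
have [|w [w0 w1 e1 e2]] := hull_split aV bV ab hx; first by rewrite h0.
move: h0; rewrite (ar_comb a b w1 e1 e2) => h0.
have wz k : k \in [set k in V | ~~ btw a k b]%SET -> k \notin [set a; b]%SET -> w k = 0.
  rewrite !inE => /andP[kV hk] /norP[ka kb].
  have hlt : ar a b (p k) < 0 by apply: ar_out; move: ab hk ka kb; cyc.
  have : \sum_(k in [set k in V | ~~ btw a k b]%SET) w k * - ar a b (p k) = 0.
    by rewrite (eq_bigr (fun k => - (w k * ar a b (p k)))) ?sumrN ?h0 ?oppr0 // => z _; rewrite mulrN.
  move/eqP; rewrite psumr_eq0 => [/allP/(_ k (mem_index_enum _))|z].
    by rewrite inE kV hk mulf_eq0 oppr_eq0 (lt_eqF hlt) orbF => /eqP.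
  by rewrite inE => /andP[_ hz]; rewrite mulr_ge0 // oppr_ge0 ar_le0.
have sub : [set a; b]%SET \subset [set k in V | ~~ btw a k b]%SET.
  by apply/fintype.subsetP => k; rewrite !inE => /orP[]/eqP->; rewrite ?aV ?bV; cyc.
apply: (hull_reweight w0 w1 e1 e2) => g _.
rewrite [RHS](bigID (mem [set a; b]%SET)) /= [X in _ + X]big1 ?addr0 => [|k /andP[h1 h2]]; last first.
  by rewrite wz // mul0r.
apply: eq_bigl => k; case: (boolP (k \in [set a; b]%SET)) => hk; last by rewrite andbF.
by rewrite (fintype.subsetP sub).
Qed.
End Plane.

Section Line.
Variable R : realType.
Implicit Types (x y z : R * R).

Definition line x y (t : R) : R * R :=
  ((1 - t) * x.1 + t * y.1, (1 - t) * x.2 + t * y.2).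

Lemma line_continuous x y : continuous (line x y).
Proof.
move=> t; have h (a b : R) : (fun t : R => (1 - t) * a + t * b) @ t --> (1 - t) * a + t * b.
  apply: cvgD; apply: cvgM; [|exact: cvg_cst|exact: cvg_id|exact: cvg_cst].
  by apply: cvgB; [exact: cvg_cst | exact: cvg_id].
exact: cvg_pair (h x.1 y.1) (h x.2 y.2).
Qed.

Variables (N : nat) (p : 'I_N -> R * R).
Implicit Types (a b c d i j k l u v : 'I_N).

Lemma ar_continuous i j : continuous (ar p i j).
Proof.
move=> y; rewrite /ar /signed_area2; apply: cvgB; apply: cvgM.
- exact: cvg_cst.
- by apply: cvgB; [exact: cvg_snd | exact: cvg_cst].
- by apply: cvgB; [exact: cvg_fst | exact: cvg_cst].
- exact: cvg_cst.
Qed.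

Lemma ar_line i j x y t : ar p i j (line x y t) = (1 - t) * ar p i j x + t * ar p i j y.
Proof. by rewrite /ar /signed_area2 /line /=; ring. Qed.

Lemma hull_segment i j : i != j ->
  hull p [set i; j]%SET = line (p i) (p j) @` `[0, 1].
Proof.
move=> ij; apply/seteqP; split=> z.
  case=> w [w0 w1 e1 e2]; rewrite sum_set2 // in w1; exists (w j).
    rewrite /= in_itv /= w0 /=; have := w0 i; lra.
  rewrite !sum_set2 // in e1 e2; rewrite (surjective_pairing z) e1 e2 /line.
  by have -> : 1 - w j = w i by lra.
case=> t; rewrite /= in_itv /= => /andP[t0 t1] <-.
exists (fun k => if k == i then 1 - t else t).
have ji : (j == i) = false by rewrite eq_sym (negbTE ij).
split; rewrite ?sum_set2 ?eqxx ?ji //; last by lra.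
by move=> k; case: ifP => _ //; lra.
Qed.

Lemma hull_line (V : {set 'I_N}) x y t : 0 <= t <= 1 -> hull p V x -> hull p V y ->
  hull p V (line x y t).
Proof.
move=> /andP[t0 t1] [w [w0 w1 e1 e2]] [w' [w0' w1' e1' e2']].
exists (fun k => (1 - t) * w k + t * w' k).
have E (g : 'I_N -> R) : \sum_(k in V) ((1 - t) * w k + t * w' k) * g k =
   (1 - t) * (\sum_(k in V) w k * g k) + t * (\sum_(k in V) w' k * g k).
  by rewrite !mulr_sumr -big_split /=; apply: eq_bigr => k _; ring.
split.
- by move=> k; rewrite addr_ge0 // mulr_ge0 //; lra.
- rewrite -(eq_bigr _ (fun k _ => mulr1 _)) E.
  by rewrite !(eq_bigr _ (fun k _ => mulr1 _)) w1 w1'; lra.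
- by rewrite E -e1 -e1'.
- by rewrite E -e2 -e2'.
Qed.

Lemma segment_hull_connected i j : i != j -> connected (hull p [set i; j]%SET).
Proof.
move=> ij; rewrite hull_segment //; apply: connected_continuous_connected.
  exact: segment_connected.
by apply: continuous_subspaceT; exact: line_continuous.
Qed.

Lemma segment_hull_closed i j : i != j -> closed (hull p [set i; j]%SET).
Proof.
move=> ij; rewrite hull_segment //; apply: compact_closed.
  exact: norm_hausdorff.
apply: continuous_compact; last exact: segment_compact.
by apply: continuous_subspaceT; exact: line_continuous.
Qed.

Lemma hull_vertex (V : {set 'I_N}) k : k \in V -> hull p V (p k).
Proof.
move=> kV; exists (fun l => (l == k)%:R).
have E (g : 'I_N -> R) : \sum_(l in V) (l == k)%:R * g l = g k.
  rewrite (bigD1 k) //= eqxx mul1r big1 ?addr0 // => l /andP[_ /negbTE->].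
  by rewrite mul0r.
split; rewrite ?E //.
by rewrite -[RHS](E (fun=> 1)); apply: eq_bigr => l _; rewrite mulr1.
Qed.
End Line.

(** * Closed cells as sign regions of the chords *)

Section Cells.
Variables (R : realType) (N : nat) (p : 'I_N -> R * R).
Hypothesis hp : clockwise p.
Variables (V : {set 'I_N}) (C : rel 'I_N).
Hypothesis hC : forall a b, C a b -> [/\ a \in V, b \in V & a != b].

Definition off_chords : set (R * R) :=
  hull p V `\` [set y | exists a b, C a b /\ hull p [set a; b]%SET y].

Lemma off_chordsP y : off_chords y <-> hull p V y /\ forall a b, C a b -> ar p a b y != 0.
Proof.
split=> -[hy h]; split=> //.
  move=> a b hab; apply/eqP => e; apply: h; exists a, b; split=> //.
  by have [aV bV ab] := hC hab; refine (hull_on_chord hp aV bV ab hy e).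
case=> a [b [hab hy']]; have [aV bV ab] := hC hab.
by have := h a b hab; rewrite hull2_ar ?eqxx.
Qed.

(** The area function of a chord has no zero on the component, so by connectedness it keeps the sign
    it has at [x]; passing to the closure makes the inequality weak. *)
Lemma cell_sign x y a b : closure (connected_component off_chords x) y ->
  off_chords x -> C a b -> 0 <= ar p a b x * ar p a b y.
Proof.
move=> hy hx hab; have [_ /(_ a b hab) x0] := (off_chordsP x).1 hx.
rewrite leNgt; apply/negP => hneg.
pose f z := ar p a b x * ar p a b z.
have fc : continuous f by move=> z; apply: cvgM; [exact: cvg_cst | exact: ar_continuous].
have [z [hz fz]] : (connected_component off_chords x `&` [set z | f z < 0]) !=set0.
  apply: hy; apply: open_nbhs_nbhs; split=> //.
  by apply: (open_comp (f := f) (D := [set r | r < 0])) => [w _|]; [exact: fc|exact: open_lt].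
have hi : is_interval (f @` connected_component off_chords x).
  apply/connected_intervalP; apply: connected_continuous_connected.
    exact: component_connected.
  exact: continuous_subspaceT.
have [] : (f @` connected_component off_chords x) 0.
  apply: (hi (f z) (f x)); [by exists z| |].
    by exists x => //; exact: connected_component_refl.
  by rewrite (ltW fz) /f -expr2 sqr_ge0.
move=> t ht /eqP; rewrite mulf_eq0 (negbTE x0) /=.
have /off_chordsP[_ /(_ a b hab) h] := connected_component_sub ht.
by rewrite (negbTE h).
Qed.

(** Along the segment from [y] to [x], all signs are strict except possibly at [y]. The half-open
    segment is thus a connected part of the component, and it tends to [y]. *)
Lemma sign_cell x y : off_chords x -> hull p V y ->
  (forall a b, C a b -> 0 <= ar p a b x * ar p a b y) ->
  closure (connected_component off_chords x) y.
Proof.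
move=> hx hy hs; have [hxV hx0] := (off_chordsP x).1 hx.
pose I := `]0, 1]%classic : set R.
have sub : line y x @` I `<=` connected_component off_chords x.
  apply: connected_component_max.
  - by exists 1; rewrite /I /= ?in_itv /= ?ltr01 ?lexx //; rewrite /line subrr !mul0r !add0r !mul1r -surjective_pairing.
  - move=> z [t]; rewrite /I /= in_itv /= => /andP[t0 t1] <-; apply/off_chordsP; split.
      by apply: hull_line => //; rewrite (ltW t0).
    move=> a b hab; rewrite ar_line; have := hs a b hab; have := hx0 a b hab => x0 xy.
    apply/eqP => e.
    have : 0 < ar p a b x * ((1 - t) * ar p a b y + t * ar p a b x).
      rewrite mulrDr ltr_wpDl //.
        by rewrite mulrCA mulr_ge0 //; lra.
      by rewrite mulrCA mulr_gt0 // -expr2 exprn_even_gt0.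
    by rewrite e mulr0 ltxx.
  - apply: connected_continuous_connected; last by apply: continuous_subspaceT; exact: line_continuous.
    by apply/connected_intervalP; exact: interval_is_interval.
apply: (closureS sub).
have y0 : line y x 0 = y by rewrite /line subr0 !mul1r !mul0r !addr0 -surjective_pairing.
rewrite -[X in closure _ X]y0 => B hB.
have /= h := @line_continuous R y x 0 B hB.
have [e e0 he] : exists2 e : R, 0 < e & forall t, `|t| < e -> B (line y x t).
  move: h => /nbhs_ballP[e e0 he]; exists e => // t ht; apply: he.
  by rewrite /ball /= sub0r normrN.
pose t := Num.min (e / 2) 1.
have t0 : 0 < t by rewrite /t lt_min ltr01 andbT divr_gt0.
have te : t < e by rewrite /t gt_min; apply/orP; left; lra.
have t1 : t <= 1 by rewrite /t ge_min lexx orbT.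
exists (line y x t); split.
  by exists t => //; rewrite /I /= in_itv /= t0.
by apply: he; rewrite gtr0_norm.
Qed.
End Cells.

(** * Connectedness of a union of noncrossing segments *)

Section SegmentUnion.
Variables (R : realType) (N : nat) (p : 'I_N -> R * R).
Hypothesis hp : clockwise p.
Variable S : rel 'I_N.
Hypothesis Sneq : forall x y, S x y -> x != y.
Hypothesis Snc : forall x y x' y', S x y -> S x' y' -> ~~ cr x y x' y'.

Definition segment_union : set (R * R) :=
  [set z | exists x y, S x y /\ hull p [set x; y]%SET z].

(** Noncrossing segments can meet only if they share an end, so a colouring constant on segments
    splits the union into two disjoint closed sets. Conversely a relatively open and closed subset
    contains each segment that it meets, and colours the points by membership. *)
Lemma segment_union_connectedP : connected segment_union <->
  forall P : 'I_N -> bool, (forall x y, S x y -> P x = P y) ->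
    forall x y x' y', S x y -> S x' y' -> P x = P x'.
Proof.
have vert x y : hull p [set x; y]%SET (p x) by apply: hull_vertex; rewrite !inE eqxx.
split=> [hconn P hP x y x' y' h h'|h].
  pose U (b : bool) := [set z | exists x y, [/\ S x y, P x = b & hull p [set x; y]%SET z]].
  have Ucl b : closed (U b).
    rewrite (_ : U b = \bigcup_(q in [set q : 'I_N * 'I_N | S q.1 q.2 && (P q.1 == b)]) hull p [set q.1; q.2]%SET).
      apply: closed_bigcup; first exact: finite_finset.
      by move=> q /andP[hq _]; apply: segment_hull_closed; exact: Sneq.
    apply/seteqP; split=> z.
      by case=> u [v [huv <- hz]]; exists (u, v); rewrite //= huv eqxx.
    by case=> -[u v] /= /andP[huv /eqP e] hz; exists u, v.
  have dis z b : U b z -> ~ U (~~ b) z.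
    move=> [u [v [huv Pu hz]]] [u' [v' [huv' Pu' hz']]].
    have e := hP _ _ huv; have e' := hP _ _ huv'.
    have nb : b <> ~~ b by case: b {Pu Pu'}.
    apply: (hull_disjoint hp (Sneq huv) (Sneq huv') (Snc huv huv') _ _ _ _ hz hz').
    - by apply: contra_notN nb => /eqP e1; rewrite -{1}Pu e1.
    - by apply: contra_notN nb => /eqP e1; rewrite -{1}Pu -Pu' e' e1.
    - by apply: contra_notN nb => /eqP e1; rewrite -{1}Pu -Pu' e e1.
    - by apply: contra_notN nb => /eqP e1; rewrite -{1}Pu -Pu' e e' e1.
  have full : U (P x) = segment_union.
    apply: hconn.
    - by exists (p x), x, y; split=> //; exact: vert.
    - exists (~` U (~~ P x)); first exact: closed_openC.
      apply/seteqP; split=> z.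
        by move=> hz; split; [case: hz => u [v [huv _ hz]]; exists u, v|exact: dis].
      move=> [[u [v [huv hz]]] nz]; exists u, v; split=> //.
      by apply: contrapT => ne; apply: nz; exists u, v; split=> //; move: ne; case: (P u) (P x) => [] [].
    - exists (U (P x)) => //.
      by apply/seteqP; split=> z; [move=> hz; split=> //; case: hz => u [v [huv _ hz]]; exists u, v | case].
  have : segment_union (p x') by exists x', y'; split=> //; exact: vert.
  rewrite -full => hx; apply: contrapT => ne; apply: (dis _ _ hx).
  exists x', y'; split=> //.
  by move: ne; case: (P x) (P x') => [] [].
move=> B [z0 Bz0] [G oG BO] [F cF BF].
pose P v := `[< B (p v) >].
have seg x y : S x y -> (hull p [set x; y]%SET `&` B) !=set0 -> hull p [set x; y]%SET `<=` B.
  move=> hxy hne; have ne := Sneq hxy.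
  have hsub : hull p [set x; y]%SET `<=` segment_union by move=> z hz; exists x, y.
  have e := segment_hull_connected (p := p) ne hne.
  rewrite -(e _ _); first by move=> z [].
    exists G => //; rewrite BO; apply/seteqP; split=> z; first by case=> hz [_ Oz].
    by case=> hz Oz; split=> //; split=> //; exact: hsub.
  exists F => //; rewrite BF; apply/seteqP; split=> z; first by case=> hz [_ Oz].
  by case=> hz Oz; split=> //; split=> //; exact: hsub.
have vert2 x y : hull p [set x; y]%SET (p y) by apply: hull_vertex; rewrite !inE eqxx orbT.
have hP x y : S x y -> P x = P y.
  move=> hxy; apply/asboolP/asboolP => hB; apply: (seg x y hxy).
  - by exists (p x).
  - exact: vert2.
  - by exists (p y).
  - exact: vert.
have [x [y [hxy hz0]]] : segment_union z0 by move: Bz0; rewrite BO => -[].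
have Bx : P x by apply/asboolP; apply: (seg x y hxy); [exists z0|exact: vert].
apply/seteqP; split=> z; first by rewrite {1}BO => -[].
case=> x' [y' [hxy' hz]]; apply: (seg x' y' hxy') => //.
exists (p x'); split; first exact: vert.
by apply/asboolP; rewrite -/(P x') -(h P hP x y x' y').
Qed.
End SegmentUnion.

(** * From labels to chords *)

Section Labels.
Variable n : nat.
Implicit Types (i j k l x y a b : 'I_n) (u v : 'I_(2 * n)).

Lemma solid_proof i : (2 * i < 2 * n)%N. Proof. by rewrite ltn_pmul2l. Qed.
Lemma hollow_proof i : (2 * i + 1 < 2 * n)%N. Proof. by have := ltn_ord i; lia. Qed.
Definition so i : 'I_(2 * n) := Ordinal (solid_proof i).
Definition ho i : 'I_(2 * n) := Ordinal (hollow_proof i).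

Lemma so_inj : injective so.
Proof. by move=> i j /(congr1 val) /= /eqP; rewrite eqn_pmul2l // => /eqP/val_inj. Qed.

Lemma ho_inj : injective ho.
Proof. by move=> i j /(congr1 val) /= /eqP; rewrite eqn_add2r eqn_pmul2l // => /eqP/val_inj. Qed.

Lemma solidP u : reflect (exists i, u = so i) (u \in solid n).
Proof.
rewrite inE; apply: (iffP idP) => [h|[i ->]]; last by rewrite /= mul2n odd_double.
have hu : (u./2 < n)%N by have := ltn_ord u; have := odd_double_half u; rewrite -mul2n; lia.
exists (Ordinal hu); apply: val_inj => /=.
by have := odd_double_half u; rewrite (negbTE h) -mul2n; lia.
Qed.

Lemma hollowP u : reflect (exists i, u = ho i) (u \in hollow n).
Proof.
rewrite inE; apply: (iffP idP) => [h|[i ->]]; last by rewrite /= addn1 /= mul2n odd_double.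
have hu : (u./2 < n)%N by have := ltn_ord u; have := odd_double_half u; rewrite -mul2n; lia.
exists (Ordinal hu); apply: val_inj => /=.
by have := odd_double_half u; rewrite h -mul2n; lia.
Qed.

Lemma ordS_ordS_so i : ordS (ordS (so i)) = so (ordS i).
Proof.
apply: ord_inj; rewrite ordSE ordSE [RHS]/= -[(i.+1 %% n)%N]/(nat_of_ord (ordS i)) ordSE /=.
have := ltn_ord i; case: (i.+1 =P n) => h1; case: ((2 * i).+1 =P 2 * n)%N => h2;
  case: (_ =P (2 * n)%N) => h3; lia.
Qed.

Lemma ordS_ordS_ho i : ordS (ordS (ho i)) = ho (ordS i).
Proof.
apply: ord_inj; rewrite ordSE ordSE [RHS]/= -[(i.+1 %% n)%N]/(nat_of_ord (ordS i)) ordSE /=.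
have := ltn_ord i; case: (i.+1 =P n) => h1; case: ((2 * i + 1).+1 =P 2 * n)%N => h2;
  case: (_ =P (2 * n)%N) => h3; lia.
Qed.

Lemma ord_pred_ho i : ord_pred (ho i) = so i.
Proof.
apply: (@ordS_inj _); rewrite ord_predK; apply: ord_inj; rewrite ordSE /=.
by have := ltn_ord i; case: eqP => h; lia.
Qed.

Lemma btw_so i j k : btw (so i) (so j) (so k) = btw i j k.
Proof. by rewrite /btw /= !ltn_pmul2l. Qed.

Lemma btw_ho i j k : btw (ho i) (ho j) (ho k) = btw i j k.
Proof. by rewrite /btw /= !ltn_add2r !ltn_pmul2l. Qed.

Lemma cr_so i j k l : cr (so i) (so j) (so k) (so l) = cr i j k l.
Proof. by rewrite /cr !btw_so. Qed.

Lemma cr_ho i j k l : cr (ho i) (ho j) (ho k) (ho l) = cr i j k l.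
Proof. by rewrite /cr !btw_ho. Qed.

Lemma cr_ho_so x y i j : cr (ho x) (ho y) (so i) (so j) = rx i j x y.
Proof.
have bt a b k : btw (ho a) (so k) (ho b) = hb a k b.
  rewrite /hb /btw /=.
  have e1 (s t : nat) : (2 * s + 1 < 2 * t)%N = (s < t)%N by apply/idP/idP; lia.
  have e2 (s t : nat) : (2 * s < 2 * t + 1)%N = (s <= t)%N by apply/idP/idP; lia.
  have e3 (s t : nat) : (2 * s + 1 < 2 * t + 1)%N = (s < t)%N by apply/idP/idP; lia.
  rewrite !e1 !e2 !e3; case: (ltngtP a k) => h1; case: (ltngtP k b) => h2;
  case: (ltngtP a b) => h3 //=; lia.
by rewrite /rx -!bt; cyc.
Qed.

Section Colour.
Variables (f : 'I_n -> 'I_(2 * n)) (V : {set 'I_(2 * n)}).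
Hypothesis f_inj : injective f.
Hypothesis f_in : forall u, reflect (exists i, u = f i) (u \in V).
Hypothesis f_S : forall i, ordS (ordS (f i)) = f (ordS i).

Lemma set2_inj i j k l : [set f i; f j]%SET = [set f k; f l]%SET -> i != j -> same i j k l.
Proof.
move=> e ij; have := set21 (f i) (f j); have := set22 (f i) (f j); rewrite e !inE !(inj_eq f_inj) /same.
by move: ij; cyc.
Qed.

Lemma same_set2 i j k l : same i j k l -> [set f i; f j]%SET = [set f k; f l]%SET.
Proof. by case/orP => /andP[/eqP-> /eqP->] //; exact: set2C. Qed.

Lemma diagonalP d : reflect (exists i j, i != j /\ d = [set f i; f j]%SET) (d \in diagonals V).
Proof.
rewrite inE; apply: (iffP andP) => [[/fintype.subsetP hV /cards2P[u [v [uv e]]]]|[i [j [ij ->]]]].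
  have /f_in[i ei] : u \in V by apply: hV; rewrite e !inE eqxx.
  have /f_in[j ej] : v \in V by apply: hV; rewrite e !inE eqxx orbT.
  by exists i, j; split; [apply: contraNneq uv => ij; rewrite ei ej ij | rewrite e ei ej].
split; last by rewrite cards2 (inj_eq f_inj) ij.
by apply/fintype.subsetP => u; rewrite !inE => /orP[]/eqP->; apply/f_in; [exists i|exists j].
Qed.

Lemma boundary_adj i j : i != j -> ([set f i; f j]%SET \in boundary_edges V) = adj i j.
Proof.
move=> ij; have fP k : ord_pred (ord_pred (f k)) = f (ord_pred k).
  by apply: (@ordS_inj _); apply: (@ordS_inj _); rewrite !ord_predK f_S ord_predK.
rewrite inE; have -> : [set f i; f j]%SET \in diagonals V by apply/diagonalP; exists i, j.
apply/existsP/orP => [[u /eqP e]|[]/eqP e].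
- have : u \in [set f i; f j]%SET by rewrite e !inE eqxx.
  rewrite !inE => /orP[]/eqP eu; rewrite eu fP in e.
    right; have := set2_inj e ij; rewrite /same eqxx /= => /orP[/eqP->|/andP[_ /eqP ji]].
      by rewrite ord_predK.
    by rewrite ji eqxx in ij.
  left; have := set2_inj e ij; rewrite /same eqxx /= (negbTE ij) /= andbT => /eqP ->.
  by rewrite ord_predK.
- by exists (f j); rewrite fP -e ordSK set2C.
- by exists (f i); rewrite fP -e ordSK.
Qed.
End Colour.
End Labels.

(** * Translation of dissections, accordions and d-vectors to chords on n points *)

Section Bridge.
Variables (R : realType) (n : nat) (p : 'I_(2 * n) -> R * R).
Hypothesis hp : clockwise p.
Variable D : {set {set 'I_(2 * n)}}.
Hypothesis hD : dissection p (hollow n) D.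
Implicit Types (i j k l x y a b : 'I_n) (u v : 'I_(2 * n)) (d e : {set 'I_(2 * n)}).

Definition hd x y : {set 'I_(2 * n)} := [set ho x; ho y]%SET.
Definition sd x y : {set 'I_(2 * n)} := [set so x; so y]%SET.
Definition chord : rel 'I_n := fun x y => (x != y) && (hd x y \in D).

Lemma hd_inj x y x' y' : hd x y = hd x' y' -> x != y -> same x y x' y'.
Proof. by apply: set2_inj; exact: ho_inj. Qed.
Lemma sd_inj x y x' y' : sd x y = sd x' y' -> x != y -> same x y x' y'.
Proof. by apply: set2_inj; exact: so_inj. Qed.

Lemma hollow_diagonalP d : reflect (exists x y, x != y /\ d = hd x y) (d \in diagonals (hollow n)).
Proof. by apply: diagonalP; [exact: ho_inj | exact: hollowP]. Qed.
Lemma solid_diagonalP d : reflect (exists x y, x != y /\ d = sd x y) (d \in diagonals (solid n)).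
Proof. by apply: diagonalP; [exact: so_inj | exact: solidP]. Qed.
Lemma hollow_boundary x y : x != y -> (hd x y \in boundary_edges (hollow n)) = adj x y.
Proof. by apply: boundary_adj; [exact: ho_inj | exact: hollowP | exact: ordS_ordS_ho]. Qed.
Lemma solid_boundary x y : x != y -> (sd x y \in boundary_edges (solid n)) = adj x y.
Proof. by apply: boundary_adj; [exact: so_inj | exact: solidP | exact: ordS_ordS_so]. Qed.

Lemma chord_of d : d \in D -> exists x y, chord x y /\ d = hd x y.
Proof.
move=> hd'; have /setDP[/hollow_diagonalP[x [y [xy e]]] _] := fintype.subsetP hD.1 _ hd'.
by exists x, y; rewrite /chord xy -e hd'.
Qed.

Lemma hd_chord x y : x != y -> hd x y \in D = chord x y.
Proof. by move=> xy; rewrite /chord xy. Qed.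

Lemma crossing_cr x y x' y' : x != y -> x' != y' -> cr x y x' y' -> cross p (hd x y) (hd x' y').
Proof. by move=> h h' hc; apply: cr_cross => //; rewrite cr_ho. Qed.

Lemma cr_same_ends x y x' y' : same x y x' y' -> ~~ cr x y x' y'.
Proof. by rewrite /same; cyc. Qed.

Lemma chord_noncrossing : noncrossing chord.
Proof.
split.
- by move=> x y; rewrite /chord eq_sym /hd set2C.
- move=> x y /andP[xy h]; rewrite xy /=; have /setDP[_] := fintype.subsetP hD.1 _ h.
  by rewrite hollow_boundary.
- move=> x y x' y' /andP[xy h] /andP[xy' h']; apply/negP => hcr.
  case: (eqVneq (hd x y) (hd x' y')) => [e|ne].
    by have := cr_same_ends (hd_inj e xy); rewrite hcr.
  by apply: (hD.2 _ _ h h' ne); exact: crossing_cr.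
Qed.

Lemma completionP d : reflect (exists x y, [/\ x != y, chord x y || adj x y & d = hd x y])
  (d \in completion (hollow n) D).
Proof.
rewrite inE; apply: (iffP orP) => [[/chord_of[x [y [h ->]]]|h]|[x [y [xy h ->]]]].
- by exists x, y; rewrite h; case/andP: h.
- have hdg : d \in diagonals (hollow n) by move: h; rewrite inE => /andP[].
  have /hollow_diagonalP[x [y [xy e]]] := hdg; exists x, y; split=> //.
  by rewrite -(hollow_boundary xy) -e h orbT.
- by case/orP: h => h; [left; rewrite hd_chord|right; rewrite hollow_boundary].
Qed.

Lemma hd_sd x y i j : hd x y != sd i j.
Proof.
apply/eqP => e; have : ho x \in sd i j by rewrite -e !inE eqxx.
by rewrite !inE -!val_eqE /=; lia.
Qed.

Lemma cross_hd_sd x y i j : x != y -> i != j -> cross p (hd x y) (sd i j) <-> rx i j x y.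
Proof.
move=> xy ij; rewrite -cr_ho_so; split; last exact: cr_cross.
apply: cross_cr => //; rewrite ?(inj_eq (@ho_inj n)) ?(inj_eq (@so_inj n)) //.
exact: hd_sd.
Qed.

Lemma cross_sd x y i j : x != y -> i != j -> sd x y != sd i j ->
  cross p (sd x y) (sd i j) <-> cr x y i j.
Proof.
move=> xy ij ne; rewrite -cr_so; split; last exact: cr_cross.
by apply: cross_cr => //; rewrite ?(inj_eq (@so_inj n)).
Qed.

(** The union in the definition of an accordion diagonal is the [segment_union] of the crossed
    hollow edges, and [segment_union_connectedP] turns its connectedness into the colouring
    condition of [acc]. *)
Lemma accordion_acc i j : i != j -> accordion_diagonal p D (sd i j) <-> acc chord i j.
Proof.
move=> ij; have hdg : sd i j \in diagonals (solid n) by apply/solid_diagonalP; exists i, j.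
pose S : rel 'I_(2 * n) := fun u v => [exists x, [exists y,
  [&& u == ho x, v == ho y, chord x y || adj x y & rx i j x y]]].
have SP u v : reflect (exists x y, [/\ u = ho x, v = ho y, chord x y || adj x y & rx i j x y]) (S u v).
  apply: (iffP existsP) => [[x /existsP[y /and4P[/eqP-> /eqP-> h1 h2]]]|[x [y [-> -> h1 h2]]]].
    by exists x, y.
  by exists x; apply/existsP; exists y; rewrite !eqxx h1.
have rxn x y : rx i j x y -> x != y by cyc.
have hS1 u v : S u v -> u != v.
  by case/SP=> x [y [-> -> _ /rxn h]]; rewrite (inj_eq (@ho_inj n)).
have hS2 u v u' v' : S u v -> S u' v' -> ~~ cr u v u' v'.
  case/SP=> x [y [-> -> h _]] /SP[x' [y' [-> -> h' _]]]; rewrite cr_ho.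
  exact: (edge_nocross chord_noncrossing).
have e : \bigcup_(d in [set d | d \in completion (hollow n) D /\ cross p d (sd i j)]) hull p d =
    segment_union p S.
  apply/seteqP; split=> z.
    case=> d [/completionP[x [y [xy h ->]]] hcr] hz; exists (ho x), (ho y); split=> //.
    by apply/SP; exists x, y; split=> //; apply/(cross_hd_sd xy ij).
  case=> u [v [/SP[x [y [-> -> h hr]]] hz]]; exists (hd x y) => //; split.
    by apply/completionP; exists x, y; split=> //; exact: rxn.
  by apply/cross_hd_sd => //; exact: rxn.
rewrite /accordion_diagonal e; have [f1 f2] := segment_union_connectedP hp hS1 hS2.
split=> [[_ /f1 hc] P hP x y x' y' h1 h2 h3 h4|hacc].
  (* The colouring carried to the hollow labels; the solid labels get [false], but no edge of [S]
     ends in one. *)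
  pose half (u : 'I_(2 * n)) := [exists x, (u == ho x) && P x].
  have halfE z : half (ho z) = P z.
    apply/existsP/idP => [[z' /andP[/eqP/ho_inj -> //]]|h]; by exists z; rewrite eqxx.
  rewrite -!halfE; apply: (hc half _ (ho x) (ho y) (ho x') (ho y')).
  - by move=> u v /SP[s [t [-> -> h h']]]; rewrite !halfE; exact: hP.
  - by apply/SP; exists x, y.
  - by apply/SP; exists x', y'.
split=> //; apply: f2 => P hP u v u' v' /SP[x [y [-> _ h1 h2]]] /SP[x' [y' [-> _ h3 h4]]].
apply: (hacc (fun z => P (ho z)) _ x y x' y') => // s t hst hr.
by apply: hP; apply/SP; exists s, t.
Qed.

Lemma shift_hd a b : shift_diagonal (hd a b) = sd a b.
Proof. by rewrite /shift_diagonal imsetU !imset_set1 !ord_pred_ho. Qed.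

Lemma accordion_sub (E F : {set {set 'I_(2 * n)}}) : accordion_dissection p D E -> F \subset E -> accordion_dissection p D F.
Proof.
case=> -[h1 h2] h3 /fintype.subsetP hFE; split; first split.
- by apply: fintype.subset_trans h1; apply/fintype.subsetP.
- by move=> d e hd' he; apply: h2; exact: hFE.
- by move=> e /hFE; exact: h3.
Qed.

Lemma accordion_elt (E : {set {set 'I_(2 * n)}}) e : accordion_dissection p D E -> e \in E ->
  exists i j, [/\ i != j, ~~ adj i j, acc chord i j & e = sd i j].
Proof.
case=> -[h1 _] h3 he; have /setDP[/solid_diagonalP[i [j [ij ee]]] hb] := fintype.subsetP h1 _ he.
exists i, j; split=> //; first by rewrite -(solid_boundary ij) -ee.
by apply/(accordion_acc ij); rewrite -ee; exact: h3.
Qed.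

Lemma accordionI (E : {set {set 'I_(2 * n)}}) : (forall e, e \in E -> exists i j, [/\ i != j, ~~ adj i j, acc chord i j & e = sd i j]) ->
  (forall i j k l, sd i j \in E -> sd k l \in E -> ~~ cr i j k l) -> accordion_dissection p D E.
Proof.
move=> h1 h2; split; first split.
- apply/fintype.subsetP => e /h1[i [j [ij h _ ->]]]; rewrite inE solid_boundary // h /=.
  by apply/solid_diagonalP; exists i, j.
- move=> d e hd' he ne hcr; have [i [j [ij _ _ ed]]] := h1 _ hd'; have [k [l [kl _ _ ee]]] := h1 _ he.
  rewrite ed ee in hcr ne hd' he; have := h2 _ _ _ _ hd' he.
  by move/negP; apply; apply/cross_sd.
- by move=> e /h1[i [j [ij _ h ->]]]; apply/accordion_acc.
Qed.

(** [sd i i] is a singleton and not a diagonal; the value there is set to 0, as a lamination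
    requires. *)
Definition wt (W : {set 'I_(2 * n)} -> R) i j := if i == j then 0 else W (sd i j).

Lemma wt_lamination W : (forall e, 0 <= W e) ->
  accordion_dissection p D [set e | W e != 0]%SET -> lamination chord (wt W).
Proof.
move=> W0 hW; split.
- by move=> i j; rewrite /wt eq_sym /sd set2C.
- by move=> i j; rewrite /wt; case: ifP.
- move=> i j; rewrite /wt; case: (eqVneq i j) => [_|ij hne]; first by rewrite eqxx.
  have [|k [l [kl h1 h2 e]]] := accordion_elt (e := sd i j) hW; first by rewrite inE.
  by have [_ a1 a2] := same_acc (sd_inj e ij) (And3 kl h1 h2).
- move=> i j k l; rewrite /wt; case: (eqVneq i j) => [_|ij h1]; first by rewrite eqxx.
  case: (eqVneq k l) => [_|kl h2]; first by rewrite eqxx.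
  case: (eqVneq (sd i j) (sd k l)) => [e|ne]; first exact: cr_same_ends (sd_inj e ij).
  apply/negP => hcr; case: hW => -[_ hc] _.
  apply: (hc (sd i j) (sd k l)); rewrite ?inE //.
  by apply/cross_sd.
Qed.

Lemma dcoefE a b i j : chord a b -> i != j ->
  dcoef p (hd a b) (sd i j) = (cr i j a b)%:R - (same i j a b)%:R.
Proof.
move=> /andP[ab _] ij; rewrite /dcoef shift_hd; case: (eqVneq (sd i j) (sd a b)) => [e|ne].
  have h := sd_inj e ij; rewrite h (negbTE (cr_same_ends h)); by rewrite /= sub0r.
have -> : same i j a b = false.
  by apply: contraNF ne => /same_set2 e; apply/eqP; exact: e.
have ne' : sd a b != sd i j by rewrite eq_sym.
have [c1 c2] := cross_sd ab ij ne'; rewrite crC.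
case: asboolP => hc; first by rewrite (c1 hc) subr0.
by have -> : cr a b i j = false by [apply: contra_notF hc]; rewrite subr0.
Qed.

Lemma sum_dcoef W a b : chord a b ->
  (forall e, W e != 0 -> exists i j, i != j /\ e = sd i j) ->
  \sum_e W e * dcoef p (hd a b) e = icoord (wt W) a b.
Proof.
move=> hab hW; have ab : a != b by case/andP: hab.
(* Diagonals are unordered, while [icoord] runs over ordered pairs: putting first the end strictly
   between [a] and [b] counts each crossing diagonal once. *)
pose Q := [set q : 'I_n * 'I_n | btw a q.1 b && btw b q.2 a]%SET.
pose phi (q : 'I_n * 'I_n) := sd q.1 q.2.
have Qn q : q \in Q -> q.1 != q.2 by rewrite inE; cyc.
have phi_inj : {in Q &, injective phi}.
  move=> q q' hq hq' e; have := sd_inj e (Qn _ hq).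
  case: q q' hq hq' {e} => [i j] [i' j']; rewrite !inE /= => /andP[h1 h2] /andP[h3 h4].
  rewrite /same => h5; have /andP[/eqP-> /eqP->] // : (i == i') && (j == j').
  by move: h1 h2 h3 h4 h5; cyc.
have dE e : W e != 0 -> dcoef p (hd a b) e = (e \in [set phi q | q in Q]%SET)%:R - (e == sd a b)%:R.
  move=> /hW[i [j [ij ->]]]; rewrite dcoefE //; congr ((nat_of_bool _)%:R - (nat_of_bool _)%:R).
    apply/idP/imsetP => [hcr|[[k l] hq ekl]].
      have [h|h] : btw a i b && btw b j a \/ btw a j b && btw b i a.
        by apply/orP; move: hcr; cyc.
        by exists (i, j); rewrite ?inE.
      by exists (j, i); rewrite ?inE //; exact: set2C.
    have := sd_inj ekl ij; move: hq; rewrite inE /= /same; cyc.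
  apply/idP/eqP => [/same_set2 e'|e']; [exact: e' | exact: sd_inj e' ij].
transitivity (\sum_e ((if e \in [set phi q | q in Q]%SET then W e else 0) - (if e == sd a b then W e else 0))).
  apply: eq_bigr => e _; case: (eqVneq (W e) 0) => [->|/dE->].
    by rewrite mul0r !if_same subrr.
  by case: (e \in _); case: (e == _); rewrite /= ?mulr1 ?mulr0; lra.
rewrite sumrB -!big_mkcond /= big_imset //= big_pred1_eq /icoord /wt (negbTE ab); congr (_ - _).
rewrite pair_big_dep /=; apply: eq_big => [q|q hq]; first by rewrite inE.
by rewrite (negbTE (Qn _ hq)).
Qed.

Lemma dvector_entry e (k : 'I_#|D|) : dvector p D e 0 k = dcoef p (enum_val k) e.
Proof.
rewrite /dvector summxE (bigD1 k) //= big1 ?addr0 => [|k' hk'].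
  by rewrite !mxE !eqxx mulr1.
by rewrite !mxE eqxx /= eq_sym (negbTE hk') mulr0.
Qed.

Lemma chord_index a b : chord a b -> exists k : 'I_#|D|, enum_val k = hd a b.
Proof. by case/andP=> _ h; exists (enum_rank_in h (hd a b)); rewrite enum_rankK_in. Qed.

Lemma index_chord (k : 'I_#|D|) : exists a b, chord a b /\ enum_val k = hd a b.
Proof. by have := enum_valP k => /chord_of. Qed.

Lemma sum_dvectorE W (k : 'I_#|D|) : (\sum_e W e *: dvector p D e) 0 k = \sum_e W e * dcoef p (enum_val k) e.
Proof. by rewrite summxE; apply: eq_bigr => e _; rewrite mxE dvector_entry. Qed.

Lemma accordion_unique : lam_unique R chord -> forall W W',
  (forall e, 0 <= W e) -> (forall e, 0 <= W' e) ->
  accordion_dissection p D [set e | W e != 0]%SET ->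
  accordion_dissection p D [set e | W' e != 0]%SET ->
  \sum_e W e *: dvector p D e = \sum_e W' e *: dvector p D e -> W =1 W'.
Proof.
move=> huniq W W' W0 W0' hW hW' hs.
have supp (f : {set 'I_(2 * n)} -> R) : accordion_dissection p D [set e | f e != 0]%SET ->
    forall e, f e != 0 -> exists i j, i != j /\ e = sd i j.
  move=> hf e he; have [|i [j [ij _ _ ->]]] := accordion_elt (e := e) hf; first by rewrite inE.
  by exists i, j.
have E : forall i j, wt W i j = wt W' i j.
  apply: huniq; try exact: wt_lamination.
  move=> a b hab; have [k hk] := chord_index hab.
  have := congr1 (fun v : 'rV[R]_#|D| => v 0 k) hs; rewrite !sum_dvectorE hk.
  by rewrite !sum_dcoef //; apply: supp.
have Esd i j : i != j -> W (sd i j) = W' (sd i j).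
  by move=> ij; have := E i j; rewrite /wt (negbTE ij).
move=> e; case: (eqVneq (W e) 0) => [h0|/(supp _ hW)[i [j [ij ->]]]]; last exact: Esd.
by case: (eqVneq (W' e) 0) => [->//|/(supp _ hW')[i [j [ij ->]]]]; exact: Esd.
Qed.

Lemma accordion_exists : lam_exists R chord -> forall v : 'rV[R]_#|D|, exists W,
  [/\ forall e, 0 <= W e, accordion_dissection p D [set e | W e != 0]%SET
    & v = \sum_e W e *: dvector p D e].
Proof.
move=> hex v.
pose x a b := \sum_(k < #|D|) v 0 k * (enum_val k == hd a b)%:R.
have xE a b (k : 'I_#|D|) : enum_val k = hd a b -> x a b = v 0 k.
  move=> hk; rewrite /x (bigD1 k) //= hk eqxx mulr1 big1 ?addr0 // => k' nk.
  by rewrite -hk (inj_eq enum_val_inj) (negbTE nk) mulr0.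
have [w L hw] : exists2 w, lamination chord w & forall a b, chord a b -> icoord w a b = x a b.
  by apply: hex => i j; rewrite /x /hd set2C.
have [sw w0 aw cw] := L.
pose W e := if [pick q : 'I_n * 'I_n | (q.1 != q.2) && (e == sd q.1 q.2)] is Some q then w q.1 q.2 else 0.
have WE i j : i != j -> W (sd i j) = w i j.
  move=> ij; rewrite /W; case: pickP => [[k l] /= /andP[kl /eqP e]|/(_ (i, j))]; last by rewrite /= ij eqxx.
  by have := sd_inj e ij; case/orP => /andP[/eqP-> /eqP->].
have W0 e : 0 <= W e by rewrite /W; case: pickP.
have WS e : W e != 0 -> exists i j, [/\ i != j, w i j != 0 & e = sd i j].
  rewrite /W; case: pickP => [[k l] /= /andP[kl /eqP e']|]; last by rewrite eqxx.
  by move=> h; exists k, l.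
exists W; split=> //.
  apply: accordionI.
    move=> e; rewrite inE => /WS[i [j [ij h ->]]]; have [_ h1 h2] := aw _ _ h.
    by exists i, j.
  have key i j : sd i j \in [set e | W e != 0]%SET -> w i j != 0.
    rewrite inE => /WS[k [l [kl h e]]].
    by have := sd_inj (esym e) kl; case/orP => /andP[/eqP e1 /eqP e2]; rewrite -e1 -e2 // sw.
  by move=> i j k l /key h1 /key h2; exact: cw.
apply/rowP => k; rewrite sum_dvectorE; have [a [b [hab hk]]] := index_chord k.
rewrite hk sum_dcoef //; last by move=> e /WS[i [j [ij _ ->]]]; exists i, j.
rewrite -(xE a b) // -hw //.
have wE i j : wt W i j = w i j.
  rewrite /wt; case: (eqVneq i j) => [->|ij]; last exact: WE.
  by apply/esym/eqP; apply: contraT => /aw[]; rewrite eqxx.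
rewrite /icoord wE; congr (_ - _); apply: eq_bigr => i _; apply: eq_bigr => j _.
by rewrite wE.
Qed.

Lemma accordion_fan : (forall K nx, ~ even_cell chord K nx) ->
  complete_simplicial_fan (accordion_cones p D).
Proof.
move=> hne; have [hex huniq] := lam_exists_unique R chord_noncrossing.
apply: (fan_of_unique_rep (Delta := accordion_dissection p D)).
- exact: accordion_sub.
- exact: accordion_exists.
- exact: accordion_unique (huniq hne).
Qed.
End Bridge.

(** * Cells *)

Section CellBridge.
Variables (R : realType) (n : nat) (p : 'I_(2 * n) -> R * R).
Hypotheses (hn : (2 <= n)%N) (hp : clockwise p).
Variable D : {set {set 'I_(2 * n)}}.
Hypothesis hD : dissection p (hollow n) D.
Implicit Types (i j k l a b c u v : 'I_n) (d e : {set 'I_(2 * n)}) (x y : R * R).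
Let hC := chord_noncrossing hp hD.
Local Notation ch := (chord D).

Definition hollow_chord : rel 'I_(2 * n) := fun u v : 'I_(2 * n) => (u != v) && ([set u; v]%SET \in D).

Lemma hollow_chordP (u v : 'I_(2 * n)) : hollow_chord u v -> exists a b, [/\ ch a b, u = ho a & v = ho b].
Proof.
case/andP=> uv h; have /setDP[dg _] := fintype.subsetP hD.1 _ h.
have /andP[/fintype.subsetP hs _] : ([set u; v]%SET \subset hollow n) && (#|[set u; v]%SET| == 2).
  by move: dg; rewrite inE.
have /hollowP[a ea] : u \in hollow n by apply: hs; rewrite !inE eqxx.
have /hollowP[b eb] : v \in hollow n by apply: hs; rewrite !inE eqxx orbT.
exists a, b; split=> //; rewrite /chord /hd -ea -eb h andbT.
by apply: contraNneq uv => ab; rewrite ea eb ab.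
Qed.

Lemma chord_hollow a b : ch a b -> hollow_chord (ho a) (ho b).
Proof. by case/andP=> ab h; rewrite /hollow_chord (inj_eq (@ho_inj n)) ab. Qed.

Lemma ho_hollow a : ho a \in hollow n. Proof. by apply/hollowP; exists a. Qed.

Lemma hollow_chord_in (u v : 'I_(2 * n)) : hollow_chord u v -> [/\ u \in hollow n, v \in hollow n & u != v].
Proof.
move=> h; have [a [b [_ ea eb]]] := hollow_chordP h.
by split; [rewrite ea ho_hollow|rewrite eb ho_hollow|case/andP: h].
Qed.

Definition open_cells := off_chords p (hollow n) hollow_chord.

Lemma cells_off : hull p (hollow n) `\` \bigcup_(d in [set` D]) hull p d = open_cells.
Proof.
rewrite /open_cells /off_chords; congr (_ `\` _); apply/seteqP; split=> z.
  case=> d /= hd' hz; have [a [b [hab e]]] := chord_of hD hd'.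
  exists (ho a), (ho b); split; first exact: chord_hollow.
  by rewrite -/(hd a b) -e.
by case=> u [v [/andP[_ h] hz]]; exists [set u; v]%SET.
Qed.

Section AtPoint.
Variable x : R * R.
Hypothesis hx : open_cells x.

Lemma x_hull : hull p (hollow n) x. Proof. by case: hx. Qed.

Lemma x_off a b : ch a b -> ar p (ho a) (ho b) x != 0.
Proof.
have /(off_chordsP hp hollow_chord_in)[_ h] := hx.
by move/chord_hollow; exact: h.
Qed.

(* The point x and the vertices strictly between a and b are on opposite sides of the chord. *)
Definition away a b := ch a b && (ar p (ho a) (ho b) x < 0).

Lemma away_or a b : ch a b -> away a b || away b a.
Proof.
move=> h; have h' : ch b a by rewrite (noncrossing_sym b a hC).
rewrite /away h h' (ar_swap p (ho a)) /= oppr_lt0; have := x_off h; case: ltgtP => //.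
Qed.

Lemma away_anti a b : away a b -> ~~ away b a.
Proof.
case/andP=> _ h; rewrite /away (ar_swap p (ho a)) oppr_lt0; apply/negP => /andP[_ h'].
by have := lt_trans h h'; rewrite ltxx.
Qed.

Lemma away_neq a b : away a b -> a != b.
Proof. by case/andP => /andP[]. Qed.

(** By [hull_split] the point [x] lies in the hull of the hollow points outside the open arc from
    [a] to [b]. If all of these were weakly on the wrong side of [a' b'], so would be [x]. *)
Lemma away_compat a b a' b' : away a b -> away a' b' ->
  ~ (forall k, ~~ btw a k b -> ~~ btw b' k a').
Proof.
move=> /andP[h1 h2] /andP[h3 h4] hk.
have [|w [w0 w1 e1 e2]] := hull_split hp (ho_hollow a) (ho_hollow b) _ x_hull (ltW h2).
  by rewrite (inj_eq (@ho_inj n)); case/andP: h1.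
move: h4; rewrite (ar_comb (ho a') (ho b') w1 e1 e2) ltNge => /negP; apply.
apply: sumr_ge0 => u; rewrite inE => /andP[/hollowP[k ->]]; rewrite btw_ho => /hk h.
by rewrite mulr_ge0 // ar_ge0 // btw_ho.
Qed.

Definition cell_vertices := [set v : 'I_n | [forall a : 'I_n, forall b : 'I_n, away a b ==> ~~ btw a v b]]%SET.

Lemma cell_verticesP v : reflect (forall a b, away a b -> ~~ btw a v b) (v \in cell_vertices).
Proof.
rewrite inE; apply: (iffP forallP) => [h a b|h a].
  by move/forallP: (h a) => /(_ b)/implyP.
by apply/forallP => b; apply/implyP; exact: h.
Qed.

Lemma cell_edge_iff a b : a != b ->
  hull p (hd a b) `<=` closure (connected_component open_cells x) <->
  a \in cell_vertices /\ b \in cell_vertices.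
Proof.
move=> ab; have ab' : ho a != ho b by rewrite (inj_eq (@ho_inj n)).
have vert c : hull p (hd a b) (p (ho c)) ->
    hull p (hd a b) `<=` closure (connected_component open_cells x) -> c \in cell_vertices.
  move=> h1 h2; apply/cell_verticesP => a' b' /andP[hc hneg].
  have := cell_sign hp hollow_chord_in (h2 _ h1) hx (chord_hollow hc).
  rewrite leNgt; apply: contra => hin; rewrite nmulr_rlt0 //.
  by apply: (ar_in hp); rewrite btw_ho.
split=> [h|[ha hb]].
  by split; apply: (vert _ _ h); apply: hull_vertex; rewrite !inE eqxx ?orbT.
move=> y hy; apply: (sign_cell hp hollow_chord_in hx).
  by apply: hull_sub hy; apply/fintype.subsetP => u /set2P[]->; exact: ho_hollow.
have neg a' b' : away a' b' -> ar p (ho a') (ho b') y <= 0.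
  move=> haw; case: hy => w [w0 w1 e1 e2]; rewrite (ar_comb _ _ w1 e1 e2) sum_set2 //.
  have h1 : ar p (ho a') (ho b') (p (ho a)) <= 0.
    by apply: (ar_le0 hp); rewrite btw_ho; move/cell_verticesP: ha; apply.
  have h2 : ar p (ho a') (ho b') (p (ho b)) <= 0.
    by apply: (ar_le0 hp); rewrite btw_ho; move/cell_verticesP: hb; apply.
  by have := w0 (ho a); have := w0 (ho b); nra.
move=> u v /hollow_chordP[a' [b' [hc -> ->]]].
case/orP: (away_or hc) => haw.
  by rewrite mulr_le0 ?neg // ltW //; case/andP: haw.
rewrite !(ar_swap p (ho b')) mulrNN.
by rewrite mulr_le0 ?neg // ltW //; case/andP: haw.
Qed.

Lemma cell_vertices_next u : u \in cell_vertices -> (forall b, ~~ away u b) -> ordS u \in cell_vertices.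
Proof.
move=> hu hno; apply/cell_verticesP => a b hab.
have h1 : ~~ btw a u b by move/cell_verticesP: hu; apply.
have h2 : u != a by apply: contraTneq hab => <-.
move: h1 h2 (away_neq hab) (btw_ordS u a) (btw_ordS u b); cyc.
Qed.

(** The starting point of a chord with the largest arc cut off from [x] is a vertex: a chord cutting
    it off would have a larger arc or contradict [away_compat]. If no chord is [away], every point
    is a vertex. *)
Lemma cell_vertices_pt : exists u, u \in cell_vertices.
Proof.
pose size_arc (q : 'I_n * 'I_n) := #|[set k : 'I_n | btw q.1 k q.2]%SET|.
case: (pickP (fun q : 'I_n * 'I_n => away q.1 q.2)) => [q0 hq0|h]; last first.
  exists (Ordinal (ltnW hn)); apply/cell_verticesP => a b hab.
  by have := h (a, b); rewrite /= hab.
have [[a b] /= hab hmax] := @arg_maxnP _ q0 (fun q : 'I_n * 'I_n => away q.1 q.2) size_arc hq0.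
exists a; apply/cell_verticesP => a' b' hab'; apply/negP => hin.
have [_ _ hnc] := hC; have ncr : ~~ cr a b a' b'.
  by case/andP: hab => h1 _; case/andP: hab' => h2 _; exact: hnc.
have ab := away_neq hab.
case: (boolP (btw a b b' || (b == b'))) => hb.
  have := hmax (a', b') hab'; rewrite leqNgt => /negP; apply; apply: proper_card.
  apply/properP; split.
    by apply/fintype.subsetP => k; rewrite !inE /=; move: hin hb ab; cyc.
  by exists a; rewrite !inE //=; cyc.
apply: (away_compat hab hab') => k; move: hin hb ab ncr; cyc.
Qed.

Section AllInterior.
Hypothesis hint : forall u, u \in cell_vertices -> exists b, away u b.

Lemma cell_next_ex : exists nx : 'I_n -> 'I_n, forall u, u \in cell_vertices ->
  away u (nx u) /\ forall b, away u b -> ~~ btw u (nx u) b.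
Proof.
have /boolp.choice[nx h] : forall u, exists c, u \in cell_vertices ->
   away u c /\ forall b, away u b -> ~~ btw u c b.
  move=> u; case: (boolP (u \in cell_vertices)) => hu; last by exists u.
  have [b0 hb0] := hint hu.
  (* The way up from [k] to [u]; minimizing it selects, among the chords from [u] that are away from
     [x], the one with the longest arc. *)
  pose d (k : 'I_n) := if (k < u)%N then (u - k)%N else (u + n - k)%N.
  have [c hc hmin] := arg_minnP d hb0.
  exists c => _; split=> // b hb; apply/negP => hin.
  have := hmin b hb; have cn := away_neq hc; have bn := away_neq hb.
  move: hin cn bn; rewrite /d /btw -!val_eqE /=.
  have := ltn_ord u; have := ltn_ord b; have := ltn_ord c.
  by case: (ltnP c u); case: (ltnP b u); lia.
by exists nx.
Qed.

Lemma cell_even_data : exists nx : 'I_n -> 'I_n, [/\ next_in cell_vertices nx,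
  forall u, u \in cell_vertices -> nx (nx u) != u,
  forall u, u \in cell_vertices -> ch u (nx u)
  & forall a b, a \in cell_vertices -> b \in cell_vertices -> ch a b -> b = nx a \/ a = nx b].
Proof.
have [nx hnx] := cell_next_ex; have [_ _ hnc] := hC; exists nx.
have nxK u : u \in cell_vertices -> nx u \in cell_vertices.
  (* A chord cutting off [nx u] must have [u] as an end. If it starts there, its arc is longer than
     the maximal one; if it ends there, [away_compat] excludes it. *)
  move=> hu; have [hau hmax] := hnx u hu; apply/cell_verticesP => a b hab; apply/negP => hin.
  have ncr : ~~ cr u (nx u) a b.
    by case/andP: hau => h1 _; case/andP: hab => h2 _; exact: hnc.
  have hub : ~~ btw a u b by move/cell_verticesP: hu; apply.
  have [/eqP e|/eqP e] : u == a \/ u == b.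
    by apply/orP; move: hin ncr hub (away_neq hau) (away_neq hab); cyc.
    by rewrite -e in hab hin; have := hmax b hab; rewrite hin.
  apply: (away_compat hau hab) => k; move: hin e (away_neq hau) (away_neq hab); cyc.
split=> //.
- move=> u hu; have [hau _] := hnx u hu; split; first exact: nxK.
    by rewrite eq_sym (away_neq hau).
  by move=> k /cell_verticesP; apply.
- move=> u hu; have [hau _] := hnx u hu; have [hav _] := hnx _ (nxK _ hu).
  by apply: contraTneq hav => ->; exact: away_anti.
- by move=> u hu; have [/andP[]] := hnx u hu.
have one a b : a \in cell_vertices -> b \in cell_vertices -> away a b -> b = nx a.
  move=> ha hb hab; have [haa hmax] := hnx a ha.
  have h1 := hmax b hab; have h2 : ~~ btw a b (nx a) by move/cell_verticesP: hb; apply.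
  by move: h1 h2 (away_neq hab) (away_neq haa); cyc.
move=> a b ha hb hab; case/orP: (away_or hab) => h; [left|right]; exact: one.
Qed.
End AllInterior.

Lemma cell_edges_card (nx : 'I_n -> 'I_n) : next_in cell_vertices nx ->
  (forall u, u \in cell_vertices -> nx (nx u) != u) ->
  (forall u, u \in cell_vertices -> ch u (nx u)) ->
  (forall a b, a \in cell_vertices -> b \in cell_vertices -> ch a b -> b = nx a \/ a = nx b) ->
  cell_edges p (hollow n) D (closure (connected_component open_cells x)) =
    [set hd u (nx u) | u in cell_vertices]%SET /\
  #|cell_edges p (hollow n) D (closure (connected_component open_cells x))| = #|cell_vertices|.
Proof.
move=> hK h3 he hc.
have e : cell_edges p (hollow n) D (closure (connected_component open_cells x)) =
    [set hd u (nx u) | u in cell_vertices]%SET.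
  apply/setP => d; rewrite inE; apply/andP/imsetP => [[/(completionP hD)[a [b [ab hab ->]]] /asboolP]|[u hu ->]].
    move/(cell_edge_iff ab) => [ha hb]; case/orP: hab => [hab|].
      have [->|->] := hc a b ha hb hab; first by exists a.
      by exists b => //; exact: set2C.
    have gap u v : u \in cell_vertices -> v \in cell_vertices -> ordS u = v -> False.
      move=> hu hv e; have [_ _ /(_ v hv)] := hK u hu; have := ends_btw hC (he u hu).
      by rewrite e => ->.
    by case/orP => /eqP /gap h; exfalso; apply: h.
  have [hv nu _] := hK u hu; have nu' : u != nx u by rewrite eq_sym.
  split; first by apply/(completionP hD); exists u, (nx u); rewrite he.
  by apply/asboolP/(cell_edge_iff nu').
split=> //; rewrite e card_in_imset // => u v hu hv huv.
have [_ nu _] := hK u hu; have := hd_inj huv _; rewrite eq_sym => /(_ nu).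
case/orP => /andP[/eqP e1 /eqP e2] //.
by have := h3 v hv; rewrite -e1 e2 eqxx.
Qed.
End AtPoint.

(** If some vertex [u] of the cell had no chord leaving it away from [x], then [ordS u] would be a
    vertex too and the boundary edge between them an edge of the cell, although all its edges belong
    to [D]. *)
Lemma even_interior_even_cell : (exists C, even_interior_cell p D C) ->
  exists K nx, even_cell ch K nx.
Proof.
case=> _ [[x +->]]; rewrite cells_off => hx hodd hsub.
have hint u : u \in cell_vertices x -> exists b, away x u b.
  move=> hu; apply: contrapT => hno.
  have hno' b : ~~ away x u b by apply/negP => h; apply: hno; exists b.
  have hS := cell_vertices_next hu hno'.
  have nu : u != ordS u by rewrite eq_sym ordS_neq.
  have hb : hd u (ordS u) \in boundary_edges (hollow n).
    by rewrite hollow_boundary // /adj eqxx.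
  have hd' : hd u (ordS u) \in D.
    apply: (fintype.subsetP hsub); rewrite inE; apply/andP; split; first by rewrite inE hb orbT.
    by apply/asboolP/(cell_edge_iff hx nu).
  by have /setDP[_] := fintype.subsetP hD.1 _ hd'; rewrite hb.
have [nx [h1 h2 h3 h4]] := cell_even_data hx hint.
have [_ hcard] := cell_edges_card hx h1 h2 h3 h4.
exists (cell_vertices x), nx; split=> //; first exact: cell_vertices_pt.
by rewrite -hcard.
Qed.

Lemma even_cell_even_interior K nx : even_cell ch K nx -> exists C, even_interior_cell p D C.
Proof.
case=> [[u0 hu0] hK h3 he hc hodd].
pose A := [set ho k | k in K]%SET.
have A0 : (#|A| > 0)%N by rewrite card_gt0; apply/set0Pn; exists (ho u0); apply: imset_f.
pose r : R := (#|A|%:R)^-1.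
have r0 : 0 < r by rewrite invr_gt0 ltr0n.
(* The barycentre of the vertices of [K] serves as the point defining the cell. *)
pose x : R * R := (\sum_(u in A) r * (p u).1, \sum_(u in A) r * (p u).2).
have rs : \sum_(u in A) r = 1.
  by rewrite sumr_const -mulr_natr mulVf // pnatr_eq0 -lt0n.
have xA : hull p A x by exists (fun=> r); split=> // u; exact: ltW.
have arx (a b : 'I_(2 * n)) : ar p a b x = \sum_(u in A) r * ar p a b (p u) by exact: (ar_comb a b (w := fun=> r)).
(* With at least three vertices in [K], one is off the given chord, which makes the sign of the
   barycentre strict. *)
have third a b : exists2 k, k \in K & (k != a) && (k != b).
  have hu1 : nx u0 \in K by case: (hK u0 hu0).
  have hu2 : nx (nx u0) \in K by case: (hK _ hu1).
  have [_ n1 _] := hK u0 hu0; have [_ n2 _] := hK _ hu1; have n3 := h3 _ hu0.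
  case: (boolP ((u0 != a) && (u0 != b))) => [|m1]; first by exists u0.
  case: (boolP ((nx u0 != a) && (nx u0 != b))) => [|m2]; first by exists (nx u0).
  exists (nx (nx u0)) => //; move: n1 n2 n3 m1 m2; cyc.
have neg a b : a != b -> (forall k, k \in K -> ~~ btw a k b) -> ar p (ho a) (ho b) x < 0.
  move=> ab hk; rewrite arx; have [k kK /andP[ka kb]] := third a b.
  have hkA : ho k \in A by apply: imset_f.
  rewrite (bigD1 (ho k)) //= -oppr_gt0 opprD ltr_pwDl //.
    rewrite -mulrN mulr_gt0 // oppr_gt0; apply: (ar_out hp); rewrite btw_ho.
    by move: (hk k kK) ab ka kb; cyc.
  rewrite oppr_ge0; apply: sumr_le0 => v /andP[/imsetP[l hl ->] _].
  by rewrite mulr_ge0_le0 ?(ltW r0) // (ar_le0 hp) // btw_ho hk.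
(* A chord with both ends in [K] is a cell edge. Any other chord has an end strictly inside the arc
   of some cell edge, and cannot leave the closed arc without crossing that edge. *)
have sides a b : ch a b -> (forall k, k \in K -> ~~ btw a k b) \/ (forall k, k \in K -> ~~ btw b k a).
  move=> hab; have [_ _ hnc] := hC.
  case: (boolP (a \in K)) => ha.
    case: (boolP (b \in K)) => hb.
      case: (hc a b ha hb hab) => e; [left|right] => k hk; rewrite e.
        by case: (hK a ha) => _ _; apply.
      by case: (hK b hb) => _ _; apply.
    have [w hw /orP[hwb|/andP[/eqP/val_inj e _]]] := next_arc hK b hu0; last first.
      by case/negP: hb; rewrite e; case: (hK w hw).
    have [hw' nw gw] := hK w hw; have := hnc _ _ _ _ hab (he w hw) => ncr.
    case: (eqVneq a w) => [e|aw].
      by left=> k hk; move: (gw k hk) hwb; rewrite e; cyc.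
    by right=> k hk; move: (gw k hk) (gw a ha) hwb ncr aw; cyc.
  have [w hw /orP[hwa|/andP[/eqP/val_inj e _]]] := next_arc hK a hu0; last first.
    by case/negP: ha; rewrite e; case: (hK w hw).
  have [hw' nw gw] := hK w hw; have := hnc _ _ _ _ hab (he w hw) => ncr.
  have ab : a != b by case/andP: hab.
  case: (boolP (btw a b (nx w) || (b == nx w))) => hb.
    by left=> k hk; move: (gw k hk) hwa ncr hb ab nw; cyc.
  by right=> k hk; move: (gw k hk) hwa ncr hb ab nw; cyc.
have hx : open_cells x.
  apply/(off_chordsP hp hollow_chord_in); split.
    by apply: hull_sub xA; apply/fintype.subsetP => u /imsetP[k _ ->]; exact: ho_hollow.
  move=> u v /hollow_chordP[a [b [hab -> ->]]]; have ab : a != b by case/andP: hab.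
  case: (sides a b hab) => h; first by rewrite lt_eqF // neg.
  by rewrite (ar_swap p (ho b)) oppr_eq0 lt_eqF // neg // eq_sym.
have KE : cell_vertices x = K.
  apply/setP => k; apply/cell_verticesP/idP => [h|hk a b /andP[hab hneg]].
    have [w hw /orP[hwk|/andP[/eqP/val_inj -> _]]] := next_arc hK k hu0; last by case: (hK w hw).
    have [hw' nw gw] := hK w hw.
    have := h w (nx w); rewrite hwk => /(_ _)/negP []//.
    by rewrite /away he // neg // eq_sym.
  case: (sides a b hab) => [|h]; first by apply.
  have ba : b != a by rewrite eq_sym; case/andP: hab.
  by have := neg _ _ ba h; rewrite (ar_swap p (ho a)) oppr_lt0 ltNge (ltW hneg).
rewrite -KE in hK h3 he hc.
have [eE eC] := cell_edges_card hx hK h3 he hc.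
exists (closure (connected_component open_cells x)); split.
- by exists x; rewrite cells_off.
- by rewrite eC KE.
- by rewrite eE; apply/fintype.subsetP => d /imsetP[u hu ->]; case/andP: (he u hu).
Qed.
End CellBridge.

(** * The d-vectors around an even cell *)

Section Entry.
Variables (R : realType) (m : nat) (k : 'I_m).
Definition entry (v : 'rV[R]_m) : R := v 0 k.
Lemma entry_scalar : scalar entry.
Proof. by move=> a u v; rewrite /entry !mxE. Qed.
HB.instance Definition _ := GRing.isLinear.Build R 'rV[R]_m R *%R entry entry_scalar.
End Entry.

Section EvenCellCone.
Variables (R : realType) (n : nat) (p : 'I_(2 * n) -> R * R).
Hypothesis hp : clockwise p.
Variable D : {set {set 'I_(2 * n)}}.
Hypothesis hD : dissection p (hollow n) D.
Variables (K : {set 'I_n}) (nx : 'I_n -> 'I_n).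
Hypothesis hc : even_cell (chord D) K nx.
Let hN := chord_noncrossing hp hD.

Definition leaf u := sd (beyond (chord D) nx u) (beyond (chord D) nx (nx u)).

Definition edge_vector u : 'rV[R]_#|D| := \row_k (enum_val k == hd u (nx u))%:R.

Let nK u : u \in K -> nx u \in K. Proof. by case/(even_next hc). Qed.

Lemma edge_inj u v : u \in K -> v \in K -> (hd u (nx u) == hd v (nx v)) = (u == v).
Proof.
move=> hu hv; apply/eqP/eqP => [e|-> //]; have [_ nu _] := even_next hc hu.
have /orP[/andP[/eqP //]|/andP[/eqP e1 /eqP e2]] : same u (nx u) v (nx v).
  by apply: hd_inj e _; rewrite eq_sym.
by have := even_ge3 hc hv; rewrite -e1 e2 eqxx.
Qed.

Lemma dvector_leaf u : u \in K ->
  dvector p D (leaf u) = edge_vector u + edge_vector (nx u).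
Proof.
move=> hu; apply/rowP => k; rewrite !mxE dvector_entry.
have [a [b [hab ->]]] := index_chord hD k; have ab : a != b by case/andP: hab.
rewrite (dcoefE hp hab (beyond_neq hN hc hu)) (beyond_cross hN hc hu hab).
rewrite (negbTE (beyond_not_chord hN hc hu hab)) subr0.
have sE s t : same a b s t = (hd a b == hd s t).
  by apply/idP/eqP => [h|e]; [exact: same_set2 | exact: hd_inj e ab].
rewrite !sE; case: eqP => [->|_]; last by rewrite add0r.
rewrite edge_inj ?nK //; have [_ nu _] := even_next hc hu.
by rewrite eq_sym (negbTE nu) addr0.
Qed.

Lemma leaves_accordion : accordion_dissection p D [set leaf u | u in K]%SET.
Proof.
apply: (accordionI hp hD) => [_ /imsetP[u hu ->]|i j k l /imsetP[u hu e] /imsetP[v hv e']].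
  exists (beyond (chord D) nx u), (beyond (chord D) nx (nx u)).
  split=> //; [exact: (beyond_neq hN hc)|exact: (beyond_nadj hN hc)|exact: (beyond_acc hN hc)].
have := beyond_nocross hN hc hu hv.
have := sd_inj (esym e) (beyond_neq hN hc hu); have := sd_inj (esym e') (beyond_neq hN hc hv).
rewrite /same; cyc.
Qed.

Lemma even_cell_not_simplicial : ~ is_simplicial (accordion_cones p D).
Proof.
move=> hS; have [u0 hu0] := even_pt hc.
have /boolp.choice[kap hk] : forall u, exists k : 'I_#|D|, u \in K -> enum_val k = hd u (nx u).
  have [k0 _] := chord_index (even_edge hc hu0).
  move=> u; case: (boolP (u \in K)) => hu; last by exists k0.
  by have [k ek] := chord_index (even_edge hc hu); exists k.
pose f u : {scalar 'rV[R]_#|D|} := @entry R #|D| (kap u).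
have fE u v : u \in K -> v \in K -> f u (edge_vector v) = (u == v)%:R.
  by move=> hu hv; rewrite /f /= /entry mxE hk // edge_inj.
(* Distinctness of the leaves is read off from their d-vectors: equal sums of two unit vectors for
   [u] and [v] distinct would force [u = nx v] and [v = nx u], impossible with at least three
   vertices. *)
have linj : {in K &, injective leaf}.
  move=> u v hu hv e; have := congr1 (dvector p D) e; rewrite !dvector_leaf // => ev.
  have step s t : s \in K -> t \in K -> edge_vector s + edge_vector (nx s) = edge_vector t + edge_vector (nx t) ->
      s != t -> s = nx t.
    move=> hs ht /(congr1 (f s)); rewrite !linearD /= -![entry _ _]/(f s _) !fE ?nK // eqxx.
    have [_ ns _] := even_next hc hs; rewrite [s == nx s]eq_sym (negbTE ns) addr0 => h /negbTE st.
    by move: h; rewrite st add0r; case: eqP => // _ /eqP; rewrite oner_eq0.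
  apply/eqP; apply: contraT => uv; have e1 := step _ _ hu hv ev uv.
  rewrite eq_sym in uv; have e2 := step _ _ hv hu (esym ev) uv.
  by have := even_ge3 hc hv; rewrite -e1 -e2 eqxx.
have [|s fs es] := hS (cone_gen [seq dvector p D e | e <- enum [set leaf u | u in K]%SET]).
  by exists [set leaf u | u in K]%SET => //; exact: leaves_accordion.
apply: (even_cone_not_simplicial (even_next hc) (even_card hc) (even_pt hc) (@even_ge3 _ _ _ _ hc) fE);
  last by exists s; [exact: fs|exact: es].
move=> x; split=> [/cone_genP[W [W0 WE ->]]|[a a0 ->]].
  exists (W \o leaf) => [u|]; first exact: W0.
  rewrite (bigID (mem [set leaf u | u in K]%SET)) /= [X in _ + X]big1 ?addr0; last first.
    by move=> e /WE ->; rewrite scale0r.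
  by rewrite big_imset //=; apply: eq_bigr => u hu; rewrite dvector_leaf.
apply/cone_genP; exists (fun e => \sum_(u in K | leaf u == e) a u); split.
- by move=> e; exact: sumr_ge0.
- by move=> e he; apply: big1 => u /andP[hu /eqP e']; case/negP: he; rewrite -e'; exact: imset_f.
- rewrite (partition_big leaf xpredT) //=; apply: eq_bigr => e _; rewrite scaler_suml.
  by apply: eq_bigr => u /andP[hu /eqP <-]; rewrite dvector_leaf.
Qed.
End EvenCellCone.

Theorem theorem3p4 (R : realType) (n : nat) (hn : (2 <= n)%N)
    (p : 'I_(2 * n) -> R * R)
    (hcircle : on_unit_circle p) (hclockwise : clockwise p)
    (D : {set {set 'I_(2 * n)}}) (hD : dissection p (hollow n) D) :
  complete_simplicial_fan (accordion_cones p D) <->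
  ~ (exists C : set (R * R), even_interior_cell p D C).
Proof.
split=> [[_ hS _] /(even_interior_even_cell hn hclockwise hD)[K [nx hc]]|hno].
  exact: (even_cell_not_simplicial hclockwise hD hc hS).
apply: (accordion_fan hclockwise hD) => K nx hc; apply: hno.
exact: (even_cell_even_interior hclockwise hD hc).
Qed.
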